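(* Let $\mathbb{K}$ be a field, and let $A_n^{Q,\Gamma}(\mathbb{K})$ and $A_m^{Q',\Gamma'}(\mathbb{K})$ be two multiparameter quantized Weyl algebras, where $Q=(q_1,\ldots,q_n)$, $\Gamma=(\gamma_{ij})$, $Q'=(q'_1,\ldots,q'_m)$, $\Gamma'=(\gamma'_{ij})$, with standard generators $x_i,y_i$ ($1\le i\le n$) and $x'_i,y'_i$ ($1\le i\le m$), respectively. (I) Assume that $q_1,\ldots,q_n$ and $q'_1,\ldots,q'_m$ are not roots of unity. Then $A_n^{Q,\Gamma}(\mathbb{K})$ and $A_m^{Q',\Gamma'}(\mathbb{K})$ are isomorphic as $\mathbb{K}$-algebras if and only if the following two conditions hold: (i) $m=n$; (ii) there exists a sign vector $\varepsilon\in\{1,-1\}^n$ such that for all $i\in\{1,\ldots,n\}$ $$q_i'=q_i^{\varepsilon_i},$$ and for all $i,j\in\{1,\ldots,n\}$ with $i<j$ $$\gamma'_{ij}=\begin{cases}\gamma_{ij}, & \text{if }(\varepsilon_i,\varepsilon_j)=(1,1),\\ \gamma_{ji}, & \text{if }(\varepsilon_i,\varepsilon_j)=(-1,1),\\ q_i^{-1}\gamma_{ji}, & \text{if }(\varepsilon_i,\varepsilon_j)=(1,-1),\\ q_i\gamma_{ij}, & \text{if }(\varepsilon_i,\varepsilon_j)=(-1,-1).\end{cases}$$ (II) If conditions (i) and (ii) above hold, then for any $\mu=(\mu_1,\ldots,\mu_n)\in(\mathbb{K}^* )^n$ and $\varepsilon=(\varepsilon_1,\ldots,\varepsilon_n)\in\{\pm1\}^n$,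 there exists a unique $\mathbb{K}$-algebra isomorphism $$\varphi_{\mu,\varepsilon}:A_n^{Q,\Gamma}(\mathbb{K})\longrightarrow A_m^{Q',\Gamma'}(\mathbb{K})$$ such that for all $i\in\{1,\ldots,n\}$ $$\varphi_{\mu,\varepsilon}(x_i)=\begin{cases}\mu_i x_i', & \varepsilon_i=1,\\ \mu_i y_i', & \varepsilon_i=-1,\end{cases}\qquad \varphi_{\mu,\varepsilon}(y_i)=\begin{cases}\lambda_i\mu_i^{-1}y_i', & \varepsilon_i=1,\\ -\lambda_i\mu_i^{-1}x_i', & \varepsilon_i=-1,\end{cases}$$ where $\lambda=\lambda(\varepsilon)=(\lambda_1,\ldots,\lambda_n)\in(\mathbb{K}^* )^n$ is defined by the recursion relation $\lambda_i=q_i^{(\varepsilon_i-1)/2}\lambda_{i-1}$, $\lambda_0=1$. Finally, $(\mu,\varepsilon)\mapsto\varphi_{\mu,\varepsilon}$ defines a bijection between $(\mathbb{K}^* )^n\times\{\pm1\}^n$ and the set of isomorphisms $A_n^{Q,\Gamma}(\mathbb{K})\to A_m^{Q',\Gamma'}(\mathbb{K})$.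
   Context: $\mathbb{K}$ is an arbitrary field and $\mathbb{K}^*=\mathbb{K}\setminus\{0\}$. Let $n$ be a positive integer, $Q=(q_1,\ldots,q_n)\in(\mathbb{K}^* )^n$, and $\Gamma=(\gamma_{ij})$ a multiplicatively skew-symmetric $n\times n$ matrix with entries in $\mathbb{K}^*$ (that is, $\gamma_{ii}=1$ and $\gamma_{ij}\gamma_{ji}=1$ for all $i,j$). The multiparameter quantized Weyl algebra $A_n^{Q,\Gamma}(\mathbb{K})$ is the unital associative $\mathbb{K}$-algebra with (standard) generators $x_1,y_1,\ldots,x_n,y_n$ and defining relations - $y_iy_j=\gamma_{ij}y_jy_i$ for all $i,j\in\{1,\ldots,n\}$; - $x_ix_j=q_i\gamma_{ij}x_jx_i$ for $i<j$; - $x_iy_j=\gamma_{ji}y_jx_i$ for $i<j$; - $x_iy_j=q_j\gamma_{ji}y_jx_i$ for $i>j$; - $x_jy_j-q_jy_jx_j=1+\sum_{k=1}^{j-1}(q_k-1)y_kx_k$ for all $j\in\{1,\ldots,n\}$. The algebra $A_m^{Q',\Gamma'}(\mathbb{K})$ is defined in the same way from a positive integer $m$, $Q'=(q'_1,\ldots,q'_m)\in(\mathbb{K}^* )^m$ and a multiplicatively skew-symmetric $m\times m$ matrix $\Gamma'=(\gamma'_{ij})$ with entries in $\mathbb{K}^*$, with generators $x'_i,y'_i$.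
   Formalization: In (II), ε ranges only over the sign vectors satisfying (ii), since for other ε (e.g. n=1, q'=q, ε=-1) no such isomorphism exists; the final bijection is between these (μ,ε) and the isomorphisms, and assumes, as in (I), that no q_i, q'_i is a root of unity (it fails for q_1=1). *)

(* Defs.v *)
From HB Require Import structures.
From mathcomp Require Import all_boot all_algebra.
From mathcomp Require Import boolp classical_sets functions.
From mathcomp Require Import monalg.

Set Implicit Arguments.
Unset Strict Implicit.
Unset Printing Implicit Defensive.

Import GRing.Theory.

Local Open Scope ring_scope.
Local Open Scope classical_set_scope.
Local Open Scope quotient_scope.

(* Finite sums of elements a * s * b with s in S. *)
Inductive ideal2 (R : pzRingType) (S : R -> Prop) : R -> Prop :=
| ideal2_0 : ideal2 S 0
| ideal2_D a s b r : S s -> ideal2 S r -> ideal2 S (a * s * b + r).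

(* pres S is the quotient of the free algebra K<I> by the two-sided ideal
   generated by S.  It is declared as a ring and a K-module rather than as an
   algType K: the latter includes 1 != 0, which for an algebra given by
   generators and relations is a theorem and not part of the construction. *)
Section Presentation.
Variables (K : comNzRingType) (I : choiceType).

Local Notation FA := {malg K[{fmonom I}]}.

Implicit Types (S : FA -> Prop) (a b r s : FA) (c : K).

Definition pres_ideal S : {pred FA} := fun r => `[< ideal2 S r >].

Lemma ideal2_add S r s : ideal2 S r -> ideal2 S s -> ideal2 S (r + s).
Proof.
elim=> [|a t b u St _ IH] Is; first by rewrite add0r.
by rewrite -addrA; apply: ideal2_D => //; apply: IH.
Qed.

Lemma ideal2_mull S a r : ideal2 S r -> ideal2 S (a * r).
Proof.
elim=> [|b s d t Ss _ IH]; first by rewrite mulr0; apply: ideal2_0.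
by rewrite mulrDr !mulrA; apply: ideal2_D.
Qed.

Lemma ideal2_mulr S a r : ideal2 S r -> ideal2 S (r * a).
Proof.
elim=> [|b s d t Ss _ IH]; first by rewrite mul0r; apply: ideal2_0.
by rewrite mulrDl -(mulrA (b * s)); apply: ideal2_D.
Qed.

Lemma pres_ideal_zmod S : zmod_closed (pres_ideal S).
Proof.
split=> [|r s /asboolP Ir /asboolP Is]; apply/asboolP; first exact: ideal2_0.
by apply: ideal2_add => //; rewrite -mulN1r; apply: ideal2_mull.
Qed.

HB.instance Definition _ S :=
  GRing.isZmodClosed.Build FA (pres_ideal S) (pres_ideal_zmod S).

Local Notation quot S := (@Quotient.quot FA (pres_ideal S)).

Definition pres S : Type := quot S.

HB.instance Definition _ S := GRing.Zmodule.on (pres S).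

Section Structure.
Variable S : FA -> Prop.

Local Notation A := (pres S).

Definition pres_proj r : A := \pi_(quot S) r.

Definition pres_lift (u : A) : FA := repr (u : (quot S)).

Lemma pres_liftK u : pres_proj (pres_lift u) = u.
Proof. exact: reprK. Qed.

Lemma pres_projE r s : pres_proj r = pres_proj s <-> ideal2 S (r - s).
Proof.
have -> : (pres_proj r = pres_proj s) = (pres_proj r == pres_proj s) :> Prop.
  by apply/propext; split=> /eqP.
by rewrite -[_ == _]Quotient.idealrBE; split=> /asboolP.
Qed.

Lemma pres_lift_proj r : ideal2 S (pres_lift (pres_proj r) - r).
Proof. by apply/pres_projE; rewrite pres_liftK. Qed.

Lemma pres_projD r s : pres_proj (r + s) = pres_proj r + pres_proj s.
Proof. exact: (raddfD \pi_(quot S)). Qed.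

Definition pres_one : A := pres_proj 1.
Definition pres_mul (u v : A) : A := pres_proj (pres_lift u * pres_lift v).
Definition pres_scale c (u : A) : A := pres_proj (c *: pres_lift u).

Lemma pres_projM r s : pres_mul (pres_proj r) (pres_proj s) = pres_proj (r * s).
Proof.
apply/pres_projE; set r' := pres_lift _; set s' := pres_lift _.
have -> : r' * s' - r * s = (r' - r) * s' + r * (s' - s).
  by rewrite mulrBl mulrBr addrA subrK.
apply: ideal2_add; first by apply: ideal2_mulr; apply: pres_lift_proj.
by apply: ideal2_mull; apply: pres_lift_proj.
Qed.

Lemma pres_projZ c r : pres_scale c (pres_proj r) = pres_proj (c *: r).
Proof.
apply/pres_projE; rewrite -scalerBr -mul_malgC; apply: ideal2_mull.
exact: pres_lift_proj.
Qed.

Lemma pres_mulA : associative pres_mul.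
Proof.
move=> u v w; rewrite -(pres_liftK u) -(pres_liftK v) -(pres_liftK w).
by rewrite !pres_projM mulrA.
Qed.

Lemma pres_mul1l : left_id pres_one pres_mul.
Proof. by move=> u; rewrite -(pres_liftK u) pres_projM mul1r. Qed.

Lemma pres_mul1r : right_id pres_one pres_mul.
Proof. by move=> u; rewrite -(pres_liftK u) pres_projM mulr1. Qed.

Lemma pres_mulDl : left_distributive pres_mul +%R.
Proof.
move=> u v w; rewrite -(pres_liftK u) -(pres_liftK v) -(pres_liftK w).
by rewrite -pres_projD !pres_projM mulrDl pres_projD.
Qed.

Lemma pres_mulDr : right_distributive pres_mul +%R.
Proof.
move=> u v w; rewrite -(pres_liftK u) -(pres_liftK v) -(pres_liftK w).
by rewrite -pres_projD !pres_projM mulrDr pres_projD.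
Qed.

HB.instance Definition _ := GRing.Zmodule_isPzRing.Build A
  pres_mulA pres_mul1l pres_mul1r pres_mulDl pres_mulDr.

Lemma pres_scaleA c d u : pres_scale c (pres_scale d u) = pres_scale (c * d) u.
Proof. by rewrite -(pres_liftK u) !pres_projZ scalerA. Qed.

Lemma pres_scale1 : left_id 1 pres_scale.
Proof. by move=> u; rewrite -(pres_liftK u) pres_projZ scale1r. Qed.

Lemma pres_scaleDr : right_distributive pres_scale +%R.
Proof.
move=> c u v; rewrite -(pres_liftK u) -(pres_liftK v) -pres_projD !pres_projZ.
by rewrite scalerDr pres_projD.
Qed.

Lemma pres_scaleDl u : {morph pres_scale^~ u : c d / c + d}.
Proof.
by move=> c d; rewrite -(pres_liftK u) !pres_projZ scalerDl pres_projD.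
Qed.

HB.instance Definition _ := GRing.Zmodule_isLmodule.Build K A
  pres_scaleA pres_scale1 pres_scaleDr pres_scaleDl.

Lemma pres_scalerAl c (u v : A) : c *: (u * v) = (c *: u) * v.
Proof.
rewrite -(pres_liftK u) -(pres_liftK v).
by rewrite /GRing.scale /GRing.mul /= !(pres_projM, pres_projZ) scalerAl.
Qed.

Lemma pres_scalerAr c (u v : A) : c *: (u * v) = u * (c *: v).
Proof.
rewrite -(pres_liftK u) -(pres_liftK v).
rewrite /GRing.scale /GRing.mul /= !(pres_projM, pres_projZ); congr pres_proj.
rewrite -!mul_malgC !mulrA; congr (_ * _).
rewrite malgM_def [RHS]malgM_def fgmulUg fgmulgU; apply: eq_bigr => k _.
by rewrite mul1m mulm1 mulrC.
Qed.

Definition pres_gen (i : I) : A := pres_proj << fmu i >>.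

End Structure.
End Presentation.

Section WeylAlgebra.
Variables (K : fieldType) (n : nat) (q : 'I_n -> K) (g : 'M[K]_n).

Local Notation FA := {malg K[{fmonom ('I_n + 'I_n)%type}]}.
Local Notation X i := (<< fmu (inl i) >> : FA).
Local Notation Y i := (<< fmu (inr i) >> : FA).

(* Each relation u = v is recorded as the element u - v. *)
Inductive weyl_rel : FA -> Prop :=
| weyl_yy (i j : 'I_n) : weyl_rel (Y i * Y j - g i j *: (Y j * Y i))
| weyl_xx (i j : 'I_n) of (i < j)%N :
    weyl_rel (X i * X j - (q i * g i j) *: (X j * X i))
| weyl_xy_lt (i j : 'I_n) of (i < j)%N :
    weyl_rel (X i * Y j - g j i *: (Y j * X i))
| weyl_xy_gt (i j : 'I_n) of (j < i)%N :
    weyl_rel (X i * Y j - (q j * g j i) *: (Y j * X i))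
| weyl_xy_eq (j : 'I_n) :
    weyl_rel (X j * Y j - q j *: (Y j * X j)
              - (1 + \sum_(k < n | (k < j)%N) (q k - 1) *: (Y k * X k))).

Definition weyl : Type := pres weyl_rel.

HB.instance Definition _ := GRing.PzRing.on weyl.
HB.instance Definition _ := GRing.Lmodule.on weyl.

Definition weyl_x (i : 'I_n) : weyl := pres_gen weyl_rel (inl i).
Definition weyl_y (i : 'I_n) : weyl := pres_gen weyl_rel (inr i).

End WeylAlgebra.

Definition mul_skew_symmetric (K : fieldType) n (g : 'M[K]_n) :=
  (forall i, g i i = 1) /\ (forall i j, g i j * g j i = 1).

Definition is_root_of_unity (K : fieldType) (z : K) :=
  exists2 k, (0 < k)%N & k.-unity_root z.

(* Isomorphisms of K-algebras; lrmorphism would require the algType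
   structure. *)
Definition algebra_iso (K : fieldType) n m (q : 'I_n -> K) (g : 'M[K]_n)
    (q' : 'I_m -> K) (g' : 'M[K]_m) : set (weyl q g -> weyl q' g') :=
  [set f : weyl q g -> weyl q' g' |
     [/\ linear f, GRing.monoid_morphism f & bijective f]].

Section Signs.
Variables (K : fieldType) (n m : nat).
Variables (q : 'I_n -> K) (g : 'M[K]_n) (q' : 'I_m -> K) (g' : 'M[K]_m).

Definition sign_vector (eps : 'I_n -> int) :=
  forall i, eps i = 1 \/ eps i = -1.

Definition sign_related (e : n = m) (eps : 'I_n -> int) :=
  (forall i, q' (cast_ord e i) = q i ^ eps i) /\
  (forall i j : 'I_n, (i < j)%N ->
     g' (cast_ord e i) (cast_ord e j) =
       if eps i == 1 then
         if eps j == 1 then g i j else (q i)^-1 * g j i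
       else
         if eps j == 1 then g j i else q i * g i j).

(* lambda_k for 0 <= k <= n; lambda_i for the 1-based index of i : 'I_n is
   lambda eps i.+1, and insub k is the index k : 'I_n for k < n. *)
Fixpoint lambda (eps : 'I_n -> int) (k : nat) : K :=
  if k is k'.+1 then
    (if insub k' is Some i then q i ^ ((eps i - 1) %/ 2)%Z else 1)
      * lambda eps k'
  else 1.

Definition std_images (e : n = m) (mu : 'I_n -> K) (eps : 'I_n -> int)
    (f : weyl q g -> weyl q' g') :=
  forall i,
    f (weyl_x q g i) = (if eps i == 1 then mu i *: weyl_x q' g' (cast_ord e i)
                        else mu i *: weyl_y q' g' (cast_ord e i)) /\
    f (weyl_y q g i) =
      (if eps i == 1
       then (lambda eps i.+1 * (mu i)^-1) *: weyl_y q' g' (cast_ord e i)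
       else - (lambda eps i.+1 * (mu i)^-1) *: weyl_x q' g' (cast_ord e i)).

Definition iso_params (e : n = m) : set (('I_n -> K) * ('I_n -> int)) :=
  [set p | [/\ forall i, p.1 i != 0, sign_vector p.2 & sign_related e p.2]].

End Signs.

(* Main.v *)
(* Put z_k = 1 + sum_(j < k) (q_j - 1) y_j x_j. The z_k commute with each other
   and q-commute with all generators, and y_j x_j and x_j y_j are combinations
   of z_j and z_(j+1). So x_j is mapped to (q_j - 1)^-1 y_j^-1 (z_(j+1) - z_j)
   in the quantum torus T generated by the y_j and z_j, and the algebra A embeds
   into T. If no q_j is a root of unity, then comparing extreme terms for the
   lexicographic order on the exponents of T shows that the normal elements of A
   are monomials in the z_j up to scalars, that A has no other monomials of T
   than those with nonnegative exponents, and that y_k is an atom which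
   q-commutes with every normal element. The atoms with this property are, up to
   scalars, generators x_s or y_s, or commute with all normal elements; y_k is
   not of the last kind. These properties being preserved by isomorphisms, y'_k
   is the image of a generator up to a scalar; so is x'_k, because the
   isomorphism with all signs -1 exchanges the roles of the x_k and y_k. Since
   x'_k and y'_k do not q-commute, they are the images of x_i and y_i in some
   order, for some i; then z_i and z_(i+1) go to multiples of z'_k and z'_(k+1),
   which gives i = k by induction, and the defining relations determine the
   remaining scalars. *)

Require Import Defs.
From HB Require Import structures.
From mathcomp Require Import all_boot all_order all_algebra.
From mathcomp Require Import boolp classical_sets functions.
From mathcomp Require Import ring finmap monalg.

Set Implicit Arguments.
Unset Strict Implicit.
Unset Printing Implicit Defensive.

Import Order.TTheory GRing.Theory Num.Theory.

Local Open Scope ring_scope.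

(** * Quantum tori *)

(** Of an algebra given by relations nothing is known beforehand, not even 1 != 0. The relations
    only yield a spanning family: monomials in the z_k times one monomial per degree in Z^n, with
    powers of y_i for positive and of x_i for negative entries. Its independence is seen in the
    torus: the degree is read off the exponents of the y_i, monomials in the z_k have distinct
    images, and multiplying by a fixed nonzero factor is injective in a domain. The hypothesis on
    roots of unity acts mainly as follows. From z_j to z_(j+1), the commutation factor with a torus
    monomial changes by a power of q_j whose exponent is, up to sign, that of y_j. So q-commuting
    with all z_k means being homogeneous, and a homogeneous element is an element of degree 0 times
    a word in the generators; for an atom one of these factors is trivial. Elements of degree 0
    involve only the z_k in the torus, as normal elements do, so the two commute. The recursion for
    lambda expresses that z_k is sent to lambda_k z'_k: exchanging x_j and y_j turns the difference
    z_(j+1) - z_j into a multiple of q'_j z'_(j+1) - z'_j, which costs a factor q_j^-1. *)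

Section LinearExtension.
Variables (K : comNzRingType) (J : choiceType) (V : lmodType K).
Implicit Types (h : J -> V) (P : {malg K[J]}).

Definition malg_lift h P : V := \sum_(k <- msupp P) P@_k *: h k.

Lemma malg_liftEw h (d : {fset J}) P :
  (msupp P `<=` d)%fset -> malg_lift h P = \sum_(k <- d) P@_k *: h k.
Proof.
move=> le; rewrite /malg_lift (big_fset_incl _ le) // => k _ /mcoeff_outdom ->.
by rewrite scale0r.
Qed.

Lemma malg_lift_is_linear h : linear (malg_lift h).
Proof.
move=> c P Q; pose d := (msupp P `|` msupp Q)%fset.
rewrite (@malg_liftEw h d P) ?fsubsetUl // (@malg_liftEw h d Q) ?fsubsetUr //.
rewrite (@malg_liftEw h d); last first.
  apply: (fsubset_trans (msuppD_le _ _)); apply: fsetSU; exact: msuppZ_le.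
rewrite scaler_sumr -big_split; apply: eq_bigr => k _ /=.
by rewrite mcoeffD mcoeffZ scalerDl scalerA.
Qed.

Lemma malg_liftU h k c : malg_lift h << c *g k >> = c *: h k.
Proof.
rewrite (@malg_liftEw h [fset k]%fset) ?msuppU_le // big_seq_fset1.
by rewrite mcoeffUU.
Qed.

Lemma eq_malg_lift h h' : h =1 h' -> malg_lift h =1 malg_lift h'.
Proof. by move=> eqh P; apply: eq_bigr => k _; rewrite eqh. Qed.

Lemma malg_lift_comb h h' c P :
  malg_lift (fun k => c *: h k + h' k) P = c *: malg_lift h P + malg_lift h' P.
Proof.
rewrite /malg_lift scaler_sumr -big_split; apply: eq_bigr => k _ /=.
by rewrite scalerDr !scalerA mulrC.
Qed.

Lemma malg_scaleU (c : K) (k : J) : << c *g k >> = c *: << k >>.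
Proof. by apply/malgP => k'; rewrite mcoeffZ !mcoeffU mulrnAr mulr1. Qed.

Lemma malg_sumU (P : {malg K[J]}) : P = \sum_(k <- msupp P) P@_k *: << k >>.
Proof. by rewrite {1}[P]monalgE; apply: eq_bigr => k _; rewrite malg_scaleU. Qed.

Lemma malg_ind (S : {malg K[J]} -> Prop) :
  S 0 -> (forall c k P, S P -> S (c *: << k >> + P)) -> forall P, S P.
Proof.
move=> S0 SD P; rewrite [P]malg_sumU.
by elim: (enum_fset _) => [|k s IHs]; rewrite ?big_nil ?big_cons //; apply: SD.
Qed.

End LinearExtension.

Section LinearEvaluation.
Variables (K : comNzRingType) (J : choiceType) (B : pzRingType).
Variables (i : {rmorphism K -> B}) (h : J -> B).
Implicit Types (P Q : {malg K[J]}) (c : K).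

(** Unlike in [malg_lift], the target is a mere ring, possibly zero, so scalars act through the
    morphism [i]. *)
Definition malg_eval P : B := \sum_(m <- msupp P) i P@_m * h m.

Lemma malg_evalEw (d : {fset J}) P :
  (msupp P `<=` d)%fset -> malg_eval P = \sum_(m <- d) i P@_m * h m.
Proof.
move=> le; rewrite /malg_eval (big_fset_incl _ le) // => m _ /mcoeff_outdom ->.
by rewrite rmorph0 mul0r.
Qed.

Lemma malg_evalP c P Q : malg_eval (c *: P + Q) = i c * malg_eval P + malg_eval Q.
Proof.
pose d := (msupp P `|` msupp Q)%fset.
rewrite (@malg_evalEw d P) ?fsubsetUl // (@malg_evalEw d Q) ?fsubsetUr //.
rewrite (@malg_evalEw d); last first.
  apply: (fsubset_trans (msuppD_le _ _)); apply: fsetSU; exact: msuppZ_le.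
rewrite mulr_sumr -big_split; apply: eq_bigr => k _ /=.
by rewrite mcoeffD mcoeffZ rmorphD rmorphM mulrDl -mulrA.
Qed.

Lemma malg_eval0 : malg_eval 0 = 0.
Proof. by rewrite /malg_eval msupp0 big_seq_fset0. Qed.

Lemma malg_evalU m : malg_eval << m >> = h m.
Proof.
rewrite (@malg_evalEw [fset m]%fset) ?msuppU_le // big_seq_fset1.
by rewrite mcoeffUU rmorph1 mul1r.
Qed.

End LinearEvaluation.

Section Bicharacter.
Variables (K : fieldType) (I : finType) (c : I -> I -> K).
Hypothesis c_neq0 : forall s t, c s t != 0.

Local Notation G := {ffun I -> int}.

(** The bimultiplicative extension of [c] to exponents. A bicharacter is a 2-cocycle, which is what
    makes the twisted product associative. *)
Definition bichar (u v : G) : K := \prod_s \prod_t c s t ^ (u s * v t).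

Lemma bichar_neq0 u v : bichar u v != 0.
Proof.
by apply/prodf_neq0 => s _; apply/prodf_neq0 => t _; rewrite expfz_neq0.
Qed.

Lemma bicharDl u u' v : bichar (u + u') v = bichar u v * bichar u' v.
Proof.
rewrite /bichar -big_split; apply: eq_bigr => s _; rewrite -big_split /=.
by apply: eq_bigr => t _; rewrite ffunE mulrDl expfzDr.
Qed.

Lemma bicharDr u v v' : bichar u (v + v') = bichar u v * bichar u v'.
Proof.
rewrite /bichar -big_split; apply: eq_bigr => s _; rewrite -big_split /=.
by apply: eq_bigr => t _; rewrite ffunE mulrDr expfzDr.
Qed.

Lemma bichar0l v : bichar 0 v = 1.
Proof. by rewrite /bichar !big1 // => s _; rewrite big1 // => t _; rewrite ffunE mul0r. Qed.

Lemma bichar0r u : bichar u 0 = 1.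
Proof. by rewrite /bichar !big1 // => s _; rewrite big1 // => t _; rewrite ffunE mulr0. Qed.

End Bicharacter.

(* The quantum torus is used through this interface only: it is the twisted
   group algebra with basis the monomials [tE u]. *)
Record torus (K : fieldType) (I : finType) (c : I -> I -> K) := Torus {
  torus_alg :> algType K;
  tE : {ffun I -> int} -> torus_alg;
  tcoef : {ffun I -> int} -> torus_alg -> K;
  tE0 : tE 0 = 1;
  tEM : forall u v, tE u * tE v = bichar c u v *: tE (u + v);
  tcoef_linear : forall u k a b, tcoef u (k *: a + b) = k * tcoef u a + tcoef u b;
  tcoefE : forall u v, tcoef v (tE u) = (u == v)%:R;
  tcoef_inj : forall a b, (forall u, tcoef u a = tcoef u b) -> a = b;
  torus_ind : forall S : torus_alg -> Prop, S 0 ->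
    (forall k u a, S a -> S (k *: tE u + a)) -> forall a, S a
}.

Arguments tE {K I c t}.

Module QuantumTorus.
Section QuantumTorus.
Variables (K : fieldType) (I : finType) (c : I -> I -> K).

Local Notation G := {ffun I -> int}.

(** The nonvanishing proof is an argument of the type because the product, and hence the ring
    structure, depends on [c] and is associative thanks to that proof. *)
Definition qtorus of (forall s t, c s t != 0) : Type := {malg K[G]}.

Variable c_neq0 : forall s t, c s t != 0.

Local Notation T := (qtorus c_neq0).

HB.instance Definition _ := GRing.Lmodule.on T.

Definition qt_E (u : G) : T := << u >> : {malg K[G]}.
Definition qt_coef (a : T) (u : G) : K := mcoeff u a.
Definition qt_one : T := qt_E 0.
Definition qt_mul_def (a b : T) : T :=
  malg_lift (fun u => malg_lift (fun v => bichar c u v *: qt_E (u + v)) b) a.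
Fact qt_mul_key : unit. Proof. exact: tt. Qed.
Definition qt_mul := locked_with qt_mul_key qt_mul_def.
Lemma qt_mul_unlock : qt_mul = qt_mul_def. Proof. exact: unlock. Qed.

Lemma qt_mulPl k a a' b : qt_mul (k *: a + a') b = k *: qt_mul a b + qt_mul a' b.
Proof. rewrite qt_mul_unlock; exact: malg_lift_is_linear. Qed.

Lemma qt_mulPr k a b b' : qt_mul a (k *: b + b') = k *: qt_mul a b + qt_mul a b'.
Proof.
rewrite qt_mul_unlock -malg_lift_comb; apply: eq_malg_lift => u; exact: malg_lift_is_linear.
Qed.

Lemma qt_mulE u v : qt_mul (qt_E u) (qt_E v) = bichar c u v *: qt_E (u + v).
Proof. by rewrite qt_mul_unlock /qt_mul_def !malg_liftU !scale1r. Qed.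

Lemma qt_mul0l a : qt_mul 0 a = 0.
Proof. by have := qt_mulPl (-1) 0 0 a; rewrite scaler0 add0r scaleN1r addNr. Qed.

Lemma qt_mul0r a : qt_mul a 0 = 0.
Proof. by have := qt_mulPr (-1) a 0 0; rewrite scaler0 add0r scaleN1r addNr. Qed.

Lemma qt_mulDl : left_distributive qt_mul +%R.
Proof. by move=> a a' b; have := qt_mulPl 1 a a' b; rewrite !scale1r. Qed.

Lemma qt_mulDr : right_distributive qt_mul +%R.
Proof. by move=> a a' b; have := qt_mulPr 1 a a' b; rewrite !scale1r. Qed.

Lemma qt_mulZl k a b : qt_mul (k *: a) b = k *: qt_mul a b.
Proof. by have := qt_mulPl k a 0 b; rewrite qt_mul0l !addr0. Qed.

Lemma qt_mulZr k a b : qt_mul a (k *: b) = k *: qt_mul a b.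
Proof. by have := qt_mulPr k a b 0; rewrite qt_mul0r !addr0. Qed.

Lemma qt_ind (S : T -> Prop) :
  S 0 -> (forall k u a, S a -> S (k *: qt_E u + a)) -> forall a, S a.
Proof. exact: malg_ind. Qed.

Lemma qt_ext (f f' : T -> T) :
  linear f -> linear f' -> (forall u, f (qt_E u) = f' (qt_E u)) -> f =1 f'.
Proof.
move=> linf linf' eqE.
have f0 (h : T -> T) : linear h -> h 0 = 0.
  by move=> linh; have := linh (-1) 0 0; rewrite scaler0 add0r scaleN1r addNr.
by elim/qt_ind => [|k u a IHa]; [rewrite !f0 | rewrite linf linf' eqE IHa].
Qed.

Lemma qt_mulA : associative qt_mul.
Proof.
(* Both sides are trilinear, so the variables are replaced one after the other by basis monomials;
   what remains is the cocycle identity. *)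
move=> a b d; move: a; apply: qt_ext => [k a a'|k a a'|u].
- exact: qt_mulPl.
- by rewrite (qt_mulPl k a a' b) (qt_mulPl k _ _ d).
move: b; apply: qt_ext => [k b b'|k b b'|v].
- by rewrite (qt_mulPl k b b' d) (qt_mulPr k _ _ _).
- by rewrite (qt_mulPr k _ b b') (qt_mulPl k _ _ d).
move: d; apply: qt_ext => [k d d'|k d d'|w].
- by rewrite (qt_mulPr k _ d d') (qt_mulPr k _ _ _).
- exact: qt_mulPr.
rewrite (qt_mulE v w) (qt_mulE u v).
rewrite (qt_mulZr _ _ (qt_E _)).
rewrite (qt_mulZl _ (qt_E _)).
rewrite (qt_mulE u _).
rewrite (qt_mulE _ w).
rewrite (scalerA _ _ (qt_E _)).
rewrite (scalerA _ _ (qt_E _)).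
rewrite (bicharDl c_neq0).
rewrite (bicharDr c_neq0).
rewrite addrA.
congr (_ *: _).
by rewrite mulrC -mulrA.
Qed.

Lemma qt_mul1l : left_id qt_one qt_mul.
Proof.
apply: (@qt_ext _ id) => [k a a'||u] //; first exact: qt_mulPr.
by rewrite (qt_mulE 0 u) bichar0l scale1r add0r.
Qed.

Lemma qt_mul1r : right_id qt_one qt_mul.
Proof.
apply: (@qt_ext (qt_mul^~ qt_one) id) => [k a a'||u] //; first exact: qt_mulPl.
by rewrite (qt_mulE u 0) bichar0r scale1r addr0.
Qed.

Lemma qt_coefE u v : qt_coef (qt_E u) v = (u == v)%:R.
Proof. by rewrite /qt_coef mcoeffU. Qed.

Lemma qt_one_neq0 : qt_one != 0.
Proof.
apply/eqP => /(congr1 (fun a => qt_coef a 0)); rewrite qt_coefE eqxx /qt_coef mcoeff0.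
by move/eqP; rewrite oner_eq0.
Qed.

HB.instance Definition _ := GRing.Zmodule_isNzRing.Build T
  qt_mulA qt_mul1l qt_mul1r qt_mulDl qt_mulDr qt_one_neq0.

Fact qt_scalerAl k (a b : T) : k *: (a * b) = k *: a * b.
Proof. by rewrite [LHS]/= -[RHS]/(qt_mul _ _) qt_mulZl. Qed.

HB.instance Definition _ := GRing.Lmodule_isLalgebra.Build K T qt_scalerAl.

Fact qt_scalerAr k (a b : T) : k *: (a * b) = a * (k *: b).
Proof. by rewrite -[RHS]/(qt_mul _ _) qt_mulZr. Qed.

HB.instance Definition _ := GRing.Lalgebra_isAlgebra.Build K T qt_scalerAr.

Lemma qt_coefP (a b : T) : (forall u, qt_coef a u = qt_coef b u) -> a = b.
Proof. by move=> eqab; apply/malgP. Qed.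

Lemma qt_coef_linear u k (a b : T) :
  qt_coef (k *: a + b) u = k * qt_coef a u + qt_coef b u.
Proof. by rewrite /qt_coef mcoeffD mcoeffZ. Qed.

Definition torus_of : torus c :=
  @Torus K I c T qt_E (fun u a => qt_coef a u) erefl qt_mulE qt_coef_linear
    qt_coefE qt_coefP qt_ind.

End QuantumTorus.
End QuantumTorus.

Lemma torus_exists (K : fieldType) (I : finType) (c : I -> I -> K) :
  (forall s t, c s t != 0) -> inhabited (torus c).
Proof. by move=> c_neq0; split; apply: QuantumTorus.torus_of c_neq0. Qed.

Section TorusTheory.
Variables (K : fieldType) (I : finType) (c : I -> I -> K) (T : torus c).
Hypothesis c_neq0 : forall s t, c s t != 0.

Local Notation G := {ffun I -> int}.
Implicit Types (a b d : T) (u v w g : G).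

Lemma tcoef0 u : tcoef u (0 : T) = 0.
Proof.
by have := tcoef_linear u (-1) (0 : T) 0; rewrite scaler0 addr0 mulN1r addNr.
Qed.

Lemma tcoefD u a b : tcoef u (a + b) = tcoef u a + tcoef u b.
Proof. by rewrite -[a]scale1r tcoef_linear mul1r scale1r. Qed.

Lemma tcoefZ u k a : tcoef u (k *: a) = k * tcoef u a.
Proof. by rewrite -[k *: a]addr0 tcoef_linear tcoef0 addr0. Qed.

Lemma tcoefN u a : tcoef u (- a) = - tcoef u a.
Proof. by rewrite -scaleN1r tcoefZ mulN1r. Qed.

Lemma tcoef_sum u (J : Type) (s : seq J) (P : pred J) (F : J -> T) :
  tcoef u (\sum_(i <- s | P i) F i) = \sum_(i <- s | P i) tcoef u (F i).
Proof.
by elim/big_rec2: _ => [|i x y _ <-]; rewrite ?tcoef0 ?tcoefD.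
Qed.

Lemma tcoef_eq0 a : (forall u, tcoef u a = 0) -> a = 0.
Proof. by move=> a0; apply: tcoef_inj => u; rewrite a0 tcoef0. Qed.

Lemma tcoef_neq0 a : a != 0 -> exists u, tcoef u a != 0.
Proof.
move=> /eqP a0; apply: contrapT => H; apply: a0; apply: tcoef_eq0 => u.
by apply: contrapT => /eqP au; apply: H; exists u.
Qed.

Lemma tE_neq0 u : tE u != 0 :> T.
Proof.
apply/eqP => /(congr1 (tcoef u)); rewrite tcoefE eqxx tcoef0.
by move/eqP; rewrite oner_eq0.
Qed.

Lemma torus_supp a :
  exists2 s : seq G, uniq s & forall u, (u \in s) = (tcoef u a != 0).
Proof.
suff [s Hs] : exists s : seq G, forall u, tcoef u a != 0 -> u \in s.
  exists (undup [seq u <- s | tcoef u a != 0]); first exact: undup_uniq.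
  by move=> u; rewrite mem_undup mem_filter; case: eqP => //= /eqP/Hs.
elim/torus_ind: a => [|k u a [s Hs]].
  by exists [::] => u; rewrite tcoef0 eqxx.
exists (u :: s) => v; rewrite inE; have [//|vu] := eqVneq v u.
by rewrite tcoef_linear tcoefE (eq_sym u) (negPf vu) mulr0 add0r; apply: Hs.
Qed.

Lemma torus_sum (s : seq G) a :
    uniq s -> (forall u, tcoef u a != 0 -> u \in s) ->
  a = \sum_(u <- s) tcoef u a *: tE u.
Proof.
move=> Us Hs; apply: tcoef_inj => w; rewrite tcoef_sum.
have [ws|wNs] := boolP (w \in s).
  rewrite (bigD1_seq w) //= tcoefZ tcoefE eqxx mulr1 big1 ?addr0 // => u uw.
  by rewrite tcoefZ tcoefE (negPf uw) mulr0.
rewrite big1_seq ?(contraNeq (Hs w)) // => u /= us.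
by rewrite tcoefZ tcoefE; case: eqP us wNs => [-> ->|_]; rewrite ?mulr0.
Qed.

Lemma tcoefM a b w (s t : seq G) :
    uniq s -> (forall u, tcoef u a != 0 -> u \in s) ->
    uniq t -> (forall u, tcoef u b != 0 -> u \in t) ->
  tcoef w (a * b) = \sum_(u <- s) \sum_(v <- t)
    tcoef u a * tcoef v b * bichar c u v * (u + v == w)%:R.
Proof.
move=> Us Hs Ut Ht; rewrite {1}(torus_sum Us Hs) {1}(torus_sum Ut Ht).
rewrite mulr_suml tcoef_sum; apply: eq_bigr => u _.
rewrite mulr_sumr tcoef_sum; apply: eq_bigr => v _.
by rewrite -scalerAl -scalerAr tEM !tcoefZ tcoefE !mulrA.
Qed.

Lemma tcoef_El g v a : tcoef (g + v) (tE g * a) = bichar c g v * tcoef v a.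
Proof.
elim/torus_ind: a => [|k u a IHa]; first by rewrite mulr0 !tcoef0 mulr0.
rewrite mulrDr -scalerAr !tcoefD IHa tEM !tcoefZ !tcoefE mulrDr.
rewrite (inj_eq (addrI g)); congr (_ + _).
by case: eqP => [->|_]; rewrite ?mulr0 // !mulr1 mulrC.
Qed.

Lemma tcoef_Er g v a : tcoef (g + v) (a * tE g) = bichar c v g * tcoef v a.
Proof.
elim/torus_ind: a => [|k u a IHa]; first by rewrite mul0r !tcoef0 mulr0.
rewrite mulrDl -scalerAl !tcoefD IHa tEM !tcoefZ !tcoefE mulrDr [g + v]addrC.
rewrite (inj_eq (addIr g)); congr (_ + _).
by case: eqP => [->|_]; rewrite ?mulr0 // !mulr1 mulrC.
Qed.

(** Conjugation by a monomial is diagonal in the basis [tE], so an eigenvector has the same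
    eigenvalue at every exponent of its support. *)
Lemma torus_qcomm_supp g k a v : tE g * a = k *: (a * tE g) ->
  tcoef v a != 0 -> bichar c g v = k * bichar c v g.
Proof.
move=> /(congr1 (tcoef (g + v))); rewrite tcoef_El tcoefZ tcoef_Er mulrA.
by move=> eqv av; apply: (mulIf av).
Qed.

Definition tsupp (S : G -> Prop) a := forall w, tcoef w a != 0 -> S w.

Lemma tsupp0 S : tsupp S 0.
Proof. by move=> w; rewrite tcoef0 eqxx. Qed.

Lemma tsuppD S a b : tsupp S a -> tsupp S b -> tsupp S (a + b).
Proof.
move=> Sa Sb w; rewrite tcoefD; have [->|/Sa//] := eqVneq (tcoef w a) 0.
by rewrite add0r => /Sb.
Qed.

Lemma tsuppZ S k a : tsupp S a -> tsupp S (k *: a).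
Proof.
move=> Sa w; rewrite tcoefZ => h; apply: Sa; apply: contraNneq h => ->.
by rewrite mulr0.
Qed.

Lemma tsuppE (S : G -> Prop) u : S u -> tsupp S (tE u).
Proof.
by move=> Su w; rewrite tcoefE; have [<-|_] := eqVneq u w; rewrite ?eqxx.
Qed.

Lemma tsuppM (S1 S2 S : G -> Prop) a b :
    (forall u v, S1 u -> S2 v -> S (u + v)) -> tsupp S1 a -> tsupp S2 b ->
  tsupp S (a * b).
Proof.
move=> S12 Sa Sb w; have [s Us Hs] := torus_supp a; have [t Ut Ht] := torus_supp b.
rewrite (@tcoefM _ _ _ s t) // => [|x|x]; rewrite ?Hs ?Ht // => nz.
apply: contrapT => nSw; case/eqP: nz; rewrite big1_seq // => u /= us.
rewrite big1_seq // => v /= vt; have [e|_] := eqVneq (u + v) w; last by rewrite mulr0.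
by case: nSw; rewrite -e; apply: S12; [apply: Sa; rewrite -Hs|apply: Sb; rewrite -Ht].
Qed.

(** * Leading exponents for an abstract total order *)

Section Leading.
Variable pos : G -> Prop.
Hypotheses (pos0 : ~ pos 0) (posD : forall u v, pos u -> pos v -> pos (u + v)).
Hypothesis pos_total : forall u, u != 0 -> pos u \/ pos (- u).

(** [pos] is the positive cone of a total group order. It is kept abstract to be instantiated by the
    lexicographic order and by its opposite. *)
Definition leading a u :=
  tcoef u a != 0 /\ forall v, tcoef v a != 0 -> v != u -> pos (u - v).

Lemma leading_exists a : a != 0 -> exists u, leading a u.
Proof.
move=> /tcoef_neq0 [u0 au0]; have [s _ Hs] := torus_supp a.
suff [u us Hu] : exists2 u, u \in s & forall v, v \in s -> v != u -> pos (u - v).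
  by exists u; split=> [|v]; rewrite -Hs //; apply: Hu.
have: u0 \in s by rewrite Hs.
elim: s {Hs} u0 {au0} => // x s IHs u0 _.
case: s IHs => [|y s] IHs.
  by exists x; rewrite ?inE // => v; rewrite inE => ->.
have [|u us Hu] := IHs y; first by rewrite inE eqxx.
have [->|xu] := eqVneq x u.
  by exists u; rewrite ?inE ?eqxx // => v /predU1P[->|]; [rewrite eqxx|apply: Hu].
have [pxu|pux] : pos (x - u) \/ pos (u - x).
- by rewrite -(opprB x u); apply: pos_total; rewrite subr_eq0.
- exists x; first by rewrite inE eqxx.
  move=> v /predU1P[->|vs _]; first by rewrite eqxx.
  have [->//|vu] := eqVneq v u.
  have -> : x - v = (x - u) + (u - v) by rewrite addrA subrK.
  by apply: posD => //; apply: Hu.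
- by exists u; [rewrite inE us orbT | move=> v /predU1P[->|] //; apply: Hu].
Qed.

(** Nothing cancels the product of the leading terms: another pair of exponents u', v' with the same
    sum would make (u - u') + (v - v') = 0 positive. *)
Lemma leadingM a b u v : leading a u -> leading b v ->
  tcoef (u + v) (a * b) = tcoef u a * tcoef v b * bichar c u v.
Proof.
move=> [au Hu] [bv Hv]; have [s Us Hs] := torus_supp a.
have [t Ut Ht] := torus_supp b.
rewrite (@tcoefM _ _ _ s t) // => [|w|w]; rewrite ?Hs ?Ht //.
rewrite (bigD1_seq u) ?Hs //= (bigD1_seq v) ?Ht //= eqxx mulr1.
rewrite !big1_seq ?addr0 // => [u' /andP[u'u]|v' /andP[v'v]]; last first.
  by rewrite (inj_eq (addrI u)) (negPf v'v) mulr0.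
rewrite Hs => au'; rewrite big1_seq // => v' /=; rewrite Ht => bv'.
have [e|_] := eqVneq (u' + v') (u + v); last by rewrite mulr0.
have pu := Hu _ au' u'u; case: pos0.
have [e'|v'v] := eqVneq v' v.
  by move: e u'u; rewrite e' => /addIr ->; rewrite eqxx.
have -> : 0 = (u - u') + (v - v') by rewrite addrACA -opprD e subrr.
by apply: posD => //; apply: Hv.
Qed.

Lemma leadingM_neq0 a b u v :
  leading a u -> leading b v -> tcoef (u + v) (a * b) != 0.
Proof.
move=> la lb; rewrite leadingM //; case: la lb => [au _] [bv _].
by rewrite !mulf_neq0 // bichar_neq0.
Qed.

Lemma leading_mono k g : k != 0 -> leading (k *: tE g) g.
Proof.
move=> k0; split=> [|v]; first by rewrite tcoefZ tcoefE eqxx mulr1.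
rewrite tcoefZ tcoefE.
by have [->|_] := eqVneq g v; rewrite ?eqxx // mulr0 eqxx.
Qed.

(** The exponent u + v occurs in the product by [leadingM_neq0], and [g] is a sum of exponents u'
    and v' of the factors. If g and u + v differed, then 0 would be the positive g - (u + v) plus
    the nonnegative u - u' and v - v'. *)
Lemma leading_mulE a b u v g : leading a u -> leading b v -> leading (a * b) g ->
  u + v = g.
Proof.
move=> la lb [abg Hg]; have ab := leadingM_neq0 la lb.
have [//|ne] := eqVneq (u + v) g.
have [s Us Hs] := torus_supp a; have [t Ut Ht] := torus_supp b.
move: abg; rewrite (@tcoefM _ _ _ s t) // => [|w|w]; rewrite ?Hs ?Ht //.
rewrite big1_seq ?eqxx // => u' /=; rewrite Hs => au'.
rewrite big1_seq // => v' /=; rewrite Ht => bv'.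
have [e|_] := eqVneq (u' + v') g; last by rewrite mulr0.
have le x d y : leading d x -> tcoef y d != 0 -> x - y = 0 \/ pos (x - y).
  move=> [_ H] dy; have [->|yx] := eqVneq y x; first by left; rewrite subrr.
  by right; apply: H.
have pg := Hg _ ab ne; case: pos0.
have -> : 0 = (g - (u + v)) + ((u - u') + (v - v')).
  by rewrite [X in _ = _ + X]addrACA -opprD e addrA subrK subrr.
apply: posD => //.
have [eu|pu] := le _ _ _ la au'; have [ev|pv] := le _ _ _ lb bv'.
- case/eqP: ne; rewrite -e.
  by move/eqP: eu; rewrite subr_eq0 => /eqP->; move/eqP: ev; rewrite subr_eq0 => /eqP->.
- by rewrite eu add0r.
- by rewrite ev addr0.
- exact: posD.
Qed.

End Leading.

Definition lexpos (u : G) := exists2 s : I, (0 < u s)%R &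
  forall t, (enum_rank t < enum_rank s)%N -> u t = 0.

Lemma lexpos0 : ~ lexpos 0.
Proof. by case=> s; rewrite ffunE ltxx. Qed.

Lemma lexposD u v : lexpos u -> lexpos v -> lexpos (u + v).
Proof.
move=> [s us Hs] [t vt Ht].
have [lt_st|lt_ts|e] := ltngtP (enum_rank s) (enum_rank t).
- exists s => [|r rs]; rewrite ffunE ?Ht ?addr0 // ?Hs //.
  exact: ltn_trans lt_st.
- exists t => [|r rt]; rewrite ffunE ?Hs ?add0r // ?Ht //.
  exact: ltn_trans lt_ts.
- have {e} e : s = t by apply: enum_rank_inj; apply: val_inj.
  subst t; exists s => [|r rs]; rewrite ffunE; first exact: addr_gt0.
  by rewrite Hs // Ht // addr0.
Qed.

Lemma lexpos_total u : u != 0 -> lexpos u \/ lexpos (- u).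
Proof.
move=> u0; have [s0 us0] : exists s, u s != 0.
  apply/existsP; rewrite -negb_forall; apply: contraNN u0 => /forallP u0.
  by apply/eqP/ffunP => s; rewrite ffunE; apply/eqP.
case: (@arg_minnP _ s0 (fun s => u s != 0) (fun s => nat_of_ord (enum_rank s)) us0) => s us Hs.
have Ht t : (enum_rank t < enum_rank s)%N -> u t = 0.
  by move=> ts; apply/eqP; apply: contraTT ts; rewrite -leqNgt; apply: Hs.
have [lt0|gt0|e] := ltrgtP (u s) 0; last by rewrite e eqxx in us.
- by right; exists s => [|t ts]; rewrite ffunE ?oppr_gt0 // Ht ?oppr0.
- by left; exists s.
Qed.

(* An element is a monomial as soon as its leading terms for the lexicographic
   order and for the opposite order have the same exponent. *)
Definition lexneg u := lexpos (- u).

Lemma lexneg0 : ~ lexneg 0.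
Proof. by rewrite /lexneg oppr0; apply: lexpos0. Qed.

Lemma lexnegD u v : lexneg u -> lexneg v -> lexneg (u + v).
Proof. by rewrite /lexneg opprD; apply: lexposD. Qed.

Lemma lexneg_total u : u != 0 -> lexneg u \/ lexneg (- u).
Proof. by rewrite /lexneg opprK => /lexpos_total[]; [right|left]. Qed.

Lemma torus_mulf_neq0 a b : a != 0 -> b != 0 -> a * b != 0.
Proof.
move=> /(leading_exists lexposD lexpos_total)[u la].
move=> /(leading_exists lexposD lexpos_total)[v lb].
have := leadingM_neq0 lexpos0 lexposD la lb; apply: contraNneq => ->.
by rewrite tcoef0.
Qed.

Definition monomial a u := exists2 k, k != 0 & a = k *: tE u.

Lemma monomial_neq0 a u : monomial a u -> a != 0.
Proof. by case=> k k0 ->; rewrite scaler_eq0 negb_or k0 tE_neq0. Qed.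

Lemma monomial_coef a u v : monomial a u -> (tcoef v a != 0) = (v == u).
Proof.
case=> k k0 ->; rewrite tcoefZ tcoefE (eq_sym v).
by have [_|_] := eqVneq u v; rewrite ?mulr1 // mulr0 eqxx.
Qed.

Lemma monomialP a u : leading lexpos a u -> leading lexneg a u -> monomial a u.
Proof.
move=> [au Hp] [_ Hn]; exists (tcoef u a) => //.
rewrite {1}(@torus_sum [:: u] a) ?big_seq1 // => v av; rewrite inE.
have [//|vu] := eqVneq v u; case: lexpos0; rewrite -(subrr (u - v)).
by apply: lexposD; [apply: Hp | apply: Hn].
Qed.

Lemma monomial_leading a u : monomial a u -> leading lexpos a u /\ leading lexneg a u.
Proof. by case=> k k0 ->; split; apply: leading_mono. Qed.

(** The difference between the highest and the lowest exponent is additive on products. It is 0 for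
    a monomial and nonnegative for each factor, hence 0 for both. *)
Lemma monomial_factors a b w : monomial (a * b) w ->
  exists u v, [/\ monomial a u, monomial b v & u + v = w].
Proof.
move=> mab; have [lab nab] := monomial_leading mab.
have ab0 := monomial_neq0 mab.
have a0 : a != 0 by apply: contraNneq ab0 => ->; rewrite mul0r.
have b0 : b != 0 by apply: contraNneq ab0 => ->; rewrite mulr0.
have [u la] := leading_exists lexposD lexpos_total a0.
have [v lb] := leading_exists lexposD lexpos_total b0.
have [u' na] := leading_exists lexnegD lexneg_total a0.
have [v' nb] := leading_exists lexnegD lexneg_total b0.
have euv := leading_mulE lexpos0 lexposD la lb lab.
have euv' := leading_mulE lexneg0 lexnegD na nb nab.
have le x y d : leading lexpos d x -> leading lexneg d y -> x = y \/ lexpos (x - y).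
  move=> [_ H] [dy _]; have [->|yx] := eqVneq y x; first by left.
  by right; apply: H.
have e : (u - u') + (v - v') = 0 by rewrite addrACA -opprD euv euv' subrr.
have [eu ev] : u = u' /\ v = v'.
  have [eu|pu] := le _ _ _ la na; have [ev|pv] := le _ _ _ lb nb => //.
  - by case: lexpos0; rewrite -e eu subrr add0r.
  - by case: lexpos0; rewrite -e ev subrr addr0.
  - by case: lexpos0; rewrite -e; apply: lexposD.
subst u' v'; exists u, v; split=> //; exact: monomialP.
Qed.

(** The highest exponents give g + u = u + v, so [b] has highest exponent [g]; the lowest exponents
    give the same. Applied to a normal element [a], this says that conjugation by [a] rescales those
    torus monomials that come from the algebra. *)
Lemma torus_conj g a b : a != 0 -> tE g * a = a * b -> monomial b g.
Proof.
move=> a0 e.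
have mg : monomial (tE g) g by exists 1; rewrite ?oner_eq0 ?scale1r.
have [lg ng] := monomial_leading mg.
have ab0 : a * b != 0 by rewrite -e torus_mulf_neq0 // tE_neq0.
have b0 : b != 0 by apply: contraNneq ab0 => ->; rewrite mulr0.
have [u la] := leading_exists lexposD lexpos_total a0.
have [v lb] := leading_exists lexposD lexpos_total b0.
have [u' na] := leading_exists lexnegD lexneg_total a0.
have [v' nb] := leading_exists lexnegD lexneg_total b0.
have [w lab] := leading_exists lexposD lexpos_total ab0.
have [w' nab] := leading_exists lexnegD lexneg_total ab0.
have e1 := leading_mulE lexpos0 lexposD la lb lab.
have e2 := leading_mulE lexneg0 lexnegD na nb nab.
rewrite -e in lab nab.
have e3 := leading_mulE lexpos0 lexposD lg la lab.
have e4 := leading_mulE lexneg0 lexnegD ng na nab.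
have ev : v = g by apply: (addrI u); rewrite e1 -e3 addrC.
have ev' : v' = g by apply: (addrI u'); rewrite e2 -e4 addrC.
by subst v v'; apply: monomialP.
Qed.

End TorusTheory.

(** * The relations between the generators and the z_k *)

Section QCommutation.
Variables (K : fieldType) (B : pzRingType) (i : {rmorphism K -> B}).
Hypothesis iC : forall c u, i c * u = u * i c.
Implicit Types (a b d : B) (c k : K).

Definition qc c a b := a * b = i c * (b * a).

Lemma qc_mull c c' a a' b : qc c a b -> qc c' a' b -> qc (c * c') (a * a') b.
Proof.
rewrite /qc => ab a'b.
by rewrite -mulrA a'b (mulrA a) -iC -mulrA (mulrA a) ab -!mulrA mulrA -rmorphM (mulrC c').
Qed.

Lemma qc_mulr c c' a b b' : qc c a b -> qc c' a b' -> qc (c * c') a (b * b').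
Proof.
rewrite /qc => ab ab'.
by rewrite mulrA ab -!mulrA ab' (mulrA b) -iC !mulrA rmorphM.
Qed.

Lemma qc_addl c a a' b : qc c a b -> qc c a' b -> qc c (a + a') b.
Proof. by rewrite /qc => ab a'b; rewrite mulrDl ab a'b !mulrDr. Qed.

Lemma qc_addr c a b b' : qc c a b -> qc c a b' -> qc c a (b + b').
Proof. by rewrite /qc => ab a'b; rewrite mulrDr ab a'b mulrDl mulrDr. Qed.

Lemma qc_scal k b : qc 1 (i k) b.
Proof. by rewrite /qc rmorph1 mul1r iC. Qed.

Lemma qc_sym c a b : c != 0 -> qc c a b -> qc c^-1 b a.
Proof. by rewrite /qc => c0 ->; rewrite mulrA -rmorphM mulVf // rmorph1 mul1r. Qed.

Lemma qc_comm a b : qc 1 a b <-> a * b = b * a.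
Proof. by rewrite /qc rmorph1 mul1r. Qed.

Lemma qc_scaler k c a b : qc c a b -> qc c a (i k * b).
Proof.
by move=> ab; rewrite -[c]mul1r; apply: qc_mulr => //; rewrite qc_comm iC.
Qed.

Lemma qc_scalel k c a b : qc c a b -> qc c (i k * a) b.
Proof.
by move=> ab; rewrite -[c]mul1r; apply: qc_mull => //; apply: qc_scal.
Qed.

Lemma qc_oppr c a b : qc c a b -> qc c a (- b).
Proof. by rewrite /qc => ab; rewrite mulrN ab mulNr mulrN. Qed.

Lemma qc_oppl c a b : qc c a b -> qc c (- a) b.
Proof. by rewrite /qc => ab; rewrite mulrN mulNr ab mulrN. Qed.

Lemma qc_invl c a a' b : c != 0 -> a' * a = 1 -> a * a' = 1 ->
  qc c a b -> qc c^-1 a' b.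
Proof.
rewrite /qc => c0 a'a aa' ab; have := congr1 (fun t => i c^-1 * (a' * t * a')) ab.
rewrite /= -!mulrA aa' mulr1 (mulrA a' a) a'a mul1r => ->.
rewrite (mulrA a' (i c)) -(iC c) -(mulrA (i c)) (mulrA (i c^-1)) -rmorphM mulVf //.
by rewrite rmorph1 mul1r.
Qed.

Lemma qc_prodr (J : Type) (s : seq J) (F : J -> B) (f : J -> K) a :
  (forall j, qc (f j) a (F j)) ->
  qc (\prod_(j <- s) f j) a (\prod_(j <- s) F j).
Proof.
move=> aF; elim: s => [|j s IHs].
  by rewrite !big_nil; apply/qc_comm; rewrite mulr1 mul1r.
by rewrite !big_cons; apply: qc_mulr.
Qed.

End QCommutation.

Section WeylModel.
Variables (K : fieldType) (n : nat) (q : 'I_n -> K) (g : 'M[K]_n).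

(* [zsum k] is the right-hand side of the last relation for the generators of
   0-based index [k]. *)
Definition zsum (B : pzRingType) (i : K -> B) (X Y : 'I_n -> B) (k : nat) : B :=
  1 + \sum_(j < n | (j < k)%N) i (q j - 1) * (Y j * X j).

Record weyl_rels (B : pzRingType) (i : {rmorphism K -> B}) (X Y : 'I_n -> B) :
    Prop := WeylRels {
  rel_yy : forall j k, qc i (g j k) (Y j) (Y k);
  rel_xx : forall j k : 'I_n, (j < k)%N -> qc i (q j * g j k) (X j) (X k);
  rel_xy_lt : forall j k : 'I_n, (j < k)%N -> qc i (g k j) (X j) (Y k);
  rel_xy_gt : forall j k : 'I_n, (k < j)%N -> qc i (q k * g k j) (X j) (Y k);
  rel_xy_eq : forall j, X j * Y j = zsum i X Y j + i (q j) * (Y j * X j)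
}.

(* The quantized Weyl algebra is used through this interface only. *)
Record weyl_model := WeylModel {
  wA :> pzRingType;
  wc : {rmorphism K -> wA};
  wx : 'I_n -> wA;
  wy : 'I_n -> wA;
  wcC : forall c u, wc c * u = u * wc c;
  w_rels : weyl_rels wc wx wy;
  w_ind : forall S : wA -> Prop, S 1 ->
    (forall c u v, S u -> S v -> S (wc c * u + v)) ->
    (forall i u, S u -> S (wx i * u)) -> (forall i u, S u -> S (wy i * u)) ->
    forall u, S u;
  w_univ : forall (B : pzRingType) (i : {rmorphism K -> B}) (X Y : 'I_n -> B),
    (forall c u, i c * u = u * i c) -> weyl_rels i X Y ->
    exists F : {rmorphism wA -> B}, [/\ forall c, F (wc c) = i c,
      forall j, F (wx j) = X j & forall j, F (wy j) = Y j]
}.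

Section RankOne.
Variables (B : pzRingType) (i : {rmorphism K -> B}).
Hypothesis iC : forall c u, i c * u = u * i c.
Variables (c : K) (w x y : B).
Hypothesis xy : x * y = w + i c * (y * x).

(** Here [w] plays the role of z_j and [w + i (c - 1) * (y * x)] that of z_(j+1): the generators of
    index j commute with the former and q-commute with the latter. *)
Lemma rank1_y : w * y = y * w ->
  (w + i (c - 1) * (y * x)) * y = i c * (y * (w + i (c - 1) * (y * x))).
Proof.
move=> wy.
have -> : (w + i (c - 1) * (y * x)) * y =
    y * w + (i (c - 1) * (y * w) + i (c * (c - 1)) * (y * (y * x))).
  rewrite mulrDl wy; congr (_ + _); rewrite -!mulrA xy (mulrDr y) (mulrDr (i _)).
  by congr (_ + _); rewrite (mulrA y (i c)) -iC (mulrC c) rmorphM -!mulrA.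
rewrite (mulrDr y) (mulrDr (i c)) addrA; congr (_ + _).
  rewrite -{1}[y * w]mul1r -(rmorph1 i) -mulrDl -rmorphD.
  by rewrite [1 + _]addrC subrK.
by rewrite (mulrA y (i _)) -iC rmorphM -!mulrA.
Qed.

Lemma rank1_x : w * x = x * w ->
  x * (w + i (c - 1) * (y * x)) = i c * ((w + i (c - 1) * (y * x)) * x).
Proof.
move=> wx.
have -> : x * (w + i (c - 1) * (y * x)) =
    w * x + (i (c - 1) * (w * x) + i (c * (c - 1)) * (y * x * x)).
  rewrite mulrDr -wx; congr (_ + _); rewrite (mulrA x) -iC -mulrA (mulrA x) xy.
  rewrite mulrDl mulrDr; congr (_ + _).
  by rewrite (mulrC c) rmorphM -!mulrA.
rewrite (mulrDl _ _ x) (mulrDr (i c)) addrA; congr (_ + _).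
  rewrite -{1}[w * x]mul1r -(rmorph1 i) -mulrDl -rmorphD.
  by rewrite [1 + _]addrC subrK.
by rewrite rmorphM -!mulrA.
Qed.

Lemma rank1_xy : i (c - 1) * (x * y) = i c * (w + i (c - 1) * (y * x)) - w.
Proof.
rewrite xy !mulrDr (mulrA (i (c - 1))) (mulrA (i c)) -!rmorphM (mulrC c).
by rewrite addrAC; congr (_ + _); rewrite rmorphB rmorph1 mulrBl mul1r.
Qed.

End RankOne.

Section Relations.
Variables (B : pzRingType) (i : {rmorphism K -> B}) (X Y : 'I_n -> B).
Hypothesis iC : forall c u, i c * u = u * i c.
Hypothesis rels : weyl_rels i X Y.
Hypotheses (q_neq0 : forall j, q j != 0) (g_skew : mul_skew_symmetric g).

Local Notation z := (zsum i X Y).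

Lemma g_neq0 j k : g j k != 0.
Proof.
apply/eqP => e; have /eqP := g_skew.2 j k; by rewrite e mul0r eq_sym oner_eq0.
Qed.

Lemma g_inv j k : (g j k)^-1 = g k j.
Proof. by apply: (mulfI (g_neq0 j k)); rewrite divff ?g_neq0 ?g_skew.2. Qed.

Lemma zsum0 : z 0 = 1.
Proof. by rewrite /zsum big_pred0 ?addr0. Qed.

Lemma zsumS (j : 'I_n) : z j.+1 = z j + i (q j - 1) * (Y j * X j).
Proof.
rewrite /zsum -addrA; congr (_ + _); rewrite (bigD1 j) //= addrC; congr (_ + _); apply: eq_bigl => k.
by rewrite ltnS [RHS]ltn_neqAle andbC.
Qed.

Lemma xy_qc (j k : 'I_n) : j != k ->
  qc i (if (j < k)%N then g k j else q k * g k j) (X j) (Y k).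
Proof.
move=> jk; case: ltnP => [jk'|kj]; first exact: (rel_xy_lt rels jk').
apply: (rel_xy_gt rels).
by rewrite ltn_neqAle eq_sym; apply/andP.
Qed.

Lemma xx_qc (j k : 'I_n) : j != k ->
  qc i (if (j < k)%N then q j * g j k else (q k)^-1 * g j k) (X j) (X k).
Proof.
move=> jk; case: ltnP => [jk'|kj]; first exact: (rel_xx rels jk').
have {jk kj} kj : (k < j)%N by rewrite ltn_neqAle eq_sym; apply/andP.
rewrite -[g j k]invrK g_inv -invfM; apply: qc_sym.
  by rewrite mulf_neq0 ?g_neq0.
exact: (rel_xx rels).
Qed.

(** The factors [g j k] and [g k j] cancel, and only the q_k present in the relation between x_j and
    y_k for k < j survives. So products y_j x_j commute with other generators up to powers of the
    q_k alone. *)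
Lemma yx_y (j k : 'I_n) : j != k ->
  qc i (if (k < j)%N then q k else 1) (Y j * X j) (Y k).
Proof.
move=> jk; have := qc_mull iC (rel_yy rels j k) (xy_qc jk).
case: ltngtP => [lt|gt|/val_inj e]; last by rewrite e eqxx in jk.
- by rewrite g_skew.2.
- by rewrite mulrCA g_skew.2 mulr1.
Qed.

Lemma yx_x (j k : 'I_n) : j != k ->
  qc i (if (k < j)%N then (q k)^-1 else 1) (Y j * X j) (X k).
Proof.
move=> jk; have kj : k != j by rewrite eq_sym.
have yx : qc i (if (k < j)%N then g j k else q j * g j k)^-1 (Y j) (X k).
  apply: qc_sym; last exact: xy_qc.
  by case: ifP => _; rewrite ?mulf_neq0 ?g_neq0.
have := qc_mull iC yx (xx_qc jk).
case: ltngtP => [lt|gt|/val_inj e]; last by rewrite e eqxx in jk.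
- by rewrite mulrCA mulVf ?g_neq0 // mulr1.
- by rewrite mulVf // mulf_neq0 ?g_neq0.
Qed.

(** Summands of index below j commute with y_j. The first partial sum containing y_j x_j has factor
    q_j by [rank1_y], and every later summand has this same factor, so it persists. *)
Lemma zsum_y k (j : 'I_n) : (k <= n)%N ->
  qc i (if (j < k)%N then q j else 1) (z k) (Y j).
Proof.
elim: k => [|k IHk] ltk; first by rewrite zsum0; apply/qc_comm; rewrite mulr1 mul1r.
pose l := Ordinal ltk; rewrite -[k.+1]/(l : nat).+1 zsumS.
have /= IH := IHk (ltnW ltk).
have [e|jl] := eqVneq j l.
  subst j; move: IH; rewrite /= ltnn ltnSn => /qc_comm IH; rewrite /qc.
  exact: (rank1_y iC (rel_xy_eq rels l) IH).
have := yx_y (j := l) (k := j); rewrite eq_sym jl => /(_ isT) H.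
have -> : (j < l.+1)%N = (j < k)%N.
  by rewrite ltnS leq_eqVlt; case: eqP => // /val_inj e; rewrite e eqxx in jl.
by apply: qc_addl => //; apply: (qc_scalel iC).
Qed.

Lemma zsum_x k (j : 'I_n) : (k <= n)%N ->
  qc i (if (j < k)%N then (q j)^-1 else 1) (z k) (X j).
Proof.
elim: k => [|k IHk] ltk; first by rewrite zsum0; apply/qc_comm; rewrite mulr1 mul1r.
pose l := Ordinal ltk; rewrite -[k.+1]/(l : nat).+1 zsumS.
have /= IH := IHk (ltnW ltk).
have [e|jl] := eqVneq j l.
  subst j; move: IH; rewrite /= ltnn ltnSn => /qc_comm IH.
  apply: qc_sym => //; rewrite /qc.
  exact: (rank1_x iC (rel_xy_eq rels l) IH).
have := yx_x (j := l) (k := j); rewrite eq_sym jl => /(_ isT) H.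
have -> : (j < l.+1)%N = (j < k)%N.
  by rewrite ltnS leq_eqVlt; case: eqP => // /val_inj e; rewrite e eqxx in jl.
by apply: qc_addl => //; apply: (qc_scalel iC).
Qed.

(** The factors q_j and q_j^-1 that z_k has with y_j and x_j cancel in the product y_j x_j. *)
Lemma zsum_comm k l : (k <= n)%N -> (l <= n)%N -> z k * z l = z l * z k.
Proof.
move=> lek; elim: l => [|l IHl] ltl; first by rewrite zsum0 mulr1 mul1r.
pose j := Ordinal ltl; rewrite -[l.+1]/(j : nat).+1 zsumS.
apply/qc_comm; apply: qc_addr.
  by apply/qc_comm; apply: IHl; apply: ltnW.
apply: (qc_scaler iC).
have := qc_mulr iC (zsum_y j lek) (zsum_x j lek).
by case: ifP => _; rewrite ?divff ?mulr1.
Qed.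

Lemma xy_zsum (j : 'I_n) : i (q j - 1) * (X j * Y j) = i (q j) * z j.+1 - z j.
Proof.
by rewrite zsumS (rank1_xy (rel_xy_eq rels j)).
Qed.

Lemma yx_zsum (j : 'I_n) : i (q j - 1) * (Y j * X j) = z j.+1 - z j.
Proof. by rewrite zsumS addrAC subrr add0r. Qed.

End Relations.
End WeylModel.

(** * Embedding into a quantum torus *)

Section WeylTorus.
Variables (K : fieldType) (n : nat) (q : 'I_n -> K) (g : 'M[K]_n).
Hypotheses (q_neq0 : forall j, q j != 0) (g_skew : mul_skew_symmetric g).

Local Notation I := ('I_n + 'I_n)%type.
Local Notation G := {ffun I -> int}.
Implicit Types (u v w : G).

(* The torus has a coordinate [inl j] for z_(j+1), z_0 being 1, and a coordinate
   [inr i] for y_i; [eZ] and [eY] are the exponents of the z_k and y_i. *)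
Definition wmat (s t : I) : K :=
  match s, t with
  | inr i, inl j => if (i <= j)%N then (q i)^-1 else 1
  | inr i, inr j => if (j < i)%N then g i j else 1
  | inl _, _ => 1
  end.

Lemma wmat_neq0 s t : wmat s t != 0.
Proof.
by case: s t => [i|i] [j|j] /=; rewrite ?oner_eq0 //; case: ifP;
  rewrite ?oner_eq0 ?invr_eq0 ?(g_neq0 g_skew).
Qed.

Definition eZ (k : nat) : G := [ffun t : I => if t is inl j then (j.+1 == k)%:Z else 0%:Z].
Definition eY (i : 'I_n) : G := [ffun t : I => if t is inr j then (j == i)%:Z else 0%:Z].

Local Notation kap := (bichar wmat).

Lemma eZ0 : eZ 0 = 0.
Proof. by apply/ffunP => -[j|j]; rewrite !ffunE. Qed.

Lemma kapE u v : kap u v = \prod_i \prod_t wmat (inr i) t ^ (u (inr i) * v t).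
Proof.
rewrite /bichar big_sumType /= [X in X * _]big1 ?mul1r // => j _.
by rewrite big1 // => t _; rewrite exp1rz.
Qed.

Lemma kap_noY u v : (forall i, u (inr i) = 0) -> kap u v = 1.
Proof.
by move=> u0; rewrite kapE big1 // => i _; rewrite big1 // => t _; rewrite u0 mul0r expr0z.
Qed.

Lemma kapZl k v : kap (eZ k) v = 1.
Proof. by apply: kap_noY => i; rewrite ffunE. Qed.

Lemma kapYl i v : kap (eY i) v = \prod_t wmat (inr i) t ^ v t.
Proof.
rewrite kapE (bigD1 i) //= [X in _ * X]big1 ?mulr1 => [|j ji].
  by apply: eq_bigr => t _; rewrite ffunE eqxx mul1r.
by rewrite big1 // => t _; rewrite ffunE (negPf ji) mul0r expr0z.
Qed.

Lemma kapYY i j : kap (eY i) (eY j) = wmat (inr i) (inr j).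
Proof.
rewrite kapYl (bigD1 (inr j)) //= big1 ?mulr1 => [|t tj]; rewrite ffunE.
  by rewrite eqxx expr1z.
case: t tj => [t|t tj]; first by rewrite expr0z.
by rewrite (_ : (t == j) = false) ?expr0z //; apply: contraNF tj => /eqP->.
Qed.

Lemma kapYZ (i j : 'I_n) : kap (eY i) (eZ j.+1) = wmat (inr i) (inl j).
Proof.
rewrite kapYl (bigD1 (inl j)) //= big1 ?mulr1 => [|t tj]; rewrite ffunE.
  by rewrite eqxx expr1z.
case: t tj => [t tj|t]; last by rewrite expr0z.
rewrite (_ : (t.+1 == j.+1) = false) ?expr0z //; apply: contraNF tj => /eqP[e].
by apply/eqP; congr inl; apply: val_inj.
Qed.

Lemma kapYZ_le (i : 'I_n) k : (k <= n)%N ->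
  kap (eY i) (eZ k) = if (i < k)%N then (q i)^-1 else 1.
Proof.
case: k => [_|k ltk]; first by rewrite eZ0 bichar0r.
by rewrite -[k.+1]/((Ordinal ltk : nat).+1) kapYZ /= ltnS.
Qed.

Lemma kapNl u v : kap (- u) v = (kap u v)^-1.
Proof.
apply: (mulfI (bichar_neq0 wmat_neq0 u v)).
by rewrite -(bicharDl wmat_neq0) subrr bichar0l divff // (bichar_neq0 wmat_neq0).
Qed.

Lemma kapNr u v : kap u (- v) = (kap u v)^-1.
Proof.
apply: (mulfI (bichar_neq0 wmat_neq0 u v)).
by rewrite -(bicharDr wmat_neq0) subrr bichar0r divff // (bichar_neq0 wmat_neq0).
Qed.

Variable T : torus wmat.

Variable iT : {rmorphism K -> T}.
Hypothesis iTE : forall c, iT c = c%:A.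

Lemma iT_scale c (a : T) : iT c * a = c *: a.
Proof. by rewrite iTE mulr_algl. Qed.

Lemma torus_scalC c (a : T) : iT c * a = a * iT c.
Proof. by rewrite iTE mulr_algl mulr_algr. Qed.

(** Only this ratio is visible in commutation relations, which is why [wmat] can put each factor on
    one order of a pair of coordinates and 1 on the other. *)
Lemma tE_qc u v : qc iT (kap u v / kap v u) (tE u : T) (tE v).
Proof.
rewrite /qc iT_scale !tEM scalerA divfK ?(bichar_neq0 wmat_neq0) //.
by rewrite addrC.
Qed.

Lemma tY_qc i j : qc iT (g i j) (tE (eY i) : T) (tE (eY j)).
Proof.
have := tE_qc (eY i) (eY j); rewrite !kapYY /=; case: ltngtP => [lt|gt|/val_inj e].
- by rewrite divr1.
- by rewrite div1r (g_inv g_skew).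
- by rewrite e divr1 g_skew.1.
Qed.

Lemma tZY_qc k (i : 'I_n) : (k <= n)%N ->
  qc iT (if (i < k)%N then q i else 1) (tE (eZ k) : T) (tE (eY i)).
Proof.
move=> lek; have := tE_qc (eZ k) (eY i); rewrite kapZl kapYZ_le //.
by rewrite div1r; case: ifP; rewrite ?invr1 ?invrK.
Qed.

Lemma tZZ_qc k l : qc iT 1 (tE (eZ k) : T) (tE (eZ l)).
Proof. by have := tE_qc (eZ k) (eZ l); rewrite !kapZl divr1. Qed.

Lemma tYV i : tE (eY i) * tE (- eY i) = 1 :> T.
Proof. by rewrite tEM kapNr kapYY /= ltnn invr1 scale1r subrr tE0. Qed.

Lemma tVY i : tE (- eY i) * tE (eY i) = 1 :> T.
Proof. by rewrite tEM kapNl kapYY /= ltnn invr1 scale1r addNr tE0. Qed.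

Hypothesis q_neq1 : forall j, q j != 1.

Definition tD (i : nat) : T := tE (eZ i.+1) - tE (eZ i).
Definition tX (i : 'I_n) : T := iT (q i - 1)^-1 * (tE (- eY i) * tD i).
Definition tY (i : 'I_n) : T := tE (eY i).

Lemma qm1_neq0 i : q i - 1 != 0. Proof. by rewrite subr_eq0. Qed.

Lemma tDY_qc (i j : 'I_n) : i != j ->
  qc iT (if (j < i)%N then q j else 1) (tD i) (tE (eY j)).
Proof.
move=> ij; apply: qc_addl; last apply: qc_oppl.
  have := @tZY_qc i.+1 j (ltn_ord i); rewrite ltnS leq_eqVlt.
  by case: eqP => // /val_inj e; rewrite e eqxx in ij.
by apply: tZY_qc; apply: ltnW.
Qed.

Lemma tDD_qc i j : qc iT 1 (tD i) (tD j).
Proof.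
by apply: qc_addl; [|apply: qc_oppl]; (apply: qc_addr; [|apply: qc_oppr]); apply: tZZ_qc.
Qed.

Lemma tXY_qc (i j : 'I_n) : i != j ->
  qc iT (g j i * (if (j < i)%N then q j else 1)) (tX i) (tY j).
Proof.
move=> ij; rewrite /tX; apply: (qc_scalel torus_scalC).
apply: (qc_mull torus_scalC); last exact: tDY_qc.
rewrite -(g_inv g_skew).
by apply: (qc_invl torus_scalC) (tY_qc i j); rewrite ?tVY ?tYV ?(g_neq0 g_skew).
Qed.

Lemma tXX_qc (i j : 'I_n) : (i < j)%N -> qc iT (q i * g i j) (tX i) (tX j).
Proof.
move=> ij; have ne : i != j by rewrite neq_ltn ij.
apply: (qc_scaler torus_scalC); rewrite mulrC.
apply: (qc_mulr torus_scalC).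
- have gi : g i j = (g j i)^-1 by rewrite g_inv.
  rewrite gi; apply: qc_sym; first exact: g_neq0.
  have h := tXY_qc ne; rewrite ltnNge (ltnW ij) /= mulr1 in h.
  have h' : qc iT (g j i)^-1 (tY j) (tX i) by apply: qc_sym; rewrite ?g_neq0.
  rewrite -[g j i]invrK; apply: (qc_invl torus_scalC) h'; rewrite ?tVY ?tYV //.
  by rewrite invr_eq0 g_neq0.
- apply: (qc_scalel torus_scalC); rewrite -[q i]mulr1; apply: (qc_mull torus_scalC).
    rewrite -[q i]invrK; apply: (qc_invl torus_scalC _ (tVY i) (tYV i)); first by rewrite invr_eq0.
    apply: qc_sym => //; have := @tDY_qc j i; rewrite eq_sym ne ij; exact.
  exact: tDD_qc.
Qed.

Lemma tYX (i : 'I_n) : tY i * tX i = iT (q i - 1)^-1 * tD i.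
Proof. by rewrite /tX mulrA -torus_scalC -mulrA (mulrA (tY i)) tYV mul1r. Qed.

Lemma tXY (i : 'I_n) :
  tX i * tY i = iT (q i - 1)^-1 * (iT (q i) * tE (eZ i.+1) - tE (eZ i)).
Proof.
rewrite /tX -!mulrA; congr (_ * _); rewrite mulrBl.
have := @tZY_qc i.+1 i (ltn_ord i); rewrite ltnSn => ->.
have := @tZY_qc i i (ltnW (ltn_ord i)); rewrite ltnn => ->.
rewrite rmorph1 mul1r mulrBr !mulrA -torus_scalC -(mulrA (iT _)) tVY mulr1.
by rewrite mul1r.
Qed.

Lemma tzsum k : (k <= n)%N -> zsum q iT tX tY k = tE (eZ k).
Proof.
elim: k => [|k IHk] ltk; first by rewrite zsum0 eZ0 tE0.
apply: etrans (zsumS q iT tX tY (Ordinal ltk)) _; rewrite IHk ?(ltnW ltk) // tYX.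
rewrite (mulrA (iT _)) -rmorphM divff ?qm1_neq0 // rmorph1 mul1r /tD.
by rewrite [LHS]addrC subrK.
Qed.

Lemma torus_weyl_rels : weyl_rels q g iT tX tY.
Proof.
split=> [i j|i j ij|i j ij|i j ji|j].
- exact: tY_qc.
- exact: tXX_qc.
- have := @tXY_qc i j; rewrite neq_ltn ij ltnNge (ltnW ij) mulr1; exact.
- have := @tXY_qc i j; rewrite neq_ltn ji orbT mulrC; exact.
(* Both sides are combinations of z_(j+1) and z_j. With p = (q_j - 1)^-1 the coefficient of z_(j+1)
   is q_j p on both sides, and for z_j the identity is -p = 1 - q_j p. *)
rewrite tzsum ?(ltnW (ltn_ord j)) // tYX tXY; set z1 := tE _; set z0 := tE _.
rewrite /tD -/z1 -/z0 !iT_scale !scalerBr !scalerA [q j * _]mulrC [RHS]addrCA.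
congr (_ + _); rewrite -{2}[z0]scale1r -scalerBl -scaleNr; congr (_ *: _).
by rewrite -{2}(mulVf (qm1_neq0 j)) mulrBr mulr1 addrAC subrr add0r.
Qed.

End WeylTorus.

(** * Equality and commutation up to a nonzero scalar *)

Section Similar.
Variables (K : fieldType) (B : pzRingType) (i : {rmorphism K -> B}).
Hypothesis iC : forall c u, i c * u = u * i c.
Implicit Types (a b d : B).

Definition sim a b := exists2 c, c != 0 & a = i c * b.
Definition qcomm a b := exists2 c, c != 0 & qc i c a b.

Lemma sim_refl a : sim a a.
Proof. by exists 1; rewrite ?oner_eq0 // rmorph1 mul1r. Qed.

Lemma sim_sym a b : sim a b -> sim b a.
Proof.
move=> [c c0 ->]; exists c^-1; first by rewrite invr_eq0.
by rewrite mulrA -rmorphM mulVf // rmorph1 mul1r.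
Qed.

Lemma sim_trans b a d : sim a b -> sim b d -> sim a d.
Proof.
move=> [c c0 ->] [c' c'0 ->]; exists (c * c'); first by rewrite mulf_neq0.
by rewrite rmorphM mulrA.
Qed.

Lemma simM a a' b b' : sim a a' -> sim b b' -> sim (a * b) (a' * b').
Proof.
move=> [c c0 ->] [c' c'0 ->]; exists (c * c'); first by rewrite mulf_neq0.
by rewrite rmorphM -!mulrA; congr (_ * _); rewrite mulrA -iC !mulrA.
Qed.

Lemma qcomm_sim a b : qcomm a b -> sim (a * b) (b * a).
Proof. by case=> c c0 e; exists c. Qed.

Lemma qcomm_sym a b : qcomm a b -> qcomm b a.
Proof. by move=> [c c0 ab]; exists c^-1; rewrite ?invr_eq0 //; apply: qc_sym. Qed.

Lemma qcommM a b b' : qcomm a b -> qcomm a b' -> qcomm a (b * b').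
Proof.
move=> [c c0 ab] [c' c'0 ab']; exists (c * c'); first by rewrite mulf_neq0.
exact: qc_mulr.
Qed.

Lemma qcomm1 a : qcomm a 1.
Proof. by exists 1; rewrite ?oner_eq0 //; apply/qc_comm; rewrite mulr1 mul1r. Qed.

Lemma qcommX a b k : qcomm a b -> qcomm a (b ^+ k).
Proof.
move=> ab; elim: k => [|k IHk]; first by rewrite expr0; apply: qcomm1.
by rewrite exprS; apply: qcommM.
Qed.

Lemma qcomm_prod (J : eqType) (s : seq J) (P : pred J) (F : J -> B) a :
  (forall j, P j -> qcomm a (F j)) -> qcomm a (\prod_(j <- s | P j) F j).
Proof.
by move=> aF; elim/big_ind: _ => //; [apply: qcomm1 | apply: qcommM].
Qed.

(** The product follows the enumeration of [J]; bringing one factor to the front past the earlier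
    ones costs only a scalar. *)
Lemma prod_extract (J : finType) (F : J -> B) (j : J) :
    (forall k, k != j -> qcomm (F j) (F k)) ->
  sim (\prod_k F k) (F j * \prod_(k | k != j) F k).
Proof.
move=> jF; have : uniq (index_enum J) by apply: index_enum_uniq.
have : j \in index_enum J by rewrite mem_index_enum.
elim: (index_enum J) => // k s IHs; rewrite in_cons /= !big_cons.
have [->|kj] := eqVneq k j.
  move=> _ /andP[js _] /=.
  have -> : \prod_(l <- s | l != j) F l = \prod_(l <- s) F l; last exact: sim_refl.
  rewrite [LHS]big_seq_cond [RHS]big_seq; apply: eq_bigl => l.
  by have [->|] := eqVneq l j; rewrite ?(negPf js) ?andbF ?andbT.
move=> js /andP[_ us] /=.
apply: (@sim_trans (F k * (F j * \prod_(l <- s | l != j) F l))).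
  by apply: simM; [apply: sim_refl | apply: IHs].
by rewrite !mulrA; apply: simM (sim_refl _); apply/qcomm_sim/qcomm_sym/jF.
Qed.

End Similar.

(** * A spanning family of ordered monomials *)

Section Structure.
Variables (K : fieldType) (n : nat) (q : 'I_n -> K) (g : 'M[K]_n).
Hypotheses (q_neq0 : forall j, q j != 0) (g_skew : mul_skew_symmetric g).
Hypothesis q_neq1 : forall j, q j != 1.
Variable M : weyl_model q g.

Local Notation sim := (sim (wc M)).
Local Notation qcomm := (qcomm (wc M)).
Local Notation x := (wx M).
Local Notation y := (wy M).
Local Notation z := (zsum q (wc M) x y).
Local Notation Za := {ffun 'I_n -> nat}.
Local Notation Ya := {ffun 'I_n -> int}.
Local Notation J := (Za * Ya)%type.
Local Notation rels := (w_rels M).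
Let iC := @wcC K n q g M.

Lemma z_qcomm_y (k : nat) i : (k <= n)%N -> qcomm (z k) (y i).
Proof.
move=> lek; exists (if (i < k)%N then q i else 1); last exact: (zsum_y iC rels g_skew).
by case: ifP; rewrite ?oner_eq0.
Qed.

Lemma z_qcomm_x (k : nat) i : (k <= n)%N -> qcomm (z k) (x i).
Proof.
move=> lek; exists (if (i < k)%N then (q i)^-1 else 1); last exact: (zsum_x iC rels q_neq0 g_skew).
by case: ifP; rewrite ?oner_eq0 // invr_eq0.
Qed.

(** Negative powers of y_i are replaced by powers of x_i, which has the opposite degree. [Negz p] is
    -(p + 1), whence the exponent [p.+1]. *)
Definition mpow (i : 'I_n) (k : int) : M :=
  match k with Posz p => y i ^+ p | Negz p => x i ^+ p.+1 end.

Lemma qcomm_mpow a i k : qcomm a (x i) -> qcomm a (y i) -> qcomm a (mpow i k).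
Proof. by case: k => p ax ay; apply: qcommX. Qed.

Lemma qcomm_gens (i j : 'I_n) : i != j ->
  [/\ qcomm (x i) (x j), qcomm (x i) (y j), qcomm (y i) (x j) & qcomm (y i) (y j)].
Proof.
have g0 := g_neq0 g_skew.
have xy (k l : 'I_n) : k != l -> qcomm (x k) (y l).
  move=> kl; exists (if (k < l)%N then g l k else q l * g l k); last exact: (xy_qc rels kl).
  by case: ifP; rewrite ?mulf_neq0.
move=> ij; split; [|exact: xy| |].
- exists (if (i < j)%N then q i * g i j else (q j)^-1 * g i j); last exact: (xx_qc rels).
  by case: ifP; rewrite ?mulf_neq0 ?invr_eq0.
- by apply: qcomm_sym; apply: xy; rewrite eq_sym.
- by exists (g i j) => //; apply: (rel_yy rels).
Qed.

Lemma qcomm_mpow2 (i j : 'I_n) k l : i != j -> qcomm (mpow i k) (mpow j l).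
Proof.
move=> /qcomm_gens[xx xy yx yy].
by apply: qcomm_sym; apply: qcomm_mpow; apply: qcomm_sym; apply: qcomm_mpow.
Qed.

(** For a negative exponent y_i meets an x_i, and the product y_i x_i is a combination of two
    consecutive z_k, so the monomial stays within the span. *)
Lemma y_mpow i (k : int) :
  y i * mpow i k = (if (0 <= k)%R then 1 else y i * x i) * mpow i (k + 1).
Proof.
case: k => [p|[|p]] /=.
- by rewrite mul1r -exprS addn1.
- by rewrite mulr1 expr1.
- by rewrite subn1 /= exprS mulrA.
Qed.

Lemma x_mpow i (k : int) :
  x i * mpow i k = (if (k <= 0)%R then 1 else x i * y i) * mpow i (k - 1).
Proof.
case: k => [[|p]|p] /=.
- by rewrite mul1r expr0 mulr1.
- by rewrite subn1 /= exprS mulrA.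
- by rewrite mul1r -exprS addn0.
Qed.

Definition zmon (a : Za) : M := \prod_(j < n) z j.+1 ^+ a j.
Definition ymon (al : Ya) : M := \prod_(j < n) mpow j (al j).
Definition bas (p : J) : M := zmon p.1 * ymon p.2.

Definition zinc (a : Za) (i : 'I_n) : Za := [ffun j => (a j + (j == i))%N].
Definition yshift (al : Ya) (i : 'I_n) (k : int) : Ya :=
  [ffun j => al j + (if j == i then k else 0)].

Lemma z_zmon (i : 'I_n) a : sim (z i.+1 * zmon a) (zmon (zinc a i)).
Proof.
have zz j k : qcomm (z (j : 'I_n).+1) (z (k : 'I_n).+1).
  exists 1; rewrite ?oner_eq0 //; apply/qc_comm; exact: (zsum_comm iC rels q_neq0 g_skew).
have zX j k p r : qcomm (z (j : 'I_n).+1 ^+ p) (z (k : 'I_n).+1 ^+ r).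
  by apply: qcommX => //; apply: qcomm_sym; apply: qcommX => //; apply: zz.
apply: (@sim_trans _ _ _ (z i.+1 * (z i.+1 ^+ a i * \prod_(k | k != i) z k.+1 ^+ a k))).
  by apply: simM; [|apply: sim_refl|apply: prod_extract].
apply: sim_sym; rewrite mulrA -exprS.
have := @prod_extract _ _ (wc M) iC _ (fun j : 'I_n => z j.+1 ^+ zinc a i j) i.
rewrite !ffunE eqxx addn1 => /(_ (fun _ _ => zX _ _ _ _)).
congr (sim _ (_ * _)); apply: eq_bigr => j ji.
by rewrite ffunE (negPf ji) addn0.
Qed.

Lemma ymon_extract i al :
  sim (ymon al) (mpow i (al i) * \prod_(k | k != i) mpow k (al k)).
Proof.
by apply: prod_extract => // k ki; apply: qcomm_mpow2; rewrite eq_sym.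
Qed.

Lemma ymon_shift i k al :
  sim (ymon (yshift al i k)) (mpow i (al i + k) * \prod_(k | k != i) mpow k (al k)).
Proof.
have := ymon_extract i (yshift al i k); rewrite ffunE eqxx.
congr (sim _ (_ * _)); apply: eq_bigr => j ji.
by rewrite ffunE (negPf ji) addr0.
Qed.

Lemma y_ymon i al :
  sim (y i * ymon al) ((if (0 <= al i)%R then 1 else y i * x i) * ymon (yshift al i 1)).
Proof.
apply: sim_trans (simM iC (sim_refl _ _) (ymon_extract i al)) _.
rewrite mulrA y_mpow -mulrA; apply: simM (sim_refl _ _) _ => //.
exact/sim_sym/ymon_shift.
Qed.

Lemma x_ymon i al :
  sim (x i * ymon al) ((if (al i <= 0)%R then 1 else x i * y i) * ymon (yshift al i (-1))).
Proof.
apply: sim_trans (simM iC (sim_refl _ _) (ymon_extract i al)) _.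
rewrite mulrA x_mpow -mulrA; apply: simM (sim_refl _ _) _ => //.
exact/sim_sym/ymon_shift.
Qed.

Lemma z_qcomm_zmon_gen i a : qcomm (x i) (zmon a) /\ qcomm (y i) (zmon a).
Proof.
split; apply: qcomm_prod => // j _; apply: qcommX => //; apply: qcomm_sym.
  exact: z_qcomm_x.
exact: z_qcomm_y.
Qed.

Definition spanned (u : M) := exists P : {malg K[J]}, u = malg_eval (wc M) bas P.

Lemma spanned_comb c u v : spanned u -> spanned v -> spanned (wc M c * u + v).
Proof. by move=> [P ->] [Q ->]; exists (c *: P + Q); rewrite malg_evalP. Qed.

Lemma spanned0 : spanned 0.
Proof. by exists 0; rewrite malg_eval0. Qed.

Lemma spanned_scale c u : spanned u -> spanned (wc M c * u).
Proof. by move=> Su; rewrite -[_ * u]addr0; apply: spanned_comb => //; apply: spanned0. Qed.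

Lemma spanned_sim u v : sim u v -> spanned v -> spanned u.
Proof. by move=> [c _ ->]; apply: spanned_scale. Qed.

Lemma spanned_bas p : spanned (bas p).
Proof. by exists << p >>; rewrite malg_evalU. Qed.

Lemma spanned_z k p : (k <= n)%N -> spanned (z k * bas p).
Proof.
case: k => [_|k ltk]; first by rewrite zsum0 mul1r; apply: spanned_bas.
rewrite mulrA; apply: spanned_sim (spanned_bas (zinc p.1 (Ordinal ltk), p.2)).
apply: simM (sim_refl _ _) => //; exact: (z_zmon (Ordinal ltk)).
Qed.

Lemma wc_solve c u v : c != 0 -> wc M c * u = v -> u = wc M c^-1 * v.
Proof. by move=> c0 <-; rewrite mulrA -rmorphM mulVf // rmorph1 mul1r. Qed.

(** Common form of the multiplications by x_i and y_i. The flag [b] says that exponents simply add;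
    otherwise y_i x_i arises, with c = 1, or x_i y_i, with c = q_i, and c' = (q_i - 1)^-1 in both
    cases. *)
Lemma spanned_z2 (b : bool) i (c c' : K) (a : Za) al :
  spanned (zmon a * ((if b then 1 else wc M c' * (wc M c * z (i : 'I_n).+1 - z i)) * ymon al)).
Proof.
case: b; first by rewrite mul1r; apply: (spanned_bas (a, al)).
rewrite -mulrA (mulrA (zmon a)) -iC -mulrA; apply: spanned_scale.
have zz k : (k <= n)%N -> zmon a * (z k * ymon al) = z k * bas (a, al).
  move=> lek; rewrite mulrA [RHS]mulrA; congr (_ * _); symmetry.
  apply/(qc_comm (wc M)); rewrite -[X in qc _ X]/(1 : K).
  have -> : (1 : K) = \prod_(j : 'I_n) 1 by rewrite big1.
  apply: qc_prodr => // j; apply/qc_comm.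
  by apply: commrX; apply: (zsum_comm iC rels q_neq0 g_skew).
rewrite mulrBl mulrBr -[_ * ymon al]mulrA mulrA -iC -!mulrA (zz _ (ltn_ord i)) (zz _ (ltnW (ltn_ord i))).
apply: spanned_comb; first exact: spanned_z.
by rewrite -mulN1r -(rmorphN1 (wc M)); apply/spanned_scale/spanned_z/ltnW.
Qed.

Lemma spanned_y i u : spanned u -> spanned (y i * u).
Proof.
move=> [P ->]; elim/malg_ind: P => [|c p P IHP].
  by rewrite malg_eval0 mulr0; apply: spanned0.
rewrite malg_evalP malg_evalU mulrDr mulrA -iC -mulrA; apply: spanned_comb IHP.
have [_ /qcomm_sim h] := z_qcomm_zmon_gen i p.1.
rewrite mulrA; apply: spanned_sim (simM iC h (sim_refl _ _)) _.
rewrite -mulrA; apply: spanned_sim (simM iC (sim_refl _ _) (y_ymon _ _)) _.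
have -> : y i * x i = wc M (q i - 1)^-1 * (wc M 1 * z i.+1 - z i).
  by apply: wc_solve; rewrite ?subr_eq0 // yx_zsum rmorph1 mul1r.
exact: spanned_z2.
Qed.

Lemma spanned_x i u : spanned u -> spanned (x i * u).
Proof.
move=> [P ->]; elim/malg_ind: P => [|c p P IHP].
  by rewrite malg_eval0 mulr0; apply: spanned0.
rewrite malg_evalP malg_evalU mulrDr mulrA -iC -mulrA; apply: spanned_comb IHP.
have [/qcomm_sim h _] := z_qcomm_zmon_gen i p.1.
rewrite mulrA; apply: spanned_sim (simM iC h (sim_refl _ _)) _.
rewrite -mulrA; apply: spanned_sim (simM iC (sim_refl _ _) (x_ymon _ _)) _.
have -> : x i * y i = wc M (q i - 1)^-1 * (wc M (q i) * z i.+1 - z i).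
  by apply: wc_solve; rewrite ?subr_eq0 // (xy_zsum rels).
exact: spanned_z2.
Qed.

(** The span contains 1 and is stable under left multiplication by the generators. *)
Lemma weyl_spanned u : spanned u.
Proof.
elim/w_ind: u => [|c u v||]; [|exact: spanned_comb|exact: spanned_x|exact: spanned_y].
have -> : 1 = bas ([ffun=> 0%N], [ffun=> 0]); last exact: spanned_bas.
rewrite /bas /zmon /ymon !big1 ?mulr1 // => j _; by rewrite ffunE.
Qed.

End Structure.

(** * Injectivity of the map to the torus, and the monomials in its image *)

Section Embedding.
Variables (K : fieldType) (n : nat) (q : 'I_n -> K) (g : 'M[K]_n).
Hypotheses (q_neq0 : forall j, q j != 0) (g_skew : mul_skew_symmetric g).
Hypothesis q_nroot : forall j, ~ is_root_of_unity (q j).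
Variable M : weyl_model q g.
Variable T : torus (wmat q g).

Local Notation x := (wx M).
Local Notation y := (wy M).
Local Notation z := (zsum q (wc M) x y).
Local Notation I := ('I_n + 'I_n)%type.
Local Notation G := {ffun I -> int}.
Local Notation Za := {ffun 'I_n -> nat}.
Local Notation Ya := {ffun 'I_n -> int}.
Local Notation J := (Za * Ya)%type.
Local Notation kap := (bichar (wmat q g)).
Local Notation w0 := (wmat_neq0 q_neq0 g_skew).
Implicit Types (v w : G) (al be : Ya) (P : {malg K[J]}).

Lemma q_exprz_eq1 i (k : int) : q i ^ k = 1 -> k = 0.
Proof.
have qX p : q i ^+ p.+1 = 1 -> False.
  by move=> e; apply: (q_nroot (j := i)); exists p.+1 => //; apply/unity_rootP.
case: k => [[|p]|p] //= e; case: (qX p) => //.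
by apply: invr_inj; rewrite invr1.
Qed.

Lemma q_neq1 i : q i != 1.
Proof. by apply/eqP => e; have := @q_exprz_eq1 i 1; rewrite expr1z => /(_ e). Qed.

Variable iT : {rmorphism K -> T}.
Hypothesis iTE : forall c, iT c = c%:A.
Variable psi : {rmorphism M -> T}.
Hypotheses (psi_c : forall c, psi (wc M c) = iT c)
  (psi_x : forall i, psi (x i) = tX iT i) (psi_y : forall i, psi (y i) = tE (eY i)).

Lemma psi_z k : (k <= n)%N -> psi (z k) = tE (eZ n k).
Proof.
move=> lek; rewrite -(tzsum q_neq0 g_skew iTE q_neq1 lek) /zsum rmorphD rmorph1.
congr (_ + _); rewrite rmorph_sum; apply: eq_bigr => i _.
by rewrite !rmorphM psi_c psi_x psi_y.
Qed.

Lemma psi_scale c a : psi (wc M c * a) = c *: psi a.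
Proof. by rewrite rmorphM psi_c iTE mulr_algl. Qed.

Lemma tX_two i : exists k1 k2, [/\ k1 != 0, k2 != 0 &
  tX iT i = k1 *: tE (eZ n i.+1 - eY i) - k2 *: tE (eZ n i - eY i) :> T].
Proof.
have qm1 : (q i - 1)^-1 != 0 by rewrite invr_eq0 subr_eq0 q_neq1.
pose k u := (q i - 1)^-1 * kap (- eY i) u.
exists (k (eZ n i.+1)), (k (eZ n i)); split; rewrite ?mulf_neq0 ?(bichar_neq0 w0) //.
rewrite /tX iTE mulr_algl mulrBr !tEM scalerBr !scalerA.
by rewrite ![- eY i + _]addrC.
Qed.

Lemma eZ_inj (i : 'I_n) : eZ n i.+1 != eZ n i.
Proof.
apply/eqP => /ffunP/(_ (inl i)); rewrite !ffunE eqxx.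
by rewrite gtn_eqF.
Qed.

Lemma tX_neq0 i : tX iT i != 0.
Proof.
have [k1 [k2 [k10 k20 ->]]] := tX_two i.
apply/eqP => /(congr1 (tcoef (eZ n i.+1 - eY i))).
rewrite tcoefD tcoefN !tcoefZ !tcoefE eqxx (inj_eq (addIr _)) [_ == _ n _]eq_sym.
rewrite (negPf (eZ_inj i)) mulr0 subr0 mulr1 tcoef0.
by move/eqP; rewrite (negPf k10).
Qed.

Lemma tX_nmono i w : ~ monomial (tX iT i) w.
Proof.
have [k1 [k2 [k10 k20 e]]] := tX_two i; move=> mw.
have e1 : eZ n i.+1 - eY i = w.
  apply/eqP; rewrite -(monomial_coef _ mw) e tcoefD tcoefN !tcoefZ !tcoefE eqxx.
  rewrite (inj_eq (addIr _)) [_ == eZ n i.+1]eq_sym.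
  by rewrite (negPf (eZ_inj i)) mulr0 subr0 mulr1.
have e2 : eZ n i - eY i = w.
  apply/eqP; rewrite -(monomial_coef _ mw) e tcoefD tcoefN !tcoefZ !tcoefE eqxx.
  rewrite (inj_eq (addIr _)) (negPf (eZ_inj i)) mulr0 add0r mulr1 oppr_eq0.
  exact: k20.
by have := eZ_inj i; rewrite -(inj_eq (addIr (- eY i))) e1 e2 eqxx.
Qed.

(* Homogeneity for the grading in which y_i has degree e_i and x_i degree -e_i. *)
Definition yhom (al : Ya) := @tsupp _ _ _ T (fun w => forall i, w (inr i) = al i).
Definition znonneg := @tsupp _ _ _ T (fun w => forall i, (0 <= w (inl i))%R).

Lemma yhomM al be a b : yhom al a -> yhom be b -> yhom (al + be) (a * b).
Proof.
by apply: tsuppM => u v ua vb i; rewrite !ffunE ua vb.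
Qed.

Definition ydelta (i : 'I_n) : Ya := [ffun j => (j == i)%:Z].

Lemma yhom_y i : yhom (ydelta i) (psi (y i)).
Proof. by rewrite psi_y; apply: tsuppE => j; rewrite !ffunE. Qed.

Lemma yhom_x i : yhom (- ydelta i) (psi (x i)).
Proof.
rewrite psi_x; have [k1 [k2 [_ _ ->]]] := tX_two i.
apply: tsuppD; last rewrite -scaleNr; apply: tsuppZ; apply: tsuppE => j;
  by rewrite !ffunE add0r.
Qed.

Lemma yhom1 : yhom 0 1.
Proof. by rewrite -tE0; apply: tsuppE => i; rewrite !ffunE. Qed.

Lemma yhomX al a p : yhom al a -> yhom (al *+ p) (a ^+ p).
Proof.
move=> ah; elim: p => [|p IHp]; first by rewrite mulr0n expr0; apply: yhom1.
by rewrite exprS mulrS; apply: yhomM.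
Qed.

Lemma yhom_mpow i k : yhom (ydelta i *~ k) (psi (mpow M i k)).
Proof.
case: k => p; rewrite /= rmorphXn; first exact/yhomX/yhom_y.
by rewrite NegzE mulrNz -mulNrz; apply/yhomX/yhom_x.
Qed.

Lemma yhom_prod (s : seq 'I_n) (F : 'I_n -> Ya) (f : 'I_n -> T) :
  (forall i, yhom (F i) (f i)) -> yhom (\sum_(i <- s) F i) (\prod_(i <- s) f i).
Proof.
move=> Ff; elim: s => [|i s IHs]; first by rewrite !big_nil; apply: yhom1.
by rewrite !big_cons; apply: yhomM.
Qed.

Lemma yhom_ymon al : yhom al (psi (ymon M al)).
Proof.
have {1}-> : al = \sum_i ydelta i *~ al i.
  apply/ffunP => j; rewrite sum_ffunE (bigD1 j) //= big1 ?addr0 => [|k kj].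
    by rewrite ffunMzE ffunE eqxx intz.
  by rewrite ffunMzE ffunE eq_sym (negPf kj) mul0rz.
by rewrite rmorph_prod; apply: yhom_prod => i; apply: yhom_mpow.
Qed.

Definition zvec (a : Za) : G := [ffun t : I => if t is inl j then (a j)%:Z else 0%:Z].

Lemma zvec_inj : injective zvec.
Proof.
by move=> a b /ffunP e; apply/ffunP => j; have := e (inl j); rewrite !ffunE => -[].
Qed.

Lemma tE_noY (u : G) v : (forall i, u (inr i) = 0) -> tE u * tE v = tE (u + v) :> T.
Proof. by move=> u0; rewrite tEM kap_noY // scale1r. Qed.

Lemma psi_zmon a : psi (zmon M a) = tE (zvec a).
Proof.
have -> : zvec a = \sum_(j < n) eZ n j.+1 *+ a j.
  apply/ffunP => -[j|j]; rewrite sum_ffunE ffunE.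
    rewrite (bigD1 j) //= big1 ?addr0 => [|k kj]; rewrite ffunMnE ffunE.
      by rewrite eqxx natz.
    have -> : (j.+1 == k.+1) = false by apply: contraNF kj => /eqP[e]; apply/eqP/val_inj.
    by rewrite mul0rn.
  by rewrite big1 // => k _; rewrite ffunMnE ffunE mul0rn.
have noY (s : seq 'I_n) i : (\sum_(j <- s) eZ n j.+1 *+ a j) (inr i) = 0.
  by rewrite sum_ffunE big1 // => k _; rewrite ffunMnE ffunE mul0rn.
rewrite rmorph_prod; elim: (index_enum _) => [|j s IHs]; first by rewrite !big_nil tE0.
rewrite !big_cons IHs rmorphXn psi_z //.
have -> : tE (eZ n j.+1) ^+ a j = tE (eZ n j.+1 *+ a j) :> T.
  elim: (a j) => [|p IHp]; first by rewrite expr0 mulr0n tE0.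
  by rewrite exprS mulrS IHp tE_noY // => i; rewrite ffunE.
by rewrite tE_noY // => i; rewrite ffunMnE ffunE mul0rn.
Qed.

Lemma psi_ymon_neq0 al : psi (ymon M al) != 0.
Proof.
rewrite rmorph_prod; elim/big_ind: _ => [|a b|i _]; first exact: oner_neq0.
  exact: (torus_mulf_neq0 w0).
have X0 (b : T) p : b != 0 -> b ^+ p != 0.
  move=> b0; elim: p => [|p IHp]; first exact: oner_neq0.
  by rewrite exprS; apply: (torus_mulf_neq0 w0).
by case: (al i) => p; rewrite rmorphXn; apply: X0; rewrite ?psi_y ?tE_neq0 ?psi_x ?tX_neq0.
Qed.

(** The coefficient of [ymon M al] in the expansion [P]: a polynomial in the z_k, to be multiplied
    by [ymon M al] on the right. *)
Definition part (al : Ya) (P : {malg K[J]}) : M :=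
  \sum_(p <- msupp P | p.2 == al) wc M P@_p * zmon M p.1.

Lemma yhom_part al P : yhom 0 (psi (part al P)).
Proof.
rewrite rmorph_sum; elim/big_ind: _ => [|a b|p _]; [exact: tsupp0|exact: tsuppD|].
rewrite psi_scale psi_zmon; apply: tsuppZ; apply: tsuppE => i.
by rewrite !ffunE.
Qed.

Lemma tcoef_part al P a : tcoef (zvec a) (psi (part al P)) = P@_(a, al).
Proof.
have H p : tcoef (zvec a) (psi (wc M P@_p * zmon M p.1)) = P@_p * (p.1 == a)%:R.
  by rewrite psi_scale psi_zmon tcoefZ tcoefE (inj_eq zvec_inj).
rewrite rmorph_sum tcoef_sum; under eq_bigr do rewrite H.
have [aP|aP] := boolP ((a, al) \in msupp P); last first.
  rewrite big_seq_cond big1; first by rewrite mcoeff_outdom.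
  move=> [a' al'] /= /andP[pP /eqP e]; subst al'.
  by case: eqP pP aP => [-> ->|_]; rewrite ?mulr0.
rewrite big_mkcond (bigD1_seq (a, al)) ?fset_uniq //= !eqxx mulr1 big1 ?addr0 //.
move=> [a' al'] /= ne; case: eqP => // e.
have [e'|] := eqVneq a' a; last by rewrite mulr0.
by rewrite e e' eqxx in ne.
Qed.

Lemma part_ymon al P w : (forall i, w (inr i) = al i) ->
  tcoef w (psi (part al P * ymon M al)) = tcoef w (psi (malg_eval (wc M) (@bas _ _ _ _ M) P)).
Proof.
move=> wal; rewrite /part /malg_eval mulr_suml !rmorph_sum !tcoef_sum.
rewrite [RHS](bigID (fun p : J => p.2 == al)) /= [X in _ + X]big1 ?addr0.
  by apply: eq_bigr => p /eqP <-; rewrite -mulrA.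
move=> p /eqP ne; apply/eqP; apply: contrapT => /negP nz; apply: ne.
have : yhom p.2 (psi (bas M p)).
  rewrite -[p.2]add0r rmorphM; apply: (@yhomM 0 p.2); last exact: yhom_ymon.
  by rewrite psi_zmon; apply: tsuppE => i; rewrite !ffunE.
move=> /(_ w) hw; apply/ffunP => i; rewrite -wal -hw //.
by move: nz; rewrite psi_scale tcoefZ mulf_eq0 negb_or => /andP[].
Qed.

(** The component of degree [al] of the image is [psi (part al P)] times [psi (ymon M al)], whose
    second factor is nonzero. As the torus is a domain, every [psi (part al P)] vanishes, and its
    torus coefficients are those of [P]. *)
Lemma psi_inj0 (u : M) : psi u = 0 -> u = 0.
Proof.
have [P ->] := weyl_spanned q_neq0 g_skew q_neq1 u => e.
suff -> : P = 0 by rewrite malg_eval0.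
apply/malgP => -[a al]; rewrite mcoeff0 -tcoef_part.
suff -> : psi (part al P) = 0 by rewrite tcoef0.
apply/eqP; apply: contrapT => /negP nz.
have := torus_mulf_neq0 w0 nz (psi_ymon_neq0 al); rewrite -rmorphM.
case/tcoef_neq0 => w ww; case/negP: (ww); rewrite part_ymon ?e ?tcoef0 //.
have := yhomM (@yhom_part al P) (@yhom_ymon al); rewrite add0r -rmorphM; exact.
Qed.

Lemma psi_inj : injective psi.
Proof.
move=> u v e; apply/eqP; rewrite -subr_eq0; apply/eqP/psi_inj0.
by rewrite rmorphB e subrr.
Qed.

(** In an expansion of [u] only the terms of degree [al] contribute to the image, and they share the
    right factor [ymon M al]; injectivity carries this back to the algebra. *)
Lemma yhom_factor al (u : M) : yhom al (psi u) ->
  exists2 p, yhom 0 (psi p) & u = p * ymon M al.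
Proof.
have [P eP] := weyl_spanned q_neq0 g_skew q_neq1 u => uh.
exists (part al P); first exact: yhom_part.
apply: psi_inj; apply: tcoef_inj => w.
have [wal|nwal] := pselect (forall i, w (inr i) = al i).
  by rewrite part_ymon // eP.
have z0 b : yhom al b -> tcoef w b = 0.
  by move=> bh; apply/eqP; apply: contrapT => /negP/bh.
rewrite !z0 //; have := yhomM (@yhom_part al P) (@yhom_ymon al).
by rewrite add0r -rmorphM.
Qed.

(** The images of the generators have exponents 0 or 1 at the z_k, and exponents add in products. *)
Lemma znonneg_psi (u : M) : znonneg (psi u).
Proof.
have znM a b : znonneg a -> znonneg b -> znonneg (a * b).
  by apply: tsuppM => v v' vn v'n i; rewrite ffunE addr_ge0.
elim/w_ind: u => [|c u v hu hv|i u hu|i u hu].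
- by rewrite rmorph1 -tE0; apply: tsuppE => i; rewrite ffunE.
- by rewrite rmorphD psi_scale; apply: tsuppD hv; apply: tsuppZ.
- rewrite rmorphM; apply: znM hu; rewrite psi_x.
  have [k1 [k2 [_ _ ->]]] := tX_two i.
  apply: tsuppD; last rewrite -scaleNr; apply: tsuppZ; apply: tsuppE => j;
    by rewrite !ffunE subr0.
- rewrite rmorphM; apply: znM hu; rewrite psi_y; apply: tsuppE => j.
  by rewrite !ffunE.
Qed.

(* If the exponent of y_i were negative, then x_i, which is not a monomial of the
   torus, would divide a monomial. *)
Lemma monomial_nonneg (u : M) w : monomial (psi u) w -> forall t, (0 <= w t)%R.
Proof.
move=> mw; have ww : tcoef w (psi u) != 0 by rewrite (monomial_coef _ mw).
case=> i; first exact: znonneg_psi ww i.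
rewrite leNgt; apply/negP => wi.
pose al : Ya := [ffun j => w (inr j)].
have [|p _ e] := @yhom_factor al u.
  by move=> v; rewrite (monomial_coef _ mw) => /eqP-> j; rewrite ffunE.
move: mw; rewrite e rmorphM => /(monomial_factors w0)[_ [v [_ mv _]]].
have [c c0 ec] := ymon_extract q_neq0 g_skew M i al.
move: mv; rewrite ec psi_scale => -[k k0 ek].
have {k k0 ek} mv : monomial (psi (mpow M i (al i) * \prod_(k | k != i) mpow M k (al k))) v.
  exists (c^-1 * k); first by rewrite mulf_neq0 ?invr_eq0.
  by rewrite -scalerA -ek scalerA mulVf // scale1r.
move: mv; rewrite rmorphM => /(monomial_factors w0)[v1 [_ [mv1 _ _]]].
(* The exponent being negative, this power is a positive power of x_i, so that a factor x_i splits
   off. *)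
move: mv1; rewrite ffunE; case: (w (inr i)) wi => // p' _ /=.
rewrite exprS rmorphM => /(monomial_factors w0)[v2 [_ [mv2 _ _]]].
by move: mv2; rewrite psi_x; apply: tX_nmono.
Qed.

End Embedding.

(** * Normal and atomic elements *)

Section Intrinsic.
Variables (K : fieldType) (B : pzRingType) (i : {rmorphism K -> B}).

Definition scalar (u : B) := exists2 c, c != 0 & u = i c.
(** Nonzero scalars are not excluded; in [weyl_atomic] they fall under the commuting alternative. *)
Definition atomic (t : B) := forall u v, u * v = t -> scalar u \/ scalar v.
(** Of the equality A u = u A only the inclusion of A u in u A is recorded; it lets each [a] be
    conjugated by [u]. *)
Definition normal (u : B) := u != 0 /\ forall a, exists b, a * u = u * b.

End Intrinsic.

Section NormalElements.
Variables (K : fieldType) (n : nat) (q : 'I_n -> K) (g : 'M[K]_n).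
Hypotheses (q_neq0 : forall j, q j != 0) (g_skew : mul_skew_symmetric g).
Hypothesis q_nroot : forall j, ~ is_root_of_unity (q j).
Variable M : weyl_model q g.

Local Notation x := (wx M).
Local Notation y := (wy M).
Local Notation z := (zsum q (wc M) x y).
Local Notation I := ('I_n + 'I_n)%type.
Local Notation G := {ffun I -> int}.
Local Notation kap := (bichar (wmat q g)).
Local Notation w0 := (wmat_neq0 q_neq0 g_skew).
Local Notation qn1 := (q_neq1 q_nroot).
Local Notation sim := (sim (wc M)).
Local Notation qcomm := (qcomm (wc M)).
Let iC := @wcC K n q g M.
Implicit Types (v w : G).

Section Torus.
Variable T : torus (wmat q g).
Variable iT : {rmorphism K -> T}.
Hypothesis iTE : forall c, iT c = c%:A.
Variable psi : {rmorphism M -> T}.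
Hypotheses (psi_c : forall c, psi (wc M c) = iT c)
  (psi_x : forall i, psi (x i) = tX iT i) (psi_y : forall i, psi (y i) = tE (eY i)).

Let psiZ := psi_scale iTE psi_c.
Let psiI := psi_inj q_neq0 g_skew q_nroot iTE psi_c psi_x psi_y.
Let psi_zE := psi_z q_neq0 g_skew q_nroot iTE psi_c psi_x psi_y.
Let psi_nonneg := monomial_nonneg q_neq0 g_skew q_nroot iTE psi_c psi_x psi_y.

Lemma psi_neq0 u : u != 0 -> psi u != 0.
Proof. by apply: contraNneq => e; apply/eqP; apply: psiI; rewrite e rmorph0. Qed.

Lemma psi_scalar u : monomial (psi u) 0 -> scalar (wc M) u.
Proof.
move=> [k k0 e]; exists k => //; apply: psiI.
by rewrite e psi_c iTE tE0.
Qed.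

Lemma kap_prod v w : kap v w = \prod_l kap (eY l) w ^ v (inr l).
Proof.
rewrite kapE; apply: eq_bigr => l _; rewrite kapYl.
elim/big_ind2: _ => [|a b c d -> ->|t _]; first by rewrite exp1rz.
  by rewrite expfzMl.
by rewrite mulrC exprz_exp.
Qed.

(** Among the y_l only y_j commutes differently with z_(j+1) and with z_j, by the factor q_j^-1. The
    two values thus differ by q_j to the power [- w (inr j)], which is 1 only for exponent 0. *)
Lemma kapZr_step w (j : 'I_n) :
  kap w (eZ n j.+1) = kap w (eZ n j) -> w (inr j) = 0.
Proof.
have lej := ltn_ord j; have lej' := ltnW lej.
rewrite !kap_prod (bigD1 j) //= [RHS](bigD1 j) //= !kapYZ_le //.
rewrite ltnn ltnSn exp1rz mul1r => e.
have {e} : (q j)^-1 ^ w (inr j) = 1.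
  apply: (mulIf (x := \prod_(l | l != j) kap (eY l) (eZ n j) ^ w (inr l))).
    by apply/prodf_neq0 => l _; rewrite expfz_neq0 // (bichar_neq0 w0).
  rewrite mul1r -[RHS]e; congr (_ * _); apply: eq_bigr => l lj.
  rewrite !kapYZ_le //; have -> // : (l < j.+1)%N = (l < j)%N.
  by rewrite ltnS leq_eqVlt (_ : (l == j :> nat) = false) //; apply: negbTE.
rewrite exprz_inv => e; have := @q_exprz_eq1 _ _ _ q_nroot j (- w (inr j)).
by move=> /(_ e)/eqP; rewrite oppr_eq0 => /eqP.
Qed.

(** Let l be the largest index with [w (inl l)] nonzero. As y_l acquires a factor q_l^-1 from the
    coordinates [inl k] with k >= l only, the value at y_l is q_l to the power [- w (inl l)], which
    is not 1. *)
Lemma kapYl_trivial w : (forall j, w (inr j) = 0) ->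
  (forall j, kap (eY j) w = 1) -> w = 0.
Proof.
move=> wY wZ; apply/ffunP => -[j|j]; rewrite ffunE //.
apply/eqP; apply: contrapT => /negP wj.
case: (@arg_maxnP _ j (fun j => w (inl j) != 0) (fun j => nat_of_ord j) wj) => l wl lmax.
have := wZ l; rewrite kapYl big_sumType /= [X in _ * X]big1 ?mulr1; last first.
  by move=> k _; rewrite wY expr0z.
rewrite (bigD1 l) //= leqnn big1 ?mulr1 => [e|k kl].
  case/eqP: wl; have := @q_exprz_eq1 _ _ _ q_nroot l (- w (inl l)).
  by rewrite -exprz_inv => /(_ e)/eqP; rewrite oppr_eq0 => /eqP.
have [->|/lmax] := eqVneq (w (inl k)) 0; first by rewrite expr0z.
rewrite /= => kl'.
case: leqP => [lk|_]; last by rewrite exp1rz.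
by case/eqP: kl; apply/val_inj/eqP; rewrite eqn_leq kl' lk.
Qed.

(** Conjugating [tE h] by [u] rescales it, by [torus_conj]. So all exponents of [u] have the same
    commutation factor with [h], and it cancels in their difference. *)
Lemma normal_supp u a h v v' : normal u -> psi a = tE h ->
  tcoef v (psi u) != 0 -> tcoef v' (psi u) != 0 -> kap h (v - v') = kap (v - v') h.
Proof.
move=> [u0 un] ah uv uv'; have [b e] := un a.
have {}e : tE h * psi u = psi u * psi b by rewrite -ah -!rmorphM e.
have [k k0 eb] := torus_conj w0 (psi_neq0 u0) e.
rewrite eb -scalerAr in e.
have ev := torus_qcomm_supp e uv; have ev' := torus_qcomm_supp e uv'.
rewrite (bicharDl w0) (bicharDr w0) kapNl // kapNr // ev ev' invfM mulrACA divff //.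
by rewrite mul1r.
Qed.

(* Normality with respect to the z_k and the y_j leaves a single exponent. As for
   x_j = k1 E_A - k2 E_B, conjugation by [u] multiplies E_A and E_B by [cA] and
   [cB]; if these were different, then E_B would be in the image of [psi]. *)
Lemma normal_monomial u : normal u ->
  exists2 v, monomial (psi u) v & forall j, v (inr j) = 0.
Proof.
move=> nu; have [u0 un] := nu; have [v uv] := tcoef_neq0 (psi_neq0 u0).
have mv : monomial (psi u) v.
  exists (tcoef v (psi u)) => //.
  rewrite {1}(@torus_sum _ _ _ _ [:: v] (psi u)) ?big_seq1 // => v' uv'.
  rewrite inE; apply/eqP; apply: subr0_eq.
  have Zd k : (k <= n)%N -> kap (v' - v) (eZ n k) = 1.
    by move=> lek; rewrite -(normal_supp nu (psi_zE lek) uv' uv) kapZl.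
  have Y0 j : (v' - v) (inr j) = 0.
    by apply: kapZr_step; rewrite !Zd // ltnW.
  apply: kapYl_trivial => // j.
  by rewrite (normal_supp nu (psi_y j) uv' uv) kap_noY.
exists v => // j; apply: kapZr_step.
have [b e] := un (x j); have [k1 [k2 [k10 k20 eX]]] := tX_two q_neq0 g_skew q_nroot iTE j.
set A := eZ n j.+1 - eY j in eX; set B := eZ n j - eY j in eX.
have [k k0 eu] := mv.
have cE h : tE h * psi u = (kap h v / kap v h) *: (psi u * tE h).
  rewrite eu -scalerAl -scalerAr !tEM !scalerA addrC; congr (_ *: _).
  by field; apply: (bichar_neq0 w0).
pose cA := kap A v / kap v A; pose cB := kap B v / kap v B.
have eb : psi b = (k1 * cA) *: tE A - (k2 * cB) *: tE B.
  have inj a a' : psi u * a = psi u * a' -> a = a'.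
    move=> ea; apply/eqP; rewrite -subr_eq0; apply: contrapT => /negP aa'.
    have := torus_mulf_neq0 w0 (psi_neq0 u0) aa'; rewrite mulrBr ea subrr.
    by rewrite eqxx.
  apply: inj; rewrite -rmorphM -e rmorphM psi_x eX mulrBl -!scalerAl !cE.
  by rewrite mulrBr -!scalerAr !scalerA.
have cAB : cA = cB.
  apply/eqP; apply: contrapT => /negP; rewrite -subr_eq0 => cAB.
  have mB : monomial (psi (wc M (- cA) * x j + b)) B.
    exists (k2 * (cA - cB)); first by rewrite mulf_neq0.
    rewrite rmorphD psiZ psi_x eX eb scalerBr !scalerA addrACA -scalerDl -opprD.
    rewrite mulNr [k1 * _]mulrC addNr scale0r add0r -scalerDl -scaleNr; congr (_ *: _).
    by rewrite mulNr opprD opprK mulrBr [k2 * cA]mulrC.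
  (* The exponent of y_j in [B] is -1, which no monomial in the image allows. *)
  by have := psi_nonneg mB (inr j); rewrite !ffunE eqxx add0r.
have nz := bichar_neq0 w0.
(* The contributions of y_j^-1 to [cA] and [cB] are equal and cancel; what is left compares z_(j+1)
   with z_j, as [kapZr_step] requires. *)
move: cAB; rewrite /cA /cB /A /B !(bicharDl w0) !(bicharDr w0) !kapZl !mul1r.
by move/(mulfI (nz _ _))/invr_inj/(mulIf (nz _ _)).
Qed.

Lemma monomial_qcomm a b u v : monomial (psi a) u -> monomial (psi b) v -> qcomm a b.
Proof.
move=> [k k0 ea] [l l0 eb]; exists (kap u v / kap v u).
  by rewrite mulf_neq0 ?invr_eq0 ?(bichar_neq0 w0).
apply: psiI; rewrite psiZ !rmorphM ea eb -!scalerAl -!scalerAr !tEM !scalerA.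
rewrite [v + u]addrC; congr (_ *: _).
by field; apply: (bichar_neq0 w0).
Qed.

(** Neither image involves the y_j, and the bicharacter is trivial on such exponents. *)
Lemma yhom0_commute a b v : monomial (psi a) v -> (forall j, v (inr j) = 0) ->
  yhom 0 (psi b) -> a * b = b * a.
Proof.
move=> [k k0 ea] v0 b0; apply: psiI; rewrite !rmorphM ea -scalerAl -scalerAr.
congr (_ *: _); apply: tcoef_inj => w; rewrite -[w](subrK v) addrC.
rewrite tcoef_El tcoef_Er kap_noY // mul1r.
have [->|bw] := eqVneq (tcoef (w - v) (psi b)) 0; first by rewrite mulr0.
by rewrite kap_noY ?mul1r // => j; rewrite (b0 _ bw) ffunE.
Qed.

Lemma psi_normal_qcomm_y u j : normal u -> qcomm u (y j).
Proof.
case/normal_monomial => v mv _; apply: monomial_qcomm mv _.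
by exists 1; rewrite ?oner_eq0 // psi_y scale1r.
Qed.

(** Both factors are monomials with nonnegative exponents whose sum is the unit vector [eY j], so
    one exponent is 0. *)
Lemma psi_y_atomic (u v : M) c j : c != 0 -> u * v = wc M c * y j ->
  scalar (wc M) u \/ scalar (wc M) v.
Proof.
move=> c0 e; have : monomial (psi (u * v)) (eY j).
  by exists c => //; rewrite e psiZ psi_y.
rewrite rmorphM => /(monomial_factors w0)[a [b [ma mb eab]]].
have a0 := psi_nonneg ma; have b0 := psi_nonneg mb.
have abt t : a t + b t = (eY j : G) t by rewrite -eab ffunE.
have [eaj|naj] := eqVneq (a (inr j)) 0.
- left; apply: psi_scalar; suff -> : 0 = a by [].
  apply/ffunP => t; rewrite ffunE; have [->//|tj] := eqVneq t (inr j).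
  apply/eqP; rewrite eq_le a0 /= -(@lerD2r _ (b t)) add0r.
  rewrite abt ffunE; case: t tj {abt} => k tj; rewrite ?b0 //.
  by have -> : (k == j) = false by apply: contraNF tj => /eqP->.
- right; apply: psi_scalar; suff -> : 0 = b by [].
  apply/ffunP => t; rewrite ffunE; have at0 := a0 t; have bt0 := b0 t.
  apply/eqP; rewrite eq_le bt0 /= -(@lerD2l _ (a t)) abt addr0 ffunE.
  case: t at0 bt0 => k ak bk; rewrite ?ak //.
  have [ekj|//] := eqVneq k j; subst k.
  by rewrite -gtz0_ge1 lt_neqAle eq_sym naj.
Qed.

Lemma psi_mul_neq0 (u v : M) : u != 0 -> v != 0 -> u * v != 0.
Proof.
move=> u0 v0; have := torus_mulf_neq0 w0 (psi_neq0 u0) (psi_neq0 v0).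
by rewrite -rmorphM; apply: contraNneq => ->; rewrite rmorph0.
Qed.

Lemma psi_xn i : psi (x i) != 0.
Proof. by rewrite psi_x; apply: (tX_neq0 q_neq0 g_skew q_nroot). Qed.

Lemma psi_yn i : psi (y i) != 0.
Proof. by rewrite psi_y tE_neq0. Qed.

Lemma yhom_unique al be (a : T) : a != 0 -> yhom al a -> yhom be a -> al = be.
Proof.
by case/tcoef_neq0 => w aw ah bh; apply/ffunP => j; rewrite -(ah w aw) -(bh w aw).
Qed.

Let yh_x := yhom_x q_neq0 g_skew q_nroot iTE psi_x.
Let yh_y := yhom_y psi_y.

Lemma yhom_scale al c a : yhom al (psi a) -> yhom al (psi (wc M c * a)).
Proof. by move=> ah; rewrite psiZ; apply: tsuppZ. Qed.

(** Here [inl] stands for x_i, whereas as a torus coordinate it stands for z_(i+1). *)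
Definition wgen (s : I) : M := match s with inl i => x i | inr i => y i end.
Definition wdeg (s : I) : {ffun 'I_n -> int} :=
  match s with inl i => - ydelta i | inr i => ydelta i end.

Lemma psi_gen_neq0 s : psi (wgen s) != 0.
Proof. by case: s => i; [apply: psi_xn | apply: psi_yn]. Qed.

Lemma yhom_gen s : yhom (wdeg s) (psi (wgen s)).
Proof. by case: s => i; [apply: yh_x | apply: yh_y]. Qed.

Lemma wdeg_neq0 s : wdeg s != 0.
Proof.
case: s => i; apply/eqP => /ffunP/(_ i); rewrite !ffunE eqxx //.
Qed.

Lemma wdeg_inj : injective wdeg.
Proof.
move=> [i|i] [j|j] /ffunP/(_ i); rewrite !ffunE eqxx;
  by case: eqVneq => [->|].
Qed.

Lemma psi_gen_nscalar s : ~ scalar (wc M) (wgen s).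
Proof.
case=> c c0 e; have := @yhom_gen s; rewrite e psi_c iTE => h.
case/eqP: (wdeg_neq0 s); apply: (@yhom_unique _ _ c%:A) h _.
  by rewrite scaler_eq0 negb_or c0 oner_neq0.
by apply: tsuppZ; apply: yhom1.
Qed.

Lemma psi_gen_sim s t : sim (wgen s) (wgen t) -> s = t.
Proof.
case=> c c0 e; apply: wdeg_inj; apply: (@yhom_unique _ _ (psi (wgen s))).
- exact: psi_gen_neq0.
- exact: yhom_gen.
- by rewrite e; apply/yhom_scale/yhom_gen.
Qed.

Lemma ymon_word al : exists l : seq I, ymon M al = \prod_(s <- l) wgen s.
Proof.
rewrite /ymon; elim/big_ind: _ => [|a b [l ->] [l' ->]|i _].
- by exists [::]; rewrite big_nil.
- by exists (l ++ l'); rewrite big_cat.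
have X s p : exists l : seq I, wgen s ^+ p = \prod_(s <- l) wgen s.
  by exists (nseq p s); rewrite big_nseq; elim: p => //= p <-; rewrite exprS.
by case: (al i) => p; [apply: (X (inr i)) | apply: (X (inl i))].
Qed.

Lemma psi_atomic t : t != 0 -> (forall k, (k <= n)%N -> qcomm (z k) t) ->
    atomic (wc M) t ->
  (exists s, sim t (wgen s)) \/ (forall u, normal u -> u * t = t * u).
Proof.
move=> t0 tz ta; have [v tv] := tcoef_neq0 (psi_neq0 t0).
pose al : {ffun 'I_n -> int} := [ffun j => v (inr j)].
have th : yhom al (psi t).
  move=> w tw j; rewrite ffunE; apply: subr0_eq.
  have Zd k : (k <= n)%N -> kap (w - v) (eZ n k) = 1.
    move=> lek; have [c c0 e] := tz _ lek.
    have {}e : tE (eZ n k) * psi t = c *: (psi t * tE (eZ n k)).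
      by rewrite -(psi_zE lek) -!rmorphM e psiZ.
    have := torus_qcomm_supp e tv; have := torus_qcomm_supp e tw.
    rewrite !kapZl => e1 e2; rewrite (bicharDl w0) kapNl //.
    have -> : kap w (eZ n k) = kap v (eZ n k) by apply: (mulfI c0); rewrite -e1.
    by rewrite divff ?(bichar_neq0 w0).
  have lej := ltn_ord j; have := @kapZr_step (w - v) j.
  by rewrite !ffunE; apply; rewrite !Zd // ltnW.
have [p p0 et] := yhom_factor q_neq0 g_skew q_nroot iTE psi_c psi_x psi_y th.
have deg0 : yhom 0 (psi t) -> forall u, normal u -> u * t = t * u.
  by move=> h u /normal_monomial[v' mv v'0]; apply: yhom0_commute mv v'0 h.
have [[|s l] el] := ymon_word al; rewrite el in et.
  by right; apply: deg0; rewrite et big_nil mulr1.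
rewrite big_cons in et.
(* Atomicity is used twice. If [p] is scalar, the first letter is split off; not being scalar, it is
   all of t up to a scalar. If instead the word is scalar, t is a multiple of [p] and has degree
   0. *)
case: (ta p (wgen s * \prod_(s <- l) wgen s)) => // [[c c0 ep]|[c c0 ew]].
- rewrite ep mulrA in et.
  case: (ta (wc M c * wgen s) (\prod_(s <- l) wgen s)) => // [[d d0 es]|[d d0 ew]].
    case: (@psi_gen_nscalar s); exists (c^-1 * d); first by rewrite mulf_neq0 ?invr_eq0.
    by rewrite rmorphM -es mulrA -rmorphM mulVf // rmorph1 mul1r.
  left; exists s; exists (c * d); first by rewrite mulf_neq0.
  by rewrite et ew -iC mulrA -rmorphM mulrC.
- right; apply: deg0; rewrite et ew -iC; exact: yhom_scale.
Qed.

Lemma tE_indep a b u v : u != v -> a *: tE u + b *: tE v = 0 :> T -> a = 0 /\ b = 0.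
Proof.
move=> uv e; have := congr1 (tcoef u) e; have := congr1 (tcoef v) e.
rewrite !tcoefD !tcoefZ !tcoefE !eqxx (negPf uv) eq_sym (negPf uv) !mulr0 !mulr1.
by rewrite !tcoef0 add0r addr0 => -> ->.
Qed.

(** After multiplication by q_i - 1 the two products become q_i z_(i+1) - z_i and z_(i+1) - z_i. As
    z_i and z_(i+1) are independent, a factor c would equal both q_i and 1. *)
Lemma psi_xy_nqcomm i : ~ qcomm (x i) (y i).
Proof.
case=> c c0 e; have qm := congr1 (fun t => wc M (q i - 1) * t) e.
rewrite /= (xy_zsum (w_rels M)) (mulrA (wc M (q i - 1))) -rmorphM in qm.
rewrite [(q i - 1) * c]mulrC rmorphM -mulrA yx_zsum in qm.
have lei := ltn_ord i; have E := congr1 psi qm.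
rewrite rmorphB !psiZ rmorphB !psi_zE // 1?ltnW // in E.
have {}E : (q i - c) *: tE (eZ n i.+1) + (c - 1) *: tE (eZ n i) = 0 :> T.
  rewrite -(subrr (c *: (tE (eZ n i.+1) - tE (eZ n i)))) -{1}E scalerBr opprB.
  by rewrite !scalerBl scale1r addrACA [RHS]addrACA; congr (_ + _); apply: addrC.
have [/eqP + /eqP] := tE_indep (eZ_inj i) E.
rewrite !subr_eq0 => /eqP qe /eqP c1.
by have := qn1 i; rewrite qe c1 eqxx.
Qed.

Lemma psi_z_comb_normal (k : 'I_n) a b :
  normal (wc M a * z k.+1 + wc M b * z k) -> a = 0 \/ b = 0.
Proof.
case/normal_monomial => v; rewrite rmorphD !psiZ !psi_zE // 1?ltnW // => mv _.
have [->|a0] := eqVneq a 0; [by left | right; apply: contrapT => /eqP b0].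
have := monomial_coef (eZ n k.+1) mv; have := monomial_coef (eZ n k) mv.
have nE : (eZ n k == eZ n k.+1) = false by rewrite eq_sym; apply/negbTE/eZ_inj.
rewrite !tcoefD !tcoefZ !tcoefE !eqxx (negPf (eZ_inj k)) nE.
by rewrite !mulr0 !mulr1 add0r addr0 a0 b0 => /esym/eqP e1 /esym/eqP e2;
  have := eZ_inj k; rewrite e1 e2 eqxx.
Qed.

Lemma psi_z_sim k l : (k <= n)%N -> (l <= n)%N -> sim (z k) (z l) -> k = l.
Proof.
move=> lek lel [c c0 e]; have := congr1 psi e; rewrite psiZ !psi_zE // => {}e.
have : eZ n k = eZ n l.
  apply/eqP; apply: contrapT => /negP kl.
  have := congr1 (tcoef (eZ n k)) e; rewrite tcoefZ !tcoefE eqxx.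
  by rewrite eq_sym (negPf kl) mulr0 => /eqP; rewrite oner_eq0.
have H m m' : (m.+1 <= n)%N -> eZ n m.+1 = eZ n m' -> m.+1 = m'.
  move=> lem /ffunP/(_ (inl (Ordinal lem))); rewrite !ffunE eqxx /=.
  by case: eqP.
case: k l lek lel {e} => [|k] [|l] lek lel // e; last exact: H.
  by have := H _ _ lel (esym e).
by have := H _ _ lek e.
Qed.

End Torus.

(** The existential form lets the torus disappear: the facts derived from it below concern the
    algebra alone. *)
Lemma embedding : exists (T : torus (wmat q g)) (iT : {rmorphism K -> T})
  (psi : {rmorphism M -> T}), [/\ forall c, iT c = c%:A,
   forall c, psi (wc M c) = iT c,
   forall i, psi (x i) = tX iT i & forall i, psi (y i) = tE (eY i)].
Proof.
have [T] := torus_exists w0; exists T, (in_alg T : {rmorphism K -> T}).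
pose iT : {rmorphism K -> T} := in_alg T.
have iTE c : iT c = c%:A by [].
have [|F [Fc Fx Fy]] := @w_univ _ _ _ _ M T iT (tX iT) (tY T) (torus_scalC iTE).
  exact: (torus_weyl_rels q_neq0 g_skew iTE qn1).
by exists F.
Qed.

Lemma weyl_mul_neq0 (u v : M) : u != 0 -> v != 0 -> u * v != 0.
Proof.
have [T [iT [psi [iTE psi_c psi_x psi_y]]]] := embedding.
by move=> *; eapply psi_mul_neq0; eassumption.
Qed.

Lemma normal_qcomm_y u j : normal u -> qcomm u (y j).
Proof.
have [T [iT [psi [iTE psi_c psi_x psi_y]]]] := embedding.
by move=> *; eapply psi_normal_qcomm_y; eassumption.
Qed.

Lemma y_atomic (u v : M) c j : c != 0 -> u * v = wc M c * y j ->
  scalar (wc M) u \/ scalar (wc M) v.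
Proof.
have [T [iT [psi [iTE psi_c psi_x psi_y]]]] := embedding.
by move=> *; eapply psi_y_atomic; eassumption.
Qed.

Lemma gen_sim s t : sim (wgen s) (wgen t) -> s = t.
Proof.
have [T [iT [psi [iTE psi_c psi_x psi_y]]]] := embedding.
by move=> *; eapply psi_gen_sim; eassumption.
Qed.

Lemma weyl_atomic t : t != 0 -> (forall k, (k <= n)%N -> qcomm (z k) t) ->
    atomic (wc M) t ->
  (exists s, sim t (wgen s)) \/ (forall u, normal u -> u * t = t * u).
Proof.
have [T [iT [psi [iTE psi_c psi_x psi_y]]]] := embedding.
by move=> *; eapply psi_atomic; eassumption.
Qed.

Lemma xy_nqcomm i : ~ qcomm (x i) (y i).
Proof.
have [T [iT [psi [iTE psi_c psi_x psi_y]]]] := embedding.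
by move=> *; eapply psi_xy_nqcomm; eassumption.
Qed.

Lemma z_comb_normal (k : 'I_n) a b :
  normal (wc M a * z k.+1 + wc M b * z k) -> a = 0 \/ b = 0.
Proof.
have [T [iT [psi [iTE psi_c psi_x psi_y]]]] := embedding.
by move=> *; eapply psi_z_comb_normal; eassumption.
Qed.

Lemma z_sim k l : (k <= n)%N -> (l <= n)%N -> sim (z k) (z l) -> k = l.
Proof.
have [T [iT [psi [iTE psi_c psi_x psi_y]]]] := embedding.
by move=> *; eapply psi_z_sim; eassumption.
Qed.

Lemma gen_neq0 s : wgen s != 0.
Proof.
have [T [iT [psi [iTE psi_c psi_x psi_y]]]] := embedding.
have := psi_gen_neq0 iTE psi_x psi_y s; apply: contraNneq => ->.
by apply/eqP/rmorph0.
Qed.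

(** The carrier of a model might be the zero ring; its morphism to the torus, where 1 != 0, rules
    this out. *)
Lemma weyl_oner_neq0 : 1 != 0 :> M.
Proof.
have [T [iT [psi _]]] := embedding; apply/eqP => /(congr1 psi)/eqP.
by rewrite rmorph1 rmorph0 oner_eq0.
Qed.

Lemma wc_inj : injective (wc M).
Proof.
move=> c d e; apply/eqP; rewrite -subr_eq0; apply: contrapT => /negP cd.
have := weyl_oner_neq0; rewrite -(rmorph1 (wc M)) -(mulVf cd) rmorphM rmorphB e.
by rewrite subrr mulr0 eqxx.
Qed.

Lemma z_normal k : (k <= n)%N -> normal (z k).
Proof.
move=> lek; split.
  have [T [iT [psi [iTE psi_c psi_x psi_y]]]] := embedding.
  apply/eqP => /(congr1 psi)/eqP; rewrite rmorph0.
  by rewrite (psi_z q_neq0 g_skew q_nroot iTE psi_c psi_x psi_y) // (negPf (tE_neq0 _ _)).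
elim/w_ind => [|c u v [a ea] [b eb]|i u [a ea]|i u [a ea]].
- by exists 1; rewrite mulr1 mul1r.
- exists (wc M c * a + b); rewrite (mulrDl (wc M c * u)) (mulrDr _ (wc M c * a)).
  rewrite -[wc M c * u * _]mulrA ea eb; congr (_ + _).
  by rewrite mulrA iC mulrA.
- have [c c0 e] := qcomm_sym (z_qcomm_x q_neq0 g_skew M i lek).
  by exists (wc M c * (x i * a)); rewrite -mulrA ea mulrA e -!mulrA mulrA iC -!mulrA.
- have [c c0 e] := qcomm_sym (z_qcomm_y q_neq0 g_skew M i lek).
  by exists (wc M c * (y i * a)); rewrite -mulrA ea mulrA e -!mulrA mulrA iC -!mulrA.
Qed.

End NormalElements.

(** * The presented algebra *)

Section PresentationUniversal.
Variables (K : fieldType) (I : choiceType).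
Local Notation FA := {malg K[{fmonom I}]}.

Lemma pres_ind (S : FA -> Prop) (P : pres S -> Prop) :
  P 1 -> (forall c u v, P u -> P v -> P (c *: u + v)) ->
  (forall i u, P u -> P (pres_gen S i * u)) -> forall u, P u.
Proof.
move=> P1 PD PM u; rewrite -(pres_liftK u).
have P0 : P 0 by rewrite -(addNr 1) -scaleN1r; apply: PD.
elim/malg_ind: (pres_lift u) => [|c m r Pr].
  suff -> : pres_proj S 0 = 0 by [].
  by apply: (addrI (pres_proj S 0)); rewrite -pres_projD !addr0.
rewrite pres_projD -pres_projZ; apply: PD Pr; case: m => m.
elim: m => [|i m IHm].
  suff -> : pres_proj S << FMonom [::] >> = 1 by [].
  by rewrite -fmoneE.
suff -> : pres_proj S << FMonom (i :: m) >> =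
    pres_gen S i * pres_proj S << FMonom m >> by apply: PM.
rewrite [RHS]pres_projM malgM_def fgmulUU mulr1; congr (pres_proj S << _ >>).
by rewrite [mmul _ _]fmmulE fmuE.
Qed.

Section Evaluation.
Variables (B : pzRingType) (i : {rmorphism K -> B}) (h : I -> B).
Hypothesis iC : forall c u, i c * u = u * i c.
Implicit Types (P Q : FA) (m : {fmonom I}).

Definition fword m : B := \prod_(j <- (m : seq I)) h j.
Definition fa_eval P : B := malg_eval i fword P.

Lemma fa_evalP c P Q : fa_eval (c *: P + Q) = i c * fa_eval P + fa_eval Q.
Proof. exact: malg_evalP. Qed.

Lemma fa_eval0 : fa_eval 0 = 0.
Proof. exact: malg_eval0. Qed.

Lemma fa_evalD P Q : fa_eval (P + Q) = fa_eval P + fa_eval Q.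
Proof. by rewrite -[P]scale1r fa_evalP rmorph1 mul1r scale1r. Qed.

Lemma fa_evalZ c P : fa_eval (c *: P) = i c * fa_eval P.
Proof. by rewrite -[c *: P]addr0 fa_evalP fa_eval0 addr0. Qed.

Lemma fa_evalB P Q : fa_eval (P - Q) = fa_eval P - fa_eval Q.
Proof. by rewrite -scaleN1r fa_evalD fa_evalZ rmorphN1 mulN1r. Qed.

Lemma fa_evalU m : fa_eval << m >> = fword m.
Proof. exact: malg_evalU. Qed.

Lemma fa_eval_gen j : fa_eval << fmu j >> = h j.
Proof. by rewrite fa_evalU /fword fmuE /= big_seq1. Qed.

Lemma fa_eval1 : fa_eval 1 = 1.
Proof. by rewrite fa_evalU /fword fm1 big_nil. Qed.

Lemma fwordM m m' : fword (mmul m m') = fword m * fword m'.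
Proof. by rewrite /fword fmM big_cat. Qed.

Lemma fa_ext (f f' : FA -> B) :
  (forall c P Q, f (c *: P + Q) = i c * f P + f Q) ->
  (forall c P Q, f' (c *: P + Q) = i c * f' P + f' Q) ->
  (forall m, f << m >> = f' << m >>) -> f =1 f'.
Proof.
move=> fP f'P eqf; elim/malg_ind => [|c m P IHP]; last by rewrite fP f'P eqf IHP.
have e0 (h' : FA -> B) : (forall c P Q, h' (c *: P + Q) = i c * h' P + h' Q) ->
    h' 0 = 0.
  by move=> /(_ (-1) 0 0); rewrite scaler0 add0r rmorphN1 mulN1r addNr.
by rewrite !e0.
Qed.

Lemma fa_evalM P Q : fa_eval (P * Q) = fa_eval P * fa_eval Q.
Proof.
(* Both sides are linear over [i] in each variable, in [Q] because the scalars are central, so it is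
   enough to compare them on words. *)
move: P; apply: fa_ext => [c P P'|c P P'|m].
- have e : (c *: P + P') * Q = c *: (P * Q) + P' * Q by rewrite mulrDl scalerAl.
  exact: etrans (congr1 fa_eval e) (fa_evalP _ _ _).
- by rewrite (fa_evalP c P P') (mulrDl _ _ (fa_eval Q)) mulrA.
move: Q; apply: fa_ext => [c Q Q'|c Q Q'|m'].
- have e : << m >> * (c *: Q + Q') = c *: (<< m >> * Q) + << m >> * Q'.
    rewrite mulrDr; congr (_ + _); rewrite -!mul_malgC.
    have mC : << m >> * c%:MP = c%:MP * << m >> :> FA.
      by rewrite malgM_def [RHS]malgM_def !fgmulUU mulm1 mul1m mulrC.
    exact: etrans (mulrA _ _ _) (etrans (congr1 (fun t => t * Q) mC) (esym (mulrA _ _ _))).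
  exact: etrans (congr1 fa_eval e) (fa_evalP _ _ _).
- by rewrite (fa_evalP c Q Q') (mulrDr (fa_eval << m >>)) !mulrA iC.
apply: etrans (congr1 fa_eval (fgmulUU 1 1 m m')) _.
by rewrite mul1r !fa_evalU fwordM.
Qed.

Variable S : FA -> Prop.
Hypothesis S0 : forall r, S r -> fa_eval r = 0.

Lemma ideal2_eval0 r : ideal2 S r -> fa_eval r = 0.
Proof.
elim=> [|a s b t Ss _ IH]; first exact: fa_eval0.
by rewrite fa_evalD IH addr0 fa_evalM fa_evalM (S0 Ss) mulr0 mul0r.
Qed.

Definition pres_eval (u : pres S) : B := fa_eval (pres_lift u).

Lemma pres_eval_proj r : pres_eval (pres_proj S r) = fa_eval r.
Proof.
apply/eqP; rewrite -subr_eq0 -fa_evalB; apply/eqP; apply: ideal2_eval0.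
exact: pres_lift_proj.
Qed.

Lemma pres_eval_additive : additive pres_eval.
Proof.
move=> u v; rewrite -(pres_liftK u) -(pres_liftK v) -scaleN1r.
rewrite -[-1 *: _]/(pres_scale _ _) pres_projZ.
by rewrite -pres_projD !pres_eval_proj scaleN1r fa_evalB.
Qed.

Lemma pres_eval_multiplicative : GRing.monoid_morphism pres_eval.
Proof.
split=> [|u v]; first by rewrite [LHS]pres_eval_proj fa_eval1.
rewrite -(pres_liftK u) -(pres_liftK v) [X in pres_eval X = _]pres_projM.
by rewrite !pres_eval_proj fa_evalM.
Qed.

Lemma pres_evalZ c u : pres_eval (c *: u) = i c * pres_eval u.
Proof.
by rewrite -(pres_liftK u) [X in pres_eval X = _]pres_projZ !pres_eval_proj fa_evalZ.
Qed.

Lemma pres_eval_gen j : pres_eval (pres_gen S j) = h j.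
Proof. by rewrite pres_eval_proj fa_eval_gen. Qed.

End Evaluation.

Section Scalars.
Variable S : FA -> Prop.

Definition pres_cst (c : K) : pres S := c *: (1 : pres S).

Lemma pres_cst_additive : additive pres_cst.
Proof. by move=> c d; rewrite /pres_cst scalerBl. Qed.

Lemma pres_cst_multiplicative : GRing.monoid_morphism pres_cst.
Proof.
split=> [|c d]; first exact: scale1r.
by rewrite /pres_cst -pres_scalerAl mul1r scalerA.
Qed.

HB.instance Definition _ :=
  GRing.isZmodMorphism.Build K (pres S) pres_cst pres_cst_additive.
HB.instance Definition _ :=
  GRing.isMonoidMorphism.Build K (pres S) pres_cst pres_cst_multiplicative.

Lemma pres_cstE c u : pres_cst c * u = c *: u.
Proof. by rewrite -pres_scalerAl mul1r. Qed.

Lemma pres_cstC c u : pres_cst c * u = u * pres_cst c.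
Proof. by rewrite pres_cstE -pres_scalerAr mulr1. Qed.

End Scalars.
End PresentationUniversal.

Section WeylIsModel.
Variables (K : fieldType) (n : nat) (q : 'I_n -> K) (g : 'M[K]_n).

Local Notation R := (weyl_rel q g).
Local Notation A := (weyl q g).

Definition weyl_cst : {rmorphism K -> A} := pres_cst R.

Lemma weyl_cstE c (u : A) : weyl_cst c * u = c *: u.
Proof. exact: pres_cstE. Qed.

Lemma weyl_zsum k :
  zsum q weyl_cst (weyl_x q g) (weyl_y q g) k =
  pres_proj R (1 + \sum_(j < n | (j < k)%N)
    (q j - 1) *: (<< fmu (inr j) >> * << fmu (inl j) >>)).
Proof.
rewrite pres_projD; congr (_ + _).
elim/big_rec2: _ => [|j u v _ ->].
  by apply: (addrI (pres_proj R 0)); rewrite -pres_projD !addr0.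
by rewrite pres_projD -pres_projZ -pres_projM weyl_cstE.
Qed.

Lemma pres_projB r s : pres_proj R (r - s) = 0 -> pres_proj R r = pres_proj R s.
Proof.
by move=> e; rewrite -[r](subrK s) pres_projD e add0r.
Qed.

Lemma weyl_rel0 r : R r -> pres_proj R r = 0.
Proof.
move=> Rr; have -> : 0 = pres_proj R 0.
  by apply: (addrI (pres_proj R 0)); rewrite -pres_projD !addr0.
apply/pres_projE; rewrite subr0 -[r]addr0 -[r]mulr1 -[r]mul1r.
by apply: ideal2_D => //; apply: ideal2_0.
Qed.

Lemma weyl_qc c (a b : {malg K[{fmonom ('I_n + 'I_n)%type}]}) :
  R (a * b - c *: (b * a)) -> qc weyl_cst c (pres_proj R a) (pres_proj R b).
Proof.
move=> /weyl_rel0/pres_projB e; rewrite /qc weyl_cstE.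
apply: etrans (pres_projM R a b) _; apply: etrans e _.
apply: etrans (esym (pres_projZ R c _)) _.
exact: (congr1 (@pres_scale K _ R c) (esym (pres_projM R b a))).
Qed.

Lemma weyl_relsP : weyl_rels q g weyl_cst (weyl_x q g) (weyl_y q g).
Proof.
split=> [j k|j k jk|j k jk|j k kj|j].
- exact/weyl_qc/weyl_yy.
- exact/weyl_qc/weyl_xx.
- exact/weyl_qc/weyl_xy_lt.
- exact/weyl_qc/weyl_xy_gt.
rewrite weyl_zsum.
have /weyl_rel0/pres_projB <- := weyl_xy_eq q g j.
rewrite weyl_cstE; apply/eqP; rewrite -subr_eq; apply/eqP.
apply: (addIr (q j *: (weyl_y q g j * weyl_x q g j))); rewrite subrK.
have -> : q j *: (weyl_y q g j * weyl_x q g j) =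
   pres_proj R (q j *: (<< fmu (inr j) >> * << fmu (inl j) >>)).
  by rewrite -pres_projZ -pres_projM.
by rewrite -pres_projD subrK -pres_projM.
Qed.

Lemma weyl_ind (S : A -> Prop) : S 1 ->
    (forall c u v, S u -> S v -> S (weyl_cst c * u + v)) ->
    (forall i u, S u -> S (weyl_x q g i * u)) ->
    (forall i u, S u -> S (weyl_y q g i * u)) ->
  forall u, S u.
Proof.
move=> S1 SD Sx Sy; apply: pres_ind => // [c u v Su Sv|[] j u Su].
- by rewrite -weyl_cstE; apply: SD.
- exact: Sx.
- exact: Sy.
Qed.

Lemma weyl_univ (B : pzRingType) (i : {rmorphism K -> B}) (X Y : 'I_n -> B) :
    (forall c u, i c * u = u * i c) -> weyl_rels q g i X Y ->
  exists F : {rmorphism A -> B}, [/\ forall c, F (weyl_cst c) = i c,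
    forall j, F (weyl_x q g j) = X j & forall j, F (weyl_y q g j) = Y j].
Proof.
move=> iC rels; pose h (j : 'I_n + 'I_n) := match j with inl j => X j | inr j => Y j end.
have S0 r : R r -> fa_eval i h r = 0.
  case=> [j k|j k jk|j k jk|j k kj|j];
    rewrite !(fa_evalB, fa_evalM, fa_evalZ, fa_eval_gen) //; apply/eqP; rewrite subr_eq0; apply/eqP.
  - exact: (rel_yy rels).
  - exact: (rel_xx rels).
  - exact: (rel_xy_lt rels).
  - exact: (rel_xy_gt rels).
  rewrite /= (rel_xy_eq rels) addrK fa_evalD fa_eval1; congr (_ + _).
  elim/big_rec2: _ => [|k u v _ ->]; first by rewrite fa_eval0.
  by rewrite fa_evalP fa_evalM // !fa_eval_gen.
pose F0 : A -> B := pres_eval i h (S := R).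
pose F := HB.pack_for {rmorphism A -> B} F0
  (GRing.isZmodMorphism.Build A B F0 (pres_eval_additive iC S0))
  (GRing.isMonoidMorphism.Build A B F0 (pres_eval_multiplicative iC S0)).
exists F; split=> [c|j|j].
- rewrite [LHS](pres_evalZ iC S0); have [-> _] := pres_eval_multiplicative iC S0.
  by rewrite mulr1.
- exact: (pres_eval_gen iC S0).
- exact: (pres_eval_gen iC S0).
Qed.

Definition weylM : weyl_model q g :=
  WeylModel (fun c u => pres_cstC c u) weyl_relsP weyl_ind weyl_univ.

End WeylIsModel.

(** * Sign changes *)

Section Homomorphisms.
Variables (K : fieldType) (n : nat) (q : 'I_n -> K) (g : 'M[K]_n).

Lemma w_ext (M : weyl_model q g) (B : pzRingType) (F F' : {rmorphism M -> B}) :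
  (forall c, F (wc M c) = F' (wc M c)) -> (forall j, F (wx M j) = F' (wx M j)) ->
  (forall j, F (wy M j) = F' (wy M j)) -> F =1 F'.
Proof.
move=> ec ex ey; elim/w_ind => [|c u v eu ev|i u eu|i u eu].
- by rewrite !rmorph1.
- by rewrite !rmorphD !rmorphM ec eu ev.
- by rewrite !rmorphM ex eu.
- by rewrite !rmorphM ey eu.
Qed.

Definition wgenb (M : weyl_model q g) (b : bool) (i : 'I_n) : M :=
  if b then wx M i else wy M i.

(* For i < j, [ctab (q i) (g i j)] gives the scalars by which the generators of
   index i and those of index j commute; [true] stands for x and [false] for y. *)
Definition ctab (c d : K) (b b' : bool) :=
  if b then (if b' then c * d else d^-1) else (if b' then (c * d)^-1 else d).

Lemma ctab_neq0 c d b b' : c != 0 -> d != 0 -> ctab c d b b' != 0.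
Proof. by move=> c0 d0; case: b b' => -[]; rewrite /ctab ?invr_eq0 ?mulf_neq0. Qed.

Lemma wgenb_qc (M : weyl_model q g) (i j : 'I_n) b b' :
  (forall j, q j != 0) -> mul_skew_symmetric g -> (i < j)%N ->
  qc (wc M) (ctab (q i) (g i j) b b') (wgenb M b i) (wgenb M b' j).
Proof.
move=> q0 gs ij; have rels := w_rels M.
case: b b' => -[]; rewrite /ctab /wgenb.
- exact: (rel_xx rels).
- by rewrite g_inv //; apply: (rel_xy_lt rels).
- apply: qc_sym; last exact: (rel_xy_gt rels).
  by rewrite mulf_neq0 ?g_neq0.
- exact: (rel_yy rels).
Qed.

(* [sign_related] with the sign 1 encoded by [true] and -1 by [false]. *)
Definition brel (q' : 'I_n -> K) (g' : 'M[K]_n) (s : 'I_n -> bool) :=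
  (forall i, q' i = if s i then q i else (q i)^-1) /\
  (forall i j : 'I_n, (i < j)%N -> g' i j =
     if s i then (if s j then g i j else (q i)^-1 * g j i)
     else (if s j then g j i else q i * g i j)).

End Homomorphisms.

Section SignChange.
Variables (K : fieldType) (n : nat) (q q' : 'I_n -> K) (g g' : 'M[K]_n).
Hypotheses (q_neq0 : forall j, q j != 0) (g_skew : mul_skew_symmetric g).
Hypotheses (q'_neq0 : forall j, q' j != 0) (g'_skew : mul_skew_symmetric g').
Variable s : 'I_n -> bool.
Hypothesis rel : brel q g q' g' s.

Lemma brel_sym : brel q' g' q g s.
Proof.
have [rq rg] := rel; split=> [i|i j ij]; first by rewrite rq; case: (s i); rewrite ?invrK.
have := rg i j ij; rewrite rq; case: (s i); case: (s j) => e.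
- by [].
- by rewrite -(g_inv g'_skew) e -(g_inv g_skew) invfM !invrK mulKf.
- by rewrite -(g_inv g'_skew) e (g_inv g_skew).
- by rewrite e mulKf.
Qed.

(** The four cases of condition (ii) say that exchanging x and y at the indices of sign -1 carries
    one commutation table into the other. *)
Lemma ctab_sign (i j : 'I_n) b b' : (i < j)%N ->
  ctab (q' i) (g' i j) (b == s i) (b' == s j) = ctab (q i) (g i j) b b'.
Proof.
move=> ij; have [rq rg] := rel; rewrite rq (rg _ _ ij).
have q0 := q_neq0 i; have g0 := g_neq0 g_skew i j.
rewrite -(g_inv g_skew i j) /ctab; case: (s i); case: (s j); case: b; case: b' => //=;
  rewrite ?invrK //; try by field; rewrite ?q0 ?g0.
- by rewrite invfM !invrK.
- by rewrite mulrA divff // mul1r invrK.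
- by rewrite invfM !invrK.
Qed.

Variables (lam : nat -> K) (mu : 'I_n -> K).
Hypotheses (lam0 : lam 0 = 1)
  (lamS : forall i : 'I_n, lam i.+1 = (if s i then 1 else (q i)^-1) * lam i).
Hypothesis mu_neq0 : forall i, mu i != 0.

(** The scalar of the image of y_i: its product with [mu i] is lambda_i up to sign. Since [i] is
    0-based, lambda_i is [lam i.+1]. *)
Definition nu (i : 'I_n) := (if s i then 1 else -1) * lam i.+1 * (mu i)^-1.

Lemma lam_neq0 k : (k <= n)%N -> lam k != 0.
Proof.
elim: k => [|k IHk] ltk; first by rewrite lam0 oner_neq0.
have -> := lamS (Ordinal ltk); apply: mulf_neq0; last by apply: IHk; apply: ltnW.
by case: (s _); rewrite ?oner_neq0 ?invr_eq0.
Qed.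

Variable M' : weyl_model q' g'.
Let iC := @wcC K n q' g' M'.
Let sX (i : 'I_n) : M' := wc M' (mu i) * wgenb M' (s i) i.
Let sY (i : 'I_n) : M' := wc M' (nu i) * wgenb M' (~~ s i) i.
Local Notation z' := (zsum q' (wc M') (wx M') (wy M')).

Lemma sYX i : sY i * sX i =
  wc M' ((if s i then 1 else -1) * lam i.+1) * (wgenb M' (~~ s i) i * wgenb M' (s i) i).
Proof.
rewrite /sX /sY -!mulrA [wgenb _ _ _ * (_ * _)]mulrA -iC !mulrA -rmorphM.
by rewrite /nu divfK.
Qed.

Lemma sXY i : sX i * sY i =
  wc M' ((if s i then 1 else -1) * lam i.+1) * (wgenb M' (s i) i * wgenb M' (~~ s i) i).
Proof.
rewrite /sX /sY -!mulrA [wgenb _ _ _ * (_ * _)]mulrA -iC !mulrA -rmorphM.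
by rewrite [mu i * _]mulrC /nu divfK.
Qed.

Lemma wcA a b u : wc M' a * (wc M' b * u) = wc M' (a * b) * u.
Proof. by rewrite mulrA -rmorphM. Qed.

(** The source of the recursion for lambda. For sign -1 the added term is lambda_j (q'_j - 1) x'_j
    y'_j, that is lambda_j (q'_j z'_(j+1) - z'_j); the z'_j cancel and the new coefficient is q_j^-1
    lambda_j. *)
Lemma sign_step (j : 'I_n) :
  wc M' (lam j) * z' j + wc M' (q j - 1) * (sY j * sX j) = wc M' (lam j.+1) * z' j.+1.
Proof.
rewrite sYX wcA lamS; have [rq _] := rel; have q0 := q_neq0 j.
have := zsumS q' (wc M') (wx M') (wy M') j; have := xy_zsum (w_rels M') j.
move: (z' j.+1) (z' j) => w1 w; case: (s j) (rq j) => rj /= e1 e2; rewrite /wgenb.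
  by rewrite !mul1r e2 mulrDr wcA rj mulrC.
have -> : (q j - 1) * (-1 * ((q j)^-1 * lam j)) = lam j * (q' j - 1).
  by rewrite rj; field.
by rewrite -wcA e1 -mulrDr addrC subrK wcA rj mulrC.
Qed.

Lemma sign_zsum k : (k <= n)%N -> zsum q (wc M') sX sY k = wc M' (lam k) * z' k.
Proof.
elim: k => [|k IHk] ltk; first by rewrite !zsum0 lam0 rmorph1 mul1r.
have IH := IHk (ltnW ltk); pose j := Ordinal ltk.
apply: etrans (zsumS q (wc M') sX sY j) _; apply: etrans (sign_step j).
by congr (_ + _).
Qed.

Lemma scal_qc c a b (u v : M') : qc (wc M') c u v -> qc (wc M') c (wc M' a * u) (wc M' b * v).
Proof. by move=> uv; apply: qc_scalel => //; apply: qc_scaler. Qed.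

Lemma sign_rels : weyl_rels q g (wc M') sX sY.
Proof.
(* In these tables [b] is the kind of the source generator, and [b == s i] the kind of its image. *)
have tab (i j : 'I_n) b b' : (i < j)%N ->
    qc (wc M') (ctab (q i) (g i j) b b') (wgenb M' (b == s i) i) (wgenb M' (b' == s j) j).
  by move=> ij; rewrite -ctab_sign //; apply: wgenb_qc.
have tabN (i j : 'I_n) b b' : (i < j)%N ->
    qc (wc M') (ctab (q i) (g i j) b b')^-1 (wgenb M' (b' == s j) j) (wgenb M' (b == s i) i).
  by move=> ij; apply: qc_sym (tab _ _ _ _ ij); rewrite ctab_neq0 ?g_neq0.
have eT i : (true == s i) = s i by case: (s i).
have eF i : (false == s i) = ~~ s i by case: (s i).
split=> [i j|i j ij|i j ij|i j ji|j].
- apply: scal_qc; rewrite -!eF; case: (ltngtP i j) => [ij|ji|/val_inj ->].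
  + exact: (tab _ _ false false).
  + by have := tabN _ _ false false ji; rewrite /ctab g_inv.
  + by rewrite g_skew.1; apply/qc_comm.
- by apply: scal_qc; have := tab _ _ true true ij; rewrite !eT.
- by apply: scal_qc; have := tab _ _ true false ij; rewrite eT eF /ctab g_inv.
- by apply: scal_qc; have := tabN _ _ false true ji; rewrite eT eF /ctab invrK.
rewrite (sign_zsum (ltnW (ltn_ord j))) sYX sXY wcA lamS.
have [rq _] := rel; have q0 := q_neq0 j; have := rel_xy_eq (w_rels M') j.
move: (z' j) => w; case: (s j) (rq j) => rj /= e; rewrite /wgenb e.
  by rewrite !mul1r mulrDr wcA rj mulrC.
(* For sign -1, x'_j y'_j has been replaced by z'_j + q'_j y'_j x'_j; the two multiples of z'_j
   cancel. *)
rewrite mulrDr addrA -mulrDl -rmorphD.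
have -> : lam j + q j * (-1 * ((q j)^-1 * lam j)) = 0 by field.
rewrite rmorph0 mul0r add0r wcA; congr (wc M' _ * _).
by rewrite rj; field.
Qed.

Variable M : weyl_model q g.

Lemma sign_hom : exists F : {rmorphism M -> M'}, [/\ forall c, F (wc M c) = wc M' c,
  forall i, F (wx M i) = wc M' (mu i) * wgenb M' (s i) i &
  forall i, F (wy M i) = wc M' (nu i) * wgenb M' (~~ s i) i].
Proof. exact: (w_univ M iC sign_rels). Qed.

End SignChange.

Section SignIso.
Variables (K : fieldType) (n : nat) (q q' : 'I_n -> K) (g g' : 'M[K]_n).
Hypotheses (q_neq0 : forall j, q j != 0) (g_skew : mul_skew_symmetric g).
Hypotheses (q'_neq0 : forall j, q' j != 0) (g'_skew : mul_skew_symmetric g').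
Variable s : 'I_n -> bool.
Hypothesis rel : brel q g q' g' s.
Variables (lam : nat -> K) (mu : 'I_n -> K).
Hypotheses (lam0 : lam 0 = 1)
  (lamS : forall i : 'I_n, lam i.+1 = (if s i then 1 else (q i)^-1) * lam i).
Hypothesis mu_neq0 : forall i, mu i != 0.
Variables (M : weyl_model q g) (M' : weyl_model q' g').

Lemma sign_iso : exists (F : {rmorphism M -> M'}) (F' : {rmorphism M' -> M}),
  [/\ cancel F F', cancel F' F, forall c, F (wc M c) = wc M' c,
  forall i, F (wx M i) = wc M' (mu i) * wgenb M' (s i) i &
  forall i, F (wy M i) = wc M' (nu s lam mu i) * wgenb M' (~~ s i) i].
Proof.
have ln0 (i : 'I_n) : lam i.+1 != 0 := lam_neq0 q_neq0 lam0 lamS (ltn_ord i).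
have [F [Fc Fx Fy]] := sign_hom q_neq0 g_skew q'_neq0 g'_skew rel lam0 lamS mu_neq0 M' M.
(* The inverse has the same signs and the inverse lambdas. Its scalar at x'_i inverts the one that
   comes with x'_i in the images under [F]: [mu i] from x_i, or - lam_(i+1) / mu_i from y_i. *)
pose mu' i := if s i then (mu i)^-1 else - (lam i.+1)^-1 * mu i.
pose lam' k := (lam k)^-1.
have lam'0 : lam' 0 = 1 by rewrite /lam' lam0 invr1.
have [rq _] := rel.
have lam'S (i : 'I_n) : lam' i.+1 = (if s i then 1 else (q' i)^-1) * lam' i.
  rewrite /lam' lamS rq invfM; case: (s i); by rewrite ?invr1 ?invrK.
have mu'0 i : mu' i != 0.
  by rewrite /mu'; case: (s i); rewrite ?mulf_neq0 ?oppr_eq0 ?invr_eq0.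
have [F' [F'c F'x F'y]] := sign_hom q'_neq0 g'_skew q_neq0 g_skew
  (brel_sym q_neq0 g_skew g'_skew rel) lam'0 lam'S mu'0 M M'.
exists F, F'; split=> //.
- apply: (w_ext (F := F' \o F) (F' := idfun)) => [c|i|i] /=.
  + by rewrite Fc F'c.
  + rewrite Fx rmorphM F'c /wgenb; case e: (s i); rewrite ?F'x ?F'y /wgenb /nu /mu' /lam' e /=;
      rewrite mulrA -rmorphM; rewrite (_ : _ * _ = 1 :> K) ?rmorph1 ?mul1r //; field;
      by rewrite ?ln0 ?mu_neq0 ?oppr_eq0 ?oner_eq0.
  + rewrite Fy rmorphM F'c /wgenb; case e: (s i); rewrite ?F'x ?F'y /wgenb /nu /mu' /lam' e /=;
      rewrite mulrA -rmorphM; rewrite (_ : _ * _ = 1 :> K) ?rmorph1 ?mul1r //; field;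
      by rewrite ?ln0 ?mu_neq0 ?oppr_eq0 ?oner_eq0.
- apply: (w_ext (F := F \o F') (F' := idfun)) => [c|i|i] /=.
  + by rewrite F'c Fc.
  + rewrite F'x rmorphM Fc /wgenb; case e: (s i); rewrite ?Fx ?Fy /wgenb /nu /mu' /lam' e /=;
      rewrite mulrA -rmorphM; rewrite (_ : _ * _ = 1 :> K) ?rmorph1 ?mul1r //; field;
      by rewrite ?ln0 ?mu_neq0 ?oppr_eq0 ?oner_eq0.
  + rewrite F'y rmorphM Fc /wgenb; case e: (s i); rewrite ?Fx ?Fy /wgenb /nu /mu' /lam' e /=;
      rewrite mulrA -rmorphM; rewrite (_ : _ * _ = 1 :> K) ?rmorph1 ?mul1r //; field;
      by rewrite ?ln0 ?mu_neq0 ?oppr_eq0 ?oner_eq0.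
Qed.

End SignIso.

(** * Classification of the isomorphisms *)

Section Transport.
Variables (K : fieldType) (A B : pzRingType).
Variables (i : {rmorphism K -> A}) (i' : {rmorphism K -> B}).
Variables (F : {rmorphism A -> B}) (F' : {rmorphism B -> A}).
Hypotheses (FK : cancel F F') (F'K : cancel F' F) (Fi : forall c, F (i c) = i' c).

Lemma transport_cst c : F' (i' c) = i c.
Proof. by rewrite -Fi FK. Qed.

Lemma transport_sim u v : sim i u v -> sim i' (F u) (F v).
Proof. by move=> [c c0 ->]; exists c; rewrite // rmorphM Fi. Qed.

Lemma transport_qcomm u v : qcomm i u v -> qcomm i' (F u) (F v).
Proof. by move=> [c c0 e]; exists c; rewrite // /qc -!rmorphM e rmorphM Fi. Qed.

Lemma transport_neq0 u : u != 0 -> F u != 0.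
Proof.
by apply: contraNneq => e; rewrite -(FK u) e; apply/eqP/rmorph0.
Qed.

Lemma transport_normal u : normal u -> normal (F u).
Proof.
move=> [u0 un]; split=> [|a]; first exact: transport_neq0.
have [b e] := un (F' a); exists (F b).
by rewrite -rmorphM -e rmorphM F'K.
Qed.

Lemma transport_scalar u : scalar i u -> scalar i' (F u).
Proof. by move=> [c c0 ->]; exists c; rewrite // Fi. Qed.

End Transport.

Section ImageOfY.
Variables (K : fieldType) (n m : nat).
Variables (q : 'I_n -> K) (g : 'M[K]_n) (q' : 'I_m -> K) (g' : 'M[K]_m).
Hypotheses (q_neq0 : forall j, q j != 0) (g_skew : mul_skew_symmetric g).
Hypotheses (q'_neq0 : forall j, q' j != 0) (g'_skew : mul_skew_symmetric g').
Hypothesis q_nroot : forall j, ~ is_root_of_unity (q j).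
Hypothesis q'_nroot : forall j, ~ is_root_of_unity (q' j).
Variables (M : weyl_model q g) (M' : weyl_model q' g').
Variables (F : {rmorphism M -> M'}) (F' : {rmorphism M' -> M}).
Hypotheses (FK : cancel F F') (F'K : cancel F' F).
Hypothesis Fc : forall c, F (wc M c) = wc M' c.

Local Notation z := (zsum q (wc M) (wx M) (wy M)).
Local Notation z' := (zsum q' (wc M') (wx M') (wy M')).

Lemma F'c c : F' (wc M' c) = wc M c.
Proof. exact: (transport_cst FK Fc). Qed.

Lemma iso_y k : exists s, sim (wc M') (F (wgen M s)) (wy M' k).
Proof.
pose t := F' (wy M' k); have y0 := gen_neq0 q'_neq0 g'_skew q'_nroot M' (inr k).
have t0 : t != 0 by apply: (transport_neq0 F'K).
have [||[s ts]|tn] := @weyl_atomic _ _ _ _ q_neq0 g_skew q_nroot M t t0.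
(* The image of z_j is normal, hence q-commutes with y'_k; this is carried back to the source. *)
- move=> j lej; rewrite -(FK (z j)); apply: (transport_qcomm F'c).
  apply: (normal_qcomm_y q'_neq0 g'_skew q'_nroot).
  exact/(transport_normal FK F'K)/z_normal.
- move=> u v uv; have : F u * F v = wc M' 1 * wy M' k.
    by rewrite -rmorphM uv F'K rmorph1 mul1r.
  move/(y_atomic q'_neq0 g'_skew q'_nroot (oner_neq0 _)).
  by case=> /(transport_scalar F'c); rewrite FK; [left | right].
- by exists s; apply: sim_sym; rewrite -(F'K (wy M' k)); apply: (transport_sim Fc).
(* In the commuting alternative y'_k would commute with the normal element z'_(k+1), with which it
   has the commutation factor q'_k, different from 1. *)
have nz : normal (z' k.+1) by apply: (z_normal q'_neq0 g'_skew q'_nroot).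
have := tn _ (transport_normal F'K FK nz); rewrite -!rmorphM => /(can_inj F'K) e.
have := zsum_y (@wcC _ _ _ _ M') (w_rels M') g'_skew (k := k.+1) k (ltn_ord k).
rewrite ltnSn /qc e => e'.
have : wc M' (q' k - 1) * (wy M' k * z' k.+1) = 0.
  by rewrite rmorphB rmorph1 mulrBl mul1r -e' subrr.
move/eqP => h; exfalso; move: h; apply/negP.
apply: (weyl_mul_neq0 q'_neq0 g'_skew q'_nroot).
  apply/eqP => /eqP; rewrite -(rmorph0 (wc M')) => /eqP.
  move/(wc_inj q'_neq0 g'_skew q'_nroot)/eqP.
  by rewrite subr_eq0 (negPf (q_neq1 q'_nroot k)).
by apply: (weyl_mul_neq0 q'_neq0 g'_skew q'_nroot) => //; case: nz.
Qed.

End ImageOfY.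

Section SignLambda.
Variables (K : fieldType) (n : nat) (q : 'I_n -> K) (s : 'I_n -> bool).

(** The lambda of the statement for boolean signs: the exponent (eps - 1) / 2 is 0 or -1. *)
Fixpoint blam (k : nat) : K :=
  if k is k'.+1 then
    (if insub k' is Some i then if s i then 1 else (q i)^-1 else 1) * blam k'
  else 1.

Lemma blamS (i : 'I_n) : blam i.+1 = (if s i then 1 else (q i)^-1) * blam i.
Proof. by rewrite /= valK. Qed.

End SignLambda.

Section Matched.
Variables (K : fieldType) (n m : nat).
Variables (q : 'I_n -> K) (g : 'M[K]_n) (q' : 'I_m -> K) (g' : 'M[K]_m).
Hypotheses (q_neq0 : forall j, q j != 0) (g_skew : mul_skew_symmetric g).
Hypotheses (q'_neq0 : forall j, q' j != 0) (g'_skew : mul_skew_symmetric g').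
Hypothesis q_nroot : forall j, ~ is_root_of_unity (q j).
Hypothesis q'_nroot : forall j, ~ is_root_of_unity (q' j).
Variables (M : weyl_model q g) (M' : weyl_model q' g').
Variables (F : {rmorphism M -> M'}) (F' : {rmorphism M' -> M}).
Hypotheses (FK : cancel F F') (F'K : cancel F' F).
Hypothesis Fc : forall c, F (wc M c) = wc M' c.

Local Notation z := (zsum q (wc M) (wx M) (wy M)).
Local Notation z' := (zsum q' (wc M') (wx M') (wy M')).

Definition qinv (i : 'I_m) : K := (q' i)^-1.
(** The matrix that condition (ii) prescribes above the diagonal when all signs are -1, completed by
    skew-symmetry. *)
Definition ginv : 'M[K]_m := \matrix_(i, j)
  if (i < j)%N then q' i * g' i j else if (j < i)%N then (q' j * g' j i)^-1 else 1.

Lemma ginv_skew : mul_skew_symmetric ginv.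
Proof.
split=> [i|i j]; first by rewrite mxE ltnn.
have nz k l : q' k * g' k l != 0 by rewrite mulf_neq0 ?g_neq0.
by rewrite !mxE; case: ltngtP => _; rewrite ?mulr1 ?divff ?mulVf.
Qed.

Lemma qinv_nroot i : ~ is_root_of_unity (qinv i).
Proof.
case=> k k0 /unity_rootP; rewrite /qinv exprVn => e; apply: (q'_nroot (j := i)).
by exists k => //; apply/unity_rootP; apply: invr_inj; rewrite e invr1.
Qed.

Lemma ginv_rel : brel q' g' qinv ginv (fun=> false).
Proof. by split=> // i j ij; rewrite mxE ij. Qed.

(* The isomorphism with all signs -1 turns x_k into y_k, so that [iso_y] applies. *)
Lemma iso_x k : exists s, sim (wc M') (F (wgen M s)) (wx M' k).
Proof.
have qi0 i : qinv i != 0 by rewrite invr_eq0.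
pose M2 := weylM qinv ginv.
pose mu1 (_ : 'I_m) : K := 1; have mu10 i : mu1 i != 0 by apply: oner_neq0.
have [G [G' [GK G'K Gc Gx Gy]]] := sign_iso q'_neq0 g'_skew qi0 ginv_skew ginv_rel
  (erefl : blam q' (fun=> false) 0 = 1) (@blamS _ _ q' (fun=> false)) mu10 M' M2.
have GFc c : (G \o F) (wc M c) = wc M2 c by rewrite /= Fc Gc.
have GFK : cancel (G \o F) (F' \o G') by move=> u /=; rewrite GK FK.
have GFK' : cancel (F' \o G') (G \o F) by move=> u /=; rewrite F'K G'K.
have [s es] := iso_y q_neq0 g_skew qi0 ginv_skew q_nroot qinv_nroot GFK GFK' GFc k.
have G'c c : G' (wc M2 c) = wc M' c by rewrite -Gc GK.
exists s; rewrite -(GK (F _)) -(GK (wx M' k)); apply: (transport_sim G'c).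
rewrite Gx rmorph1 mul1r; exact: es.
Qed.

(** The boolean tells whether x_i goes to x'_k or to y'_k, up to a scalar. *)
Definition matched (i : 'I_n) (k : 'I_m) (s : bool) :=
  sim (wc M') (F (wx M i)) (wgenb M' s k) /\
  sim (wc M') (F (wy M i)) (wgenb M' (~~ s) k).

Lemma qcomm_simr (B : pzRingType) (iB : {rmorphism K -> B}) (a b a' b' : B) :
  (forall c u, iB c * u = u * iB c) ->
  sim iB a a' -> sim iB b b' -> qcomm iB a b -> qcomm iB a' b'.
Proof.
move=> iC /sim_sym[c c0 ->] /sim_sym[d d0 ->] [e e0 ab]; exists e => //.
by apply: qc_scalel => //; apply: qc_scaler.
Qed.

(* Generators of different indices q-commute, whereas x_k and y_k do not. *)
Lemma matched_total k : exists i s, matched i k s.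
Proof.
have [s es] := iso_y q_neq0 g_skew q'_neq0 g'_skew q_nroot q'_nroot FK F'K Fc k.
have [t et] := iso_x k.
have nst : ~ qcomm (wc M) (wgen M t) (wgen M s).
  move=> /(transport_qcomm Fc)/(qcomm_simr (@wcC _ _ _ _ M') et es).
  exact: (xy_nqcomm q'_neq0 g'_skew q'_nroot).
have nn u : qcomm (wc M) u u by exists 1; rewrite ?oner_neq0 //; apply/qc_comm.
case: t s et es nst => [i|i] [j|j] et es nst.
- case: nst; have [->|/(qcomm_gens q_neq0 g_skew M)[]//] := eqVneq i j; exact: nn.
- have [e|/(qcomm_gens q_neq0 g_skew M)[]//] := eqVneq i j; subst j.
  by exists i, true.
- have [e|/(qcomm_gens q_neq0 g_skew M)[]//] := eqVneq i j; subst j.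
  by exists i, false.
- case: nst; have [->|/(qcomm_gens q_neq0 g_skew M)[]//] := eqVneq i j; exact: nn.
Qed.

(* F(z_i) is normal and a combination of z'_k and z'_(k+1), so one of the two
   coefficients vanishes; the one of z'_k does not. *)
Lemma matched_z (i : 'I_n) (k : 'I_m) s mu nu : mu != 0 -> nu != 0 ->
    F (wx M i) = wc M' mu * wgenb M' s k -> F (wy M i) = wc M' nu * wgenb M' (~~ s) k ->
  q' k = (if s then q i else (q i)^-1) /\
  exists c, [/\ c != 0, F (z i) = wc M' c * z' k,
    F (z i.+1) = wc M' ((if s then 1 else (q i)^-1) * c) * z' k.+1 &
    nu * mu = (if s then 1 else -1) * ((if s then 1 else (q i)^-1) * c)].
Proof.
move=> mu0 nu0 Fx Fy.
have iC := @wcC _ _ _ _ M'.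
have wcA a b u : wc M' a * (wc M' b * u) = wc M' (a * b) * u.
  by rewrite mulrA -rmorphM.
have qm1 : q i - 1 != 0 by rewrite subr_eq0 (q_neq1 q_nroot).
have q'm1 : q' k - 1 != 0 by rewrite subr_eq0 (q_neq1 q'_nroot).
pose d := nu * mu; have d0 : d != 0 by rewrite mulf_neq0.
have Fxy : F (wx M i * wy M i) = wc M' d * (wgenb M' s k * wgenb M' (~~ s) k).
  rewrite rmorphM Fx Fy -mulrA [wgenb M' s k * (_ * _)]mulrA -iC !mulrA -rmorphM.
  by rewrite [mu * nu]mulrC.
have Fyx : F (wy M i * wx M i) = wc M' d * (wgenb M' (~~ s) k * wgenb M' s k).
  by rewrite rmorphM Fx Fy -mulrA [wgenb M' (~~ s) k * (_ * _)]mulrA -iC !mulrA -rmorphM.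
(* The last defining relation is solved for z_i, so that F(z_i) and F(z_(i+1)) are computed from the
   images of x_i and y_i. *)
have e1 : F (z i) = F (wx M i * wy M i) - wc M' (q i) * F (wy M i * wx M i).
  by rewrite -Fc -rmorphM -rmorphB (rel_xy_eq (w_rels M)) addrK.
have e2 : F (z i.+1) = F (z i) + wc M' (q i - 1) * F (wy M i * wx M i).
  by rewrite -Fc -rmorphM -rmorphD -zsumS.
have nzi : normal (F (z i)).
  by apply/(transport_normal FK F'K)/(z_normal q_neq0 g_skew q_nroot)/ltnW.
rewrite {}Fxy {}Fyx in e1 e2.
pose p := (q' k - 1)^-1.
(* All elements below are combinations of z'_(k+1) and z'_k, so their equalities reduce to field
   identities between coefficients. *)
pose lc a b : M' := wc M' a * z' k.+1 + wc M' b * z' k.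
have lcZ c a b : wc M' c * lc a b = lc (c * a) (c * b).
  by rewrite /lc (mulrDr (wc M' c)) !wcA.
have lcD a b a' b' : lc a b + lc a' b' = lc (a + a') (b + b').
  by rewrite /lc addrACA -!mulrDl -!rmorphD.
have lcN a b : - lc a b = lc (- a) (- b).
  by rewrite /lc opprD -!mulNr -!rmorphN.
have lc0r a : lc a 0 = wc M' a * z' k.+1 by rewrite /lc rmorph0 mul0r addr0.
have lc0l b : lc 0 b = wc M' b * z' k by rewrite /lc rmorph0 mul0r add0r.
have xy : wx M' k * wy M' k = lc (p * q' k) (- p).
  have -> : wx M' k * wy M' k = wc M' p * (wc M' (q' k - 1) * (wx M' k * wy M' k)).
    by rewrite wcA mulVf // rmorph1 mul1r.
  rewrite (xy_zsum (w_rels M')).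
  have -> : wc M' (q' k) * z' k.+1 - z' k = lc (q' k) (-1).
    by rewrite /lc rmorphN1 mulN1r.
  by rewrite lcZ mulrN1.
have yx : wy M' k * wx M' k = lc p (- p).
  have -> : wy M' k * wx M' k = wc M' p * (wc M' (q' k - 1) * (wy M' k * wx M' k)).
    by rewrite wcA mulVf // rmorph1 mul1r.
  rewrite yx_zsum; have -> : z' k.+1 - z' k = lc 1 (-1).
    by rewrite /lc rmorphN1 mulN1r rmorph1 mul1r.
  by rewrite lcZ mulrN1 mulr1.
have q0 := q_neq0 i; have q'0 := q'_neq0 k.
have dp0 : d * p != 0 by rewrite mulf_neq0 ?invr_eq0.
case: s Fx Fy e1 e2 => _ _; rewrite /wgenb /= xy yx => e1 e2.
- have {}e1 : F (z i) = lc (d * p * (q' k - q i)) (d * p * (q i - 1)).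
    by rewrite e1 !lcZ lcN lcD; congr lc; ring.
  have eq' : q' k = q i.
    have := nzi; rewrite e1 => /(z_comb_normal q'_neq0 g'_skew q'_nroot)[] /eqP.
      by rewrite mulf_eq0 (negPf dp0) subr_eq0 => /eqP.
    by rewrite mulf_eq0 (negPf dp0) (negPf qm1).
  have {}e1 : F (z i) = lc 0 d.
    by rewrite e1 /p eq'; congr lc; field.
  split=> //; exists d; split=> //; [by rewrite e1 lc0l | rewrite e2 e1 !lcZ lcD | by rewrite !mul1r].
  rewrite mul1r -lc0r /p eq'; congr lc; field; exact: qm1.
- have {}e1 : F (z i) = lc (d * p * (1 - q i * q' k)) (d * p * (q i - 1)).
    by rewrite e1 !lcZ lcN lcD; congr lc; ring.
  have eq' : q' k = (q i)^-1.
    have := nzi; rewrite e1 => /(z_comb_normal q'_neq0 g'_skew q'_nroot)[] /eqP.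
      rewrite mulf_eq0 (negPf dp0) subr_eq0 => /eqP e.
      by apply: (mulfI q0); rewrite -e divff.
    by rewrite mulf_eq0 (negPf dp0) (negPf qm1).
  have q1m : 1 - q i != 0 by rewrite -opprB oppr_eq0.
  have {}e1 : F (z i) = lc 0 (- (d * q i)).
    by rewrite e1 /p eq'; congr lc; field; rewrite ?mulN1r ?q0 ?q1m.
  (* With q'_k = q_i^-1 the coefficient d p (q_i - 1) of z'_k simplifies to - d q_i. *)
  split=> //; exists (- (d * q i)); split.
  + by rewrite oppr_eq0 mulf_neq0.
  + by rewrite e1 lc0l.
  + rewrite e2 e1 !lcZ lcD -lc0r /p eq'; congr lc; field; by rewrite ?mulN1r ?q0 ?q1m.
  + by rewrite -/d; field.
Qed.

Lemma matched_scalars (i : 'I_n) (k : 'I_m) s : matched i k s ->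
  exists mu nu, [/\ mu != 0, nu != 0, F (wx M i) = wc M' mu * wgenb M' s k &
    F (wy M i) = wc M' nu * wgenb M' (~~ s) k].
Proof. by move=> [[mu mu0 Fx] [nu nu0 Fy]]; exists mu, nu. Qed.

Lemma matched_zsim (i : 'I_n) (k : 'I_m) s : matched i k s ->
  sim (wc M') (F (z i)) (z' k) /\ sim (wc M') (F (z i.+1)) (z' k.+1).
Proof.
case/matched_scalars => mu [nu [mu0 nu0 Fx Fy]].
have [_ [c [c0 e1 e2 _]]] := matched_z mu0 nu0 Fx Fy.
split; first by exists c.
exists ((if s then 1 else (q i)^-1) * c) => //; rewrite mulf_neq0 //.
by case: (s); rewrite ?oner_neq0 ?invr_eq0.
Qed.

End Matched.

Section Matching.
Variables (K : fieldType) (n m : nat).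
Variables (q : 'I_n -> K) (g : 'M[K]_n) (q' : 'I_m -> K) (g' : 'M[K]_m).
Hypotheses (q_neq0 : forall j, q j != 0) (g_skew : mul_skew_symmetric g).
Hypotheses (q'_neq0 : forall j, q' j != 0) (g'_skew : mul_skew_symmetric g').
Hypothesis q_nroot : forall j, ~ is_root_of_unity (q j).
Hypothesis q'_nroot : forall j, ~ is_root_of_unity (q' j).
Variables (M : weyl_model q g) (M' : weyl_model q' g').
Variables (F : {rmorphism M -> M'}) (F' : {rmorphism M' -> M}).
Hypotheses (FK : cancel F F') (F'K : cancel F' F).
Hypothesis Fc : forall c, F (wc M c) = wc M' c.

(** Obtained from [matched_total] for the inverse. The sign is unchanged, since exchanging x and y
    is an involution. *)
Lemma matched_total_left i : exists k s, matched F i k s.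
Proof.
have F'c c : F' (wc M' c) = wc M c := transport_cst FK Fc c.
have [k [s [sx sy]]] := matched_total q'_neq0 g'_skew q_neq0 g_skew q'_nroot q_nroot F'K FK F'c i.
have := transport_sim Fc sx; have := transport_sim Fc sy; rewrite !F'K => {}sy {}sx.
by exists k, s; case: s sx sy => sx sy; split; apply: sim_sym.
Qed.

(** Distinct z'_k are not proportional. For i = 0, z'_k is proportional to 1 = z'_0. Otherwise the
    predecessor of i is matched with its own index, which determines the image of z_i up to a
    scalar, hence k. *)
Lemma matched_eq i k s : matched F i k s -> i = k :> nat.
Proof.
have zsim := matched_zsim q_neq0 g_skew q'_neq0 g'_skew q_nroot q'_nroot FK F'K Fc.
have z'sim := @z_sim _ _ _ _ q'_neq0 g'_skew q'_nroot M'.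
have [N] := ubnP (i : nat); elim: N => // N IHN in i k s *.
rewrite ltnS => iN ms; have [zi _] := zsim _ _ _ ms.
have lek := ltnW (ltn_ord k).
case: i zi ms iN => -[|i0] lti zi ms iN /=.
  apply: z'sim => //; rewrite zsum0; apply: sim_trans zi.
  rewrite zsum0 rmorph1; exact: sim_refl.
pose j := Ordinal (ltnW lti); have [l [t mj]] := matched_total_left j.
have e : j = l :> nat by apply: IHN mj; apply: iN.
have [_ zj] := zsim _ _ _ mj; rewrite [RHS](_ : _ = l.+1); first by rewrite -e.
apply/esym/z'sim => //; apply: sim_trans (sim_sym zj) _; exact: zi.
Qed.

(** Every index below n is matched with an equal index, which is below m. The inverse isomorphism
    gives the other inequality. *)
Lemma matched_leq : (n <= m)%N.
Proof.
rewrite leqNgt; apply/negP => ltmn.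
have [k [s /matched_eq /= e]] := matched_total_left (Ordinal ltmn).
by have := ltn_ord k; rewrite -e ltnn.
Qed.

End Matching.

Section Classification.
Variables (K : fieldType) (n : nat) (q q' : 'I_n -> K) (g g' : 'M[K]_n).
Hypotheses (q_neq0 : forall j, q j != 0) (g_skew : mul_skew_symmetric g).
Hypotheses (q'_neq0 : forall j, q' j != 0) (g'_skew : mul_skew_symmetric g').
Hypothesis q_nroot : forall j, ~ is_root_of_unity (q j).
Hypothesis q'_nroot : forall j, ~ is_root_of_unity (q' j).
Variables (M : weyl_model q g) (M' : weyl_model q' g').
Variables (F : {rmorphism M -> M'}) (F' : {rmorphism M' -> M}).
Hypotheses (FK : cancel F F') (F'K : cancel F' F).
Hypothesis Fc : forall c, F (wc M c) = wc M' c.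

Local Notation z := (zsum q (wc M) (wx M) (wy M)).
Local Notation z' := (zsum q' (wc M') (wx M') (wy M')).

Lemma wc_mulI c d (u : M') : u != 0 -> wc M' c * u = wc M' d * u -> c = d.
Proof.
move=> u0 /eqP; rewrite -subr_eq0 -mulrBl -rmorphB => e.
apply/eqP; rewrite -subr_eq0; apply: contraTT e => cd.
apply: (weyl_mul_neq0 q'_neq0 g'_skew q'_nroot) => //.
apply: contraNneq cd; rewrite -(rmorph0 (wc M')).
by move/(wc_inj q'_neq0 g'_skew q'_nroot) ->.
Qed.

Lemma iso_classification : exists s mu, [/\ forall i, mu i != 0, brel q g q' g' s,
  forall i, F (wx M i) = wc M' (mu i) * wgenb M' (s i) i &
  forall i, F (wy M i) = wc M' (nu s (blam q s) mu i) * wgenb M' (~~ s i) i].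
Proof.
have tot i : exists t : bool * K * K, [/\ t.1.2 != 0, t.2 != 0,
    F (wx M i) = wc M' t.1.2 * wgenb M' t.1.1 i &
    F (wy M i) = wc M' t.2 * wgenb M' (~~ t.1.1) i].
  have [k [s ms]] := matched_total_left q_neq0 g_skew q'_neq0 g'_skew q_nroot q'_nroot FK F'K Fc i.
  have e : i = k.
    apply/val_inj; exact: (matched_eq q_neq0 g_skew q'_neq0 g'_skew q_nroot q'_nroot FK F'K Fc ms).
  subst k; have [mu [nu [mu0 nu0 Fx Fy]]] := matched_scalars ms.
  by exists (s, mu, nu).
have [t Ht] := choice tot; pose s i := (t i).1.1; pose mu i := (t i).1.2; pose nu0 i := (t i).2.
have mu0 i : mu i != 0 by case: (Ht i).
have nu00 i : nu0 i != 0 by case: (Ht i).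
have Fx i : F (wx M i) = wc M' (mu i) * wgenb M' (s i) i by case: (Ht i).
have Fy i : F (wy M i) = wc M' (nu0 i) * wgenb M' (~~ s i) i by case: (Ht i).
have mz i := matched_z q_neq0 g_skew q'_neq0 g'_skew q_nroot q'_nroot FK F'K Fc
  (mu0 i) (nu00 i) (Fx i) (Fy i).
have z'0 k : (k <= n)%N -> z' k != 0.
  by move=> lek; case: (z_normal q'_neq0 g'_skew q'_nroot M' lek).
(* [matched_z] leaves one unknown scalar per index; chaining them from z_0 = 1 identifies these with
   the lambdas. *)
have Fz k : (k <= n)%N -> F (z k) = wc M' (blam q s k) * z' k.
  elim: k => [|k IHk] ltk; first by rewrite !zsum0 !rmorph1 mul1r.
  pose j := Ordinal ltk; have [_ [c [c0 e1 e2 _]]] := mz j.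
  have ec : blam q s k = c.
    apply: (wc_mulI (z'0 _ (ltnW ltk))).
    exact: (etrans (esym (IHk (ltnW ltk))) e1).
  by apply: etrans e2 _; rewrite -ec -(blamS q s j).
exists s, mu; split=> // [|i].
  have rq i : q' i = if s i then q i else (q i)^-1 by case: (mz i).
  split=> // i j ij.
  have gen0 b k : wgenb M' b k != 0.
    by case: b; [apply: (gen_neq0 _ _ _ _ (inl k)) | apply: (gen_neq0 _ _ _ _ (inr k))].
  (* The images of y_i and y_j are generators up to scalars; comparing their commutation factor in
     the target with [g i j] determines [g' i j] for each pair of signs. *)
  have := congr1 F (rel_yy (w_rels M) i j); rewrite !(rmorphM F) Fc !Fy.
  have iC := @wcC _ _ _ _ M'.
  have sc k l b b' : wc M' (nu0 k) * wgenb M' b k * (wc M' (nu0 l) * wgenb M' b' l) =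
     wc M' (nu0 k * nu0 l) * (wgenb M' b k * wgenb M' b' l).
    by rewrite rmorphM -!mulrA; congr (_ * _); rewrite mulrA -iC -mulrA.
  have := wgenb_qc M' (~~ s i) (~~ s j) q'_neq0 g'_skew ij; rewrite /qc => e.
  rewrite !sc e !mulrA -!(rmorphM (wc M')) -![wc M' _ * _ * _]mulrA => h.
  have {h} := wc_mulI (weyl_mul_neq0 q'_neq0 g'_skew q'_nroot (gen0 _ _) (gen0 _ _)) h.
  have nn : nu0 i * nu0 j != 0 by rewrite mulf_neq0.
  rewrite mulrC [nu0 j * _]mulrC => /(mulIf nn).
  rewrite rq /ctab; have q0 := q_neq0 i.
  case: (s i); case: (s j) => /= e'.
  - by [].
  - by rewrite -(g_inv g_skew i j) -e' invrK mulKf.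
  - by rewrite -(g_inv g_skew i j) -e' invrK.
  - by rewrite -e' mulVKf.
rewrite Fy; congr (wc M' _ * _).
have [_ [c [c0 e1 e2 e3]]] := mz i; apply: (mulIf (mu0 i)); rewrite e3 /nu divfK //.
rewrite blamS; congr (_ * (_ * _)).
have lei := ltnW (ltn_ord i); apply: (wc_mulI (z'0 _ lei)).
exact: (etrans (esym e1) (Fz _ lei)).
Qed.

(** The images of the x_i are enough: distinct generators are not proportional, which fixes the
    signs and then the scalars. *)
Lemma params_unique (s s' : 'I_n -> bool) (mu mu' : 'I_n -> K) :
    (forall i, mu i != 0) -> (forall i, mu' i != 0) ->
    (forall i, wc M' (mu i) * wgenb M' (s i) i = wc M' (mu' i) * wgenb M' (s' i) i) ->
  mu = mu' /\ s = s'.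
Proof.
move=> mu0 mu'0 e.
have gE b i : wgenb M' b i = wgen M' (if b then inl i else inr i) by case: b.
have es i : s i = s' i.
  have : sim (wc M') (wgenb M' (s i) i) (wgenb M' (s' i) i).
    apply: sim_trans (_ : sim _ (wc M' (mu i) * wgenb M' (s i) i) _).
      by apply: sim_sym; exists (mu i).
    by rewrite e; exists (mu' i).
  rewrite !gE => /(gen_sim q'_neq0 g'_skew q'_nroot).
  by case: (s i); case: (s' i).
split; apply: funext => i; last exact: es.
have := e i; rewrite -es gE; apply: wc_mulI.
exact: gen_neq0.
Qed.

End Classification.

Local Open Scope classical_set_scope.

(** * Isomorphisms of the presented algebras *)

Section AlgebraIso.
Variables (K : fieldType) (n m : nat) (q : 'I_n -> K) (g : 'M[K]_n).
Variables (q' : 'I_m -> K) (g' : 'M[K]_m).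

Local Notation M := (weylM q g).
Local Notation M' := (weylM q' g').

Lemma algebra_iso_rmorphism (f : weyl q g -> weyl q' g') : algebra_iso f ->
  exists (F : {rmorphism M -> M'}) (F' : {rmorphism M' -> M}),
    [/\ cancel F F', cancel F' F, forall c, F (wc M c) = wc M' c & f = F].
Proof.
case=> flin [f1 fM] [f' fK f'K].
have fZ c u : f (c *: u) = c *: f u.
  have f0 : f 0 = 0 by have := flin (-1) 0 0; rewrite scaler0 add0r scaleN1r addNr.
  by have := flin c u 0; rewrite f0 !addr0.
have fB : {morph f : u v / u - v}.
  by move=> u v; have := flin (-1) v u; rewrite !scaleN1r ![- _ + _]addrC.
pose F := HB.pack_for {rmorphism M -> M'} f
  (GRing.isZmodMorphism.Build M M' f fB)
  (GRing.isMonoidMorphism.Build M M' f (f1, fM)).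
have f'B : {morph f' : u v / u - v}.
  by move=> u v; apply: (can_inj fK); rewrite f'K fB !f'K.
have f'1 : f' 1 = 1 by apply: (can_inj fK); rewrite f'K f1.
have f'M : {morph f' : u v / u * v}.
  by move=> u v; apply: (can_inj fK); rewrite f'K fM !f'K.
pose F' := HB.pack_for {rmorphism M' -> M} f'
  (GRing.isZmodMorphism.Build M' M f' f'B)
  (GRing.isMonoidMorphism.Build M' M f' (f'1, f'M)).
exists F, F'; split=> // c.
by rewrite [LHS]fZ f1.
Qed.

Lemma rmorphism_algebra_iso (F : {rmorphism M -> M'}) (F' : {rmorphism M' -> M}) :
    cancel F F' -> cancel F' F -> (forall c, F (wc M c) = wc M' c) ->
  algebra_iso (F : weyl q g -> weyl q' g').
Proof.
move=> FK F'K Fc; split; last by exists F'.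
- by move=> c u v; rewrite -[c *: u]weyl_cstE -[c *: F u]weyl_cstE rmorphD rmorphM Fc.
- by split; [apply: rmorph1 | apply: rmorphM].
Qed.

Lemma algebra_iso_ext (f f' : weyl q g -> weyl q' g') :
    algebra_iso f -> algebra_iso f' ->
    (forall i, f (weyl_x q g i) = f' (weyl_x q g i)) ->
    (forall i, f (weyl_y q g i) = f' (weyl_y q g i)) -> f = f'.
Proof.
move=> /algebra_iso_rmorphism[F [_ [_ _ Fc ->]]].
move=> /algebra_iso_rmorphism[F1 [_ [_ _ F1c ->]]] ex ey.
by apply: funext; apply: (@w_ext _ _ _ _ M M' F F1) => // c; rewrite Fc F1c.
Qed.

Lemma algebra_iso_size : (forall i, q i != 0) -> (forall i, q' i != 0) ->
    mul_skew_symmetric g -> mul_skew_symmetric g' ->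
    (forall i, ~ is_root_of_unity (q i)) -> (forall i, ~ is_root_of_unity (q' i)) ->
  (exists f : weyl q g -> weyl q' g', algebra_iso f) -> n = m.
Proof.
move=> q0 q'0 gs g's qr q'r [f /algebra_iso_rmorphism[F [F' [FK F'K Fc _]]]].
have F'c c : F' (wc M' c) = wc M c := transport_cst FK Fc c.
apply/eqP; rewrite eqn_leq.
by rewrite (matched_leq q0 gs q'0 g's qr q'r FK F'K Fc) (matched_leq q'0 g's q0 gs q'r qr F'K FK F'c).
Qed.

End AlgebraIso.

(** * Signs, parameters and isomorphisms for equal numbers of generators *)

Section SameSize.
Variables (K : fieldType) (n : nat) (q q' : 'I_n -> K) (g g' : 'M[K]_n).
Hypotheses (q_neq0 : forall j, q j != 0) (g_skew : mul_skew_symmetric g).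
Hypotheses (q'_neq0 : forall j, q' j != 0) (g'_skew : mul_skew_symmetric g').

Local Notation M := (weylM q g).
Local Notation M' := (weylM q' g').
Local Notation e := (erefl n).

Definition sign_of (eps : 'I_n -> int) (i : 'I_n) := eps i == 1.
Definition eps_of (s : 'I_n -> bool) (i : 'I_n) : int := if s i then 1 else -1.

Lemma sign_of_eps s : sign_of (eps_of s) = s.
Proof. by apply: funext => i; rewrite /sign_of /eps_of; case: (s i). Qed.

Lemma eps_of_sign eps : sign_vector eps -> eps_of (sign_of eps) = eps.
Proof.
by move=> se; apply: funext => i; rewrite /sign_of /eps_of; case: (se i) => ->.
Qed.

Lemma eps_of_vector s : sign_vector (eps_of s).
Proof. by move=> i; rewrite /eps_of; case: (s i); [left | right]. Qed.

Lemma sign_related_brel s : sign_related q g q' g' e (eps_of s) <-> brel q g q' g' s.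
Proof.
have es i : (eps_of s i == 1) = s i by rewrite -[RHS](congr1 (@^~ i) (sign_of_eps s)).
split=> -[hq hg]; split=> [i|i j ij].
- by have := hq i; rewrite cast_ord_id => ->; rewrite /eps_of; case: (s i).
- by have := hg i j ij; rewrite !cast_ord_id !es.
- by rewrite cast_ord_id hq /eps_of; case: (s i).
- by rewrite !cast_ord_id !es; apply: hg.
Qed.

Lemma lambda_blam s k : lambda q (eps_of s) k = blam q s k.
Proof.
elim: k => //= k ->; congr (_ * _); case: insubP => //= i _ _.
by rewrite /eps_of; case: (s i).
Qed.

Lemma weyl_genE c b i : wc M' c * wgenb M' b i =
  c *: (if b then weyl_x q' g' i else weyl_y q' g' i).
Proof. by case: b; apply: weyl_cstE. Qed.

Lemma std_imagesE s mu (F : {rmorphism M -> M'}) :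
  std_images e mu (eps_of s) F <->
  (forall i, F (wx M i) = wc M' (mu i) * wgenb M' (s i) i) /\
  (forall i, F (wy M i) = wc M' (nu s (blam q s) mu i) * wgenb M' (~~ s i) i).
Proof.
have es i : (eps_of s i == 1) = s i by rewrite -[RHS](congr1 (@^~ i) (sign_of_eps s)).
have nuE i : nu s (blam q s) mu i =
    if s i then blam q s i.+1 / mu i else - (blam q s i.+1 / mu i).
  by rewrite /nu; case: (s i); rewrite ?mul1r ?mulN1r ?mulNr.
split=> [H|[Hx Hy] i].
  split=> i; rewrite weyl_genE; have := H i; rewrite es cast_ord_id lambda_blam ?nuE.
    by case: (s i) => -[Hx _]; exact: Hx.
  by case: (s i) => -[_ Hy]; exact: Hy.
have hx := Hx i; have hy := Hy i; rewrite weyl_genE in hx; rewrite weyl_genE nuE in hy.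
rewrite es cast_ord_id lambda_blam; case: (s i) hx hy => hx hy.
  by split; [exact: hx | exact: hy].
by split; [exact: hx | exact: hy].
Qed.

Lemma iso_exists p : iso_params q g q' g' e p ->
  exists f : weyl q g -> weyl q' g', algebra_iso f /\ std_images e p.1 p.2 f.
Proof.
case: p => mu eps [/= mu0 se]; rewrite -(eps_of_sign se) => /sign_related_brel rel.
have [F [F' [FK F'K Fc Fx Fy]]] := sign_iso q_neq0 g_skew q'_neq0 g'_skew rel
  (erefl : blam q (sign_of eps) 0 = 1) (@blamS _ _ q (sign_of eps)) mu0 M M'.
exists F; split; first exact: rmorphism_algebra_iso FK F'K Fc.
exact: (proj2 (std_imagesE (sign_of eps) mu F) (conj Fx Fy)).
Qed.

Lemma iso_unique mu eps (f f' : weyl q g -> weyl q' g') :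
    algebra_iso f -> std_images e mu eps f ->
    algebra_iso f' -> std_images e mu eps f' -> f = f'.
Proof.
move=> If Sf If' Sf'; apply: algebra_iso_ext => // i.
- by have [-> _] := Sf i; have [-> _] := Sf' i.
- by have [_ ->] := Sf i; have [_ ->] := Sf' i.
Qed.

Hypothesis q_nroot : forall j, ~ is_root_of_unity (q j).
Hypothesis q'_nroot : forall j, ~ is_root_of_unity (q' j).

Lemma iso_params_exist (f : weyl q g -> weyl q' g') : algebra_iso f ->
  exists p, iso_params q g q' g' e p /\ std_images e p.1 p.2 f.
Proof.
move=> /algebra_iso_rmorphism[F [F' [FK F'K Fc ->]]].
have [s [mu [mu0 rel Fx Fy]]] := iso_classification q_neq0 g_skew q'_neq0 g'_skew
  q_nroot q'_nroot FK F'K Fc.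
exists (mu, eps_of s); split.
  by split=> //=; [apply: eps_of_vector | apply/sign_related_brel].
exact: (proj2 (std_imagesE s mu F) (conj Fx Fy)).
Qed.

Lemma iso_params_unique p p' (f : weyl q g -> weyl q' g') : algebra_iso f ->
    iso_params q g q' g' e p -> iso_params q g q' g' e p' ->
    std_images e p.1 p.2 f -> std_images e p'.1 p'.2 f -> p = p'.
Proof.
move=> /algebra_iso_rmorphism[F [_ [_ _ _ ->]]].
case: p p' => mu eps [mu' eps'] [/= mu0 se _] [/= mu'0 se' _].
rewrite -(eps_of_sign se) -(eps_of_sign se').
move: (sign_of eps) (sign_of eps') => s s' /std_imagesE[fx _] /std_imagesE[fx' _].
have [|-> -> //] := params_unique q'_neq0 g'_skew q'_nroot mu0 mu'0 (M' := M') (s := s) (s' := s').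
by move=> i; exact: (etrans (esym (fx i)) (fx' i)).
Qed.

End SameSize.

Theorem theorem5p1 (K : fieldType) (n m : nat) (n_gt0 : (0 < n)%N)
    (m_gt0 : (0 < m)%N) (q : 'I_n -> K) (g : 'M[K]_n) (q' : 'I_m -> K)
    (g' : 'M[K]_m) (q_neq0 : forall i, q i != 0)
    (q'_neq0 : forall i, q' i != 0) (g_skew : mul_skew_symmetric g)
    (g'_skew : mul_skew_symmetric g') :
  ((forall i, ~ is_root_of_unity (q i)) ->
   (forall i, ~ is_root_of_unity (q' i)) ->
   ((exists f : weyl q g -> weyl q' g', algebra_iso f) <->
    exists (e : n = m) (eps : 'I_n -> int),
      sign_vector eps /\ sign_related q g q' g' e eps)) /\
  (forall e : n = m,
   (exists eps, sign_vector eps /\ sign_related q g q' g' e eps) ->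
   exists phi : ('I_n -> K) * ('I_n -> int) -> weyl q g -> weyl q' g',
     (forall mu eps, iso_params q g q' g' e (mu, eps) ->
        unique (fun f => algebra_iso f /\ std_images e mu eps f)
               (phi (mu, eps))) /\
     ((forall i, ~ is_root_of_unity (q i)) ->
      (forall i, ~ is_root_of_unity (q' i)) ->
      set_bij (iso_params q g q' g' e)
        (algebra_iso (q := q) (g := g) (q' := q') (g' := g')) phi)).
Proof.
split=> [qr q'r|e _].
  split=> [iso_ex|[e [eps [se rel]]]]; last first.
    (* Any scalars will do for existence; all are taken to be 1. *)
    subst m; have [|f [If _]] := @iso_exists _ _ q q' g g' q_neq0 g_skew q'_neq0 g'_skew
      (fun=> 1, eps).
      by split=> //= i; apply: oner_neq0.
    by exists f.
  have e := algebra_iso_size q_neq0 q'_neq0 g_skew g'_skew qr q'r iso_ex.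
  subst m; exists erefl; case: iso_ex => f If.
  have [[mu eps] [[_ se rel] _]] := iso_params_exist q_neq0 g_skew q'_neq0 g'_skew qr q'r If.
  by exists eps.
subst m.
(* [phi] is a total function obtained by choice, so the implication is put under the existential;
   outside [iso_params] the value is the zero map. *)
have ex p : exists f : weyl q g -> weyl q' g', iso_params q g q' g' erefl p ->
    algebra_iso f /\ std_images erefl p.1 p.2 f.
  have [/(iso_exists q_neq0 g_skew q'_neq0 g'_skew)[f Hf]|nP] :=
    pselect (iso_params q g q' g' erefl p); first by exists f.
  by exists (fun=> 0).
have [phi Hphi] := choice ex; exists phi; split=> [mu eps P|qr q'r].
  split; first exact: (Hphi (mu, eps)).
  move=> f [If Sf]; have [Ip Sp] := Hphi _ P.
  exact: iso_unique Ip Sp If Sf.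
split.
- by move=> p /Hphi[].
- move=> p p' /set_mem P /set_mem P' ephi.
  have [_ Sp] := Hphi _ P; have [_ Sp'] := Hphi _ P'.
  have Ip := (Hphi _ P).1.
  rewrite -ephi in Sp'; exact: (iso_params_unique q'_neq0 g'_skew q'r Ip P P' Sp Sp').
- move=> f If; have [[mu eps] [P Sf]] :=
    iso_params_exist q_neq0 g_skew q'_neq0 g'_skew qr q'r If.
  exists (mu, eps) => //; have [Ip Sp] := Hphi _ P.
  exact: iso_unique Ip Sp If Sf.
Qed.
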